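(* Assume the $abc$-conjecture. Then there exist absolute constants $c>0$ and $C>0$ such that for all real $x \ge 1$ and all real $y$ with $1 \le y \le x$, \[ Q_2(x+y) - Q_2(x) \le C\,\frac{y}{\log^{1+c}(y+1)}. \]
   Context: A positive integer $n$ is squarefull if every prime $p$ dividing $n$ satisfies $p^2\mid n$. $Q_2(x)$ denotes the number of squarefull positive integers $n \le x$. For a nonzero integer $m$, $\kappa(m)=\prod_{p\mid m} p$. The $abc$-conjecture is the statement: for every $\epsilon>0$ there is a constant $C_\epsilon>0$ such that for all integers $a,b,c$ with $a+b=c$ and $\gcd(a,b)=1$, one has $\max\{|a|,|b|,|c|\} \le C_\epsilon\, \kappa(abc)^{1+\epsilon}$. *)

(* Defs.v *)
From mathcomp Require Import all_boot.
From Stdlib Require Import Reals ZArith.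

Definition squarefull (n : nat) : bool :=
  (0 < n) && all (fun p => p ^ 2 %| n) (primes n).

(* floor of a real number, as a nat (0 for negative reals). *)
Definition floor_nat (x : R) : nat := Z.to_nat (Int_part x).

Definition Q2 (x : R) : nat := count squarefull (iota 1 (floor_nat x)).

Definition kappa (m : Z) : R :=
  INR (\prod_(p <- primes (Z.abs_nat m)) p)%N.

Definition abc_conjecture : Prop :=
  forall eps : R, (0 < eps)%R ->
  exists Ceps : R, (0 < Ceps)%R /\
  forall a b c : Z, a <> 0%Z -> b <> 0%Z -> c <> 0%Z ->
    (a + b = c)%Z -> Z.gcd a b = 1%Z ->
    (IZR (Z.max (Z.abs a) (Z.max (Z.abs b) (Z.abs c)))
       <= Ceps * Rpower (kappa (a * b * c)) (1 + eps))%R.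

(* Main.v *)
(** For y <= x^(9/40) the abc-conjecture forbids three squarefull numbers n - d, n, n + d in (x, x + y]
    once x is large: after division by the gcd, the identity (n - d)(n + d) + d^2 = n^2 would have a
    radical of order at most n^(3/2) d^2. The squarefull numbers of the interval thus form a set without
    3-term arithmetic progressions, so there are O(y / log^2 y) of them, and c = 1 works. For
    y > x^(9/40) it suffices to write n = a^2 b^3 and to count, and bounded x are absorbed in C.

    The bound N / log^2 N for progression-free subsets of an interval of length N is beyond the reach of
    Roth's original argument; it follows from the method of Kelley and Meka, in a quantitatively weak
    form. In a cyclic group of odd order, a progression-free set A of relative density a on a Bohr set
    has far too few representations x + z = 2y, so a high moment of the balanced convolution is large.
    By positivity of the moments of autocorrelations (Cauchy--Schwarz) and unbalancing, the
    autocorrelation of A exceeds 9/8 of its mean on most differences of a dense set A1 found by sifting.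
    Croot--Sisask sampling yields many almost-periods of the corresponding averages, and Chang's lemma,
    proved with Riesz products, turns them into a Bohr set of polylogarithmic rank on a translate of
    which A has density at least (1 + 1/200) a. Iterating contradicts the bound 1 on the density. *)
From mathcomp Require Import all_boot.
From mathcomp Require all_order all_algebra finalg archimedean ring lra zify.
From mathcomp Require reals sequences exp trigo Rstruct.
Require Import Defs.
From Stdlib Require Import Reals ZArith Lra Psatz.
Set Implicit Arguments. Unset Strict Implicit. Unset Printing Implicit Defensive.

(** The exponent 9/40 lies between the thresholds 1/5 and 1/4. Below 1/4 the radical falls short of
    n^2 by a power of n, which pays for the epsilon of the abc-conjecture. Above 1/5 counting saves
    a power of y, since one of a, b is O(x^(1/5)).

    The middle term of a progression enters doubled. Correlations are therefore measured at the
    doubled differences 2 (m2 - m1) of a small ball, and the increment appears on the dilate of a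
    Bohr set by 2. When 2 is invertible this dilate is again a Bohr set, with halved frequencies; to
    express this, characters are indexed by multiplication in a commutative ring.

    Regular radii are found by a pigeonhole argument that uses only |G| <= 2^(2^q) and no bound on
    the growth of Bohr sets in terms of their rank. It shrinks the radius by a factor exponential in
    q. All other exponents are polynomial in q too, where 2^-q is the density, so the argument runs
    as soon as log |G| exceeds a fixed polynomial in q; this allows q to be a multiple of log log
    N. *)

Module DensityIncrement.
Import all_boot all_order all_algebra finalg archimedean.
Import ring lra zify reals sequences exp trigo.
Import Order.TTheory GRing.Theory Num.Theory.
Local Open Scope ring_scope.

(** * Sums over a finite abelian group *)

Section Sums.
Variables (R : realFieldType) (G : finZmodType).
Implicit Types (A B D : {set G}) (g h : G -> R) (d u x : G).

Definition ind A x : R := (x \in A)%:R.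

Lemma ind_ge0 A x : 0 <= ind A x.
Proof. exact: ler0n. Qed.

Lemma ind_le1 A x : ind A x <= 1.
Proof. by rewrite /ind; case: (_ \in _); rewrite /= ?ler01 ?lexx. Qed.

Lemma ind_sqr A x : ind A x * ind A x = ind A x.
Proof. by rewrite /ind; case: (_ \in _); rewrite /= ?mulr1 ?mulr0. Qed.

Lemma sum_ind A : \sum_x ind A x = #|A|%:R.
Proof. by rewrite -sum1_card natr_sum [RHS]big_mkcond; apply: eq_bigr => x _; rewrite /ind; case: (_ \in _). Qed.

Lemma sum_indM A h : \sum_x ind A x * h x = \sum_(x in A) h x.
Proof.
by rewrite [RHS]big_mkcond; apply: eq_bigr => x _; rewrite /ind; case: (_ \in _); rewrite ?mul1r ?mul0r.
Qed.

Lemma sum_shift h d : \sum_x h (x + d) = \sum_x h x.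
Proof. by rewrite [RHS](reindex_inj (addIr d)). Qed.

Lemma sum_opp h : \sum_x h (- x) = \sum_x h x.
Proof. by rewrite [RHS](reindex_inj oppr_inj). Qed.

Lemma sumX (T : finType) (F : T -> R) j :
  (\sum_n F n) ^+ j = \sum_(f : {ffun 'I_j -> T}) \prod_i F (f i).
Proof. by rewrite -(bigA_distr_bigA (fun _ : 'I_j => F)) prodr_const card_ord. Qed.

Lemma addr_shiftK x d u : x + d + (u - d) = x + u.
Proof. by rewrite -addrA (addrC d) subrK. Qed.

Lemma subr_shiftK x d u : u - d - (x + u) = - x - d.
Proof. by rewrite opprD addrC -addrA (addrC (- u)) [u - d]addrC addrK. Qed.

Definition corr g u := \sum_n g n * g (n + u).
Definition selfconv g u := \sum_n g n * g (u - n).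

Definition tuple_mass g D j (f : {ffun 'I_j -> G}) :=
  \sum_(m in D) \prod_i g (f i + m *+ 2).

(** After the shift n -> n + 2 m1 the variables m1 and m2 separate in the expanded power, and every
    tuple contributes a square. Hence the moments are nonnegative for odd j as well. *)
Lemma corr_moment g D j :
  \sum_(m1 in D) \sum_(m2 in D) corr g (m2 *+ 2 - m1 *+ 2) ^+ j =
  \sum_(f : {ffun 'I_j -> G}) tuple_mass g D f ^+ 2.
Proof.
under eq_bigr => m1 _.
  under eq_bigr => m2 _.
    rewrite /corr -(sum_shift _ (m1 *+ 2)) sumX.
    under eq_bigr => f _ do
      (under eq_bigr => i _ do rewrite addr_shiftK; rewrite big_split /=).
    over.
  rewrite exchange_big /=; over.
rewrite exchange_big /=; apply: eq_bigr => f _.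
rewrite expr2 /tuple_mass mulr_suml; apply: eq_bigr => m1 _.
by rewrite mulr_sumr; apply: eq_bigr => m2 _.
Qed.

Lemma corr_moment_ge0 g D j :
  0 <= \sum_(m1 in D) \sum_(m2 in D) corr g (m2 *+ 2 - m1 *+ 2) ^+ j.
Proof. by rewrite corr_moment; apply: sumr_ge0 => f _; rewrite sqr_ge0. Qed.

(** The same expansion gives the products of the masses of f and of the reflected tuple -f. They are
    bounded by squares through 2 u v <= u^2 + v^2 and the reindexing f -> -f; the symmetry of [D]
    absorbs the reflection of [m1]. *)
Lemma selfconv_moment g D j : (forall x, (- x \in D) = (x \in D)) ->
  \sum_(m1 in D) \sum_(m2 in D) selfconv g (m2 *+ 2 - m1 *+ 2) ^+ j <=
  \sum_(m1 in D) \sum_(m2 in D) corr g (m2 *+ 2 - m1 *+ 2) ^+ j.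
Proof.
move=> Dsym; rewrite corr_moment.
pose nf (f : {ffun 'I_j -> G}) := [ffun i => - f i].
have nfK : involutive nf by move=> f; apply/ffunP => i; rewrite !ffunE opprK.
have -> : \sum_(m1 in D) \sum_(m2 in D) selfconv g (m2 *+ 2 - m1 *+ 2) ^+ j =
  \sum_(f : {ffun 'I_j -> G}) tuple_mass g D (nf f) * tuple_mass g D f.
  under eq_bigr => m1 _.
    under eq_bigr => m2 _.
      rewrite /selfconv -(sum_shift _ (m2 *+ 2)) sumX.
      under eq_bigr => f _ do
        (under eq_bigr => i _ do rewrite subr_shiftK; rewrite big_split /=).
      over.
    rewrite exchange_big /=; over.
  rewrite exchange_big /=; apply: eq_bigr => f _.
  rewrite /tuple_mass mulr_suml (reindex_inj oppr_inj) /=.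
  apply: eq_big => [m|m1 _]; first by rewrite Dsym.
  rewrite mulr_sumr; apply: eq_bigr => m2 _; rewrite mulrC; congr (_ * _).
  by apply: eq_bigr => i _; rewrite ffunE mulNrn opprK; congr (g _); rewrite addrC.
have /= E : \sum_f tuple_mass g D (nf f) ^+ 2 = \sum_(f : {ffun 'I_j -> G}) tuple_mass g D f ^+ 2.
  by rewrite [RHS](reindex_inj (inv_inj nfK)).
have : 0 <= \sum_(f : {ffun 'I_j -> G}) (tuple_mass g D (nf f) - tuple_mass g D f) ^+ 2.
  by apply: sumr_ge0 => f _; rewrite sqr_ge0.
rewrite (eq_bigr _ (fun f _ => sqrrB _ _)).
rewrite !big_split /= E sumrN sumrMnl => H.
by move: H; lra.
Qed.

End Sums.

(** * Unbalancing: from an even moment of X to a high moment of 1 + X *)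

Section Unbalance.
Variables (R : realFieldType) (I : finType) (Q : {set I}) (X : I -> R).

Lemma bernoulli4 (y : R) : 0 <= y -> 1 + 4 * y <= (1 + y) ^+ 4.
Proof. by move=> y0; rewrite !exprS expr0; nra. Qed.

Lemma expr_bernoulli (y : R) n : 0 <= y -> 1 + n%:R * y <= (1 + y) ^+ n.
Proof.
move=> y0; elim: n => [|n IH]; first by rewrite mul0r addr0 expr0.
have n0 : 0 <= n%:R :> R by exact: ler0n.
rewrite exprS -natr1; apply: le_trans (_ : (1 + y) * (1 + n%:R * y) <= _); first by nra.
by rewrite ler_wpM2l //; lra.
Qed.

(** A nonnegative odd moment means that the positive part of X carries at least half of the absolute
    moment of order q = 2k + 1. Where X >= 1/2, Bernoulli's inequality gives (1 + X)^4 >= (3/2)^4 2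
    X, whence the final exponent 4 q; smaller values are absorbed by powers of 1/2. *)
Lemma unbalance k : (2 <= k)%N -> 0 <= \sum_(i in Q) X i ^+ k.*2.+1 ->
  (3/4) ^+ k.*2 * #|Q|%:R <= \sum_(i in Q) X i ^+ k.*2 ->
  (3/2) ^+ (4 * k.*2.+1) * #|Q|%:R <= \sum_(i in Q) (1 + X i) ^+ (4 * k.*2.+1).
Proof.
move=> k2 odd0 ev; set q := k.*2.+1.
have evk : ~~ odd k.*2 by rewrite odd_double.
have h0 : 0 <= (1/2 : R) by lra.
(* |x|^q >= 1/2 (x^2k - 2^-2k), and x_+^q = (|x|^q + x^q)/2 *)
have pt x : (3/2 : R) ^+ (4 * q) * (2 ^+ q * ((1/2) * (1/2 * (x ^+ k.*2 - (1/2) ^+ k.*2) + x ^+ q) - (1/2) ^+ q))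
   <= (1 + x) ^+ (4 * q).
  have P0 : 0 <= (1 + x) ^+ (4 * q) by rewrite mulnC exprM exprn_even_ge0.
  have x2k : 0 <= x ^+ k.*2 by exact: exprn_even_ge0.
  have q0 : 0 <= (1/2 : R) ^+ k.*2 by exact: exprn_ge0.
  have [xlt|xge] := ltP x (1/2).
    apply: le_trans P0; rewrite mulr_ge0_le0 ?exprn_ge0 //; first by lra.
    rewrite mulr_ge0_le0 ?exprn_ge0 // /q !exprS.
    have [x0|x0] := ltP x (- (1/2)); first by nra.
    have le1 : x ^+ k.*2 <= (1/2) ^+ k.*2.
      rewrite -(ger0_norm x2k) normrX lerXn2r ?nnegrE ?normr_ge0 //.
      by rewrite ler_norml; apply/andP; split; lra.
    have := @mulr_ge0 _ (1/2 - x) (x ^+ k.*2).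
    nra.
  apply: le_trans (_ : (3/2) ^+ (4 * q) * (2 ^+ q * x ^+ q) <= _).
    rewrite !ler_wpM2l ?exprn_ge0 //; first by lra.
    rewrite /q !exprS; nra.
  have base : (3/2) ^+ 4 * (2 * x) <= (1 + x) ^+ 4.
    have B : 1 + 4 * ((x - 1/2) * (2/3)) <= (1 + (x - 1/2) * (2/3)) ^+ 4 by apply: bernoulli4; lra.
    have -> : 1 + x = 3/2 * (1 + (x - 1/2) * (2/3)) by lra.
    rewrite [leRHS]exprMn ler_wpM2l ?exprn_ge0 //; first by lra.
    by apply: le_trans B; lra.
  rewrite -[2 ^+ q * _]exprMn !exprM -exprMn; apply: lerXn2r => //.
    by rewrite nnegrE mulr_ge0 ?exprn_ge0 //; lra.
  by rewrite nnegrE exprn_ge0 //; lra.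
apply: le_trans (ler_sum _ (fun i _ => pt (X i))).
rewrite -mulr_sumr ler_wpM2l ?exprn_ge0 //; first by lra.
rewrite -mulr_sumr.
have -> : \sum_(i in Q) (1 / 2 * (1 / 2 * (X i ^+ k.*2 - (1 / 2) ^+ k.*2) + X i ^+ q) - (1 / 2) ^+ q)
  = 1/4 * (\sum_(i in Q) X i ^+ k.*2) + 1/2 * (\sum_(i in Q) X i ^+ q)
    - (1/4 * (1/2) ^+ k.*2 + (1/2) ^+ q) * #|Q|%:R.
  have -> : #|Q|%:R = \sum_(i in Q) (1 : R) by rewrite sumr_const.
  by rewrite !mulr_sumr -big_split /= -sumrB; apply: eq_bigr => i _; field.
set S := \sum_(i in Q) _ ^+ k.*2 in ev *; set S' := \sum_(i in Q) _ ^+ q in odd0 *.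
have c0 : 0 <= #|Q|%:R :> R by exact: ler0n.
have p2 : 0 < (2 : R) ^+ q by rewrite exprn_gt0.
have E1 : 2 ^+ q * (1/2 : R) ^+ q = 1 by rewrite -exprMn (_ : 2 * (1/2) = 1 :> R) ?expr1n //; lra.
have E2 : 2 ^+ q * (1/2 : R) ^+ k.*2 = 2 by rewrite /q exprS -mulrA -exprMn (_ : 2 * (1/2) = 1 :> R) ?expr1n ?mulr1 //; lra.
(* The margin: 2 (3/2)^(2k) >= 2 (3/2)^4 > 10 for k >= 2, and 10/4 - (2/4 + 1) = 1. *)
have E3 : 10 <= 2 ^+ q * (3/4 : R) ^+ k.*2.
  rewrite /q exprS -mulrA -exprMn (_ : 2 * (3/4) = 3/2 :> R); last by lra.
  have : (3/2 : R) ^+ 4 <= (3/2) ^+ k.*2 by apply: ler_weXn2l; [lra|lia].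
  by rewrite !exprS expr0; lra.
have : 2 ^+ q * (1/4 * ((3/4) ^+ k.*2 * #|Q|%:R)) <= 2 ^+ q * (1 / 4 * S + 1 / 2 * S').
  rewrite ler_wpM2l ?(ltW p2) //; lra.
move=> H; rewrite mulrBr; move: H.
set T := 2 ^+ q * (1 / 4 * S + 1 / 2 * S').
have -> : 2 ^+ q * ((1 / 4 * (1 / 2) ^+ k.*2 + (1 / 2) ^+ q) * #|Q|%:R) = (1/4 * (2 ^+ q * (1/2) ^+ k.*2) + 2 ^+ q * (1/2) ^+ q) * #|Q|%:R :> R.
  by ring.
rewrite E1 E2.
have -> : 2 ^+ q * (1 / 4 * ((3 / 4) ^+ k.*2 * #|Q|%:R)) = 1/4 * (2 ^+ q * (3/4) ^+ k.*2) * #|Q|%:R :> R by ring.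
nra.
Qed.

End Unbalance.

(** * Lifting and sifting *)

Section Lift.
Variables (R : realFieldType) (G : finZmodType).
Implicit Types (A B D : {set G}) (g h : G -> R) (d u x : G).
Local Notation ind := (@ind R G).

Lemma sum_setX D (F : G -> G -> R) :
  \sum_(p in setX D D) F p.1 p.2 = \sum_(m1 in D) \sum_(m2 in D) F m1 m2.
Proof. by rewrite pair_big /=; apply: eq_bigl => -[x y]; rewrite in_setX. Qed.

Definition shift_err B d := \sum_x `|ind B (x + d) - ind B x|.

Lemma shift_errN B d : shift_err B (- d) = shift_err B d.
Proof.
rewrite /shift_err -(sum_shift _ d); apply: eq_bigr => x _.
by rewrite addrK distrC.
Qed.

Lemma shift_sum_bound B d h : (forall x, 0 <= h x <= 1) ->
  `|\sum_x h x * ind B (x + d) - \sum_x h x * ind B x| <= shift_err B d.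
Proof.
move=> h01; rewrite -sumrB; apply: le_trans (ler_norm_sum _ _ _) _.
apply: ler_sum => x _; rewrite -mulrBr normrM ger0_norm; last by case/andP: (h01 x).
by rewrite ler_piMl //; case/andP: (h01 x).
Qed.

Variables (A B D : {set G}).
Let F := ind (A :&: B).
Let N : R := #|B|%:R.
Let a : R := #|A :&: B|%:R / N.
(** The balanced function of [A :&: B] relative to [B], of total mass 0. *)
Let g x := F x - a * ind B x.

Hypothesis Bsym : forall x, (- x \in B) = (x \in B).
Hypothesis Dsym : forall x, (- x \in D) = (x \in D).
Hypothesis Binv : forall m1 m2, m1 \in D -> m2 \in D ->
  shift_err B (m2 *+ 2 - m1 *+ 2) <= a / 32 * N.
Hypothesis AP3 : forall x y z, x \in A -> y \in A -> z \in A -> x + z = y *+ 2 -> x = y.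
Hypothesis Nbig : 16 <= a ^+ 2 * N.

Let N_ge0 : 0 <= N. Proof. exact: ler0n. Qed.

Let N_gt0 : 0 < N.
Proof. by rewrite lt_neqAle N_ge0 andbT; apply/eqP => E; move: Nbig; rewrite -E mulr0; lra. Qed.

Let a_ge0 : 0 <= a. Proof. by rewrite divr_ge0. Qed.

Let a_gt0 : 0 < a.
Proof. by rewrite lt_neqAle a_ge0 andbT; apply/eqP => E; move: Nbig; rewrite -E expr0n mul0r; lra. Qed.

Let a_le1 : a <= 1.
Proof. by rewrite ler_pdivrMr // mul1r ler_nat subset_leq_card ?subsetIr. Qed.

Let F01 x : 0 <= F x <= 1. Proof. by rewrite ind_ge0 ind_le1. Qed.

Let B01 x : 0 <= ind B x <= 1. Proof. by rewrite ind_ge0 ind_le1. Qed.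

Let FB x : F x * ind B x = F x.
Proof. by rewrite /F /ind inE; case: (x \in A); case: (x \in B); rewrite /= ?mulr1 ?mulr0 ?mul0r. Qed.

Let indBN x : ind B (- x) = ind B x. Proof. by rewrite /ind Bsym. Qed.

Let sumF : \sum_x F x = a * N.
Proof. by rewrite sum_ind /a divfK // gt_eqF. Qed.

Let cFB m1 m2 (u := m2 *+ 2 - m1 *+ 2) : m1 \in D -> m2 \in D ->
  `|\sum_x F x * ind B (x + u) - a * N| <= a / 32 * N.
Proof.
move=> h1 h2; have := shift_sum_bound B u F01.
by rewrite (eq_bigr F (fun x _ => FB x)) sumF => /le_trans; apply; exact: Binv.
Qed.

Let cBB m1 m2 (u := m2 *+ 2 - m1 *+ 2) : m1 \in D -> m2 \in D ->
  `|\sum_x ind B x * ind B (x + u) - N| <= a / 32 * N.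
Proof.
move=> h1 h2; have := shift_sum_bound B u B01.
rewrite (eq_bigr (ind B) (fun x _ => ind_sqr R B x)) sum_ind => /le_trans; apply; exact: Binv.
Qed.

(** [B] is almost invariant under u, so each of the three cross terms of [corr g u] equals a^2 N up
    to a^2 N / 32, and 3/32 <= 1/8. *)
Let corr_g m1 m2 (u := m2 *+ 2 - m1 *+ 2) : m1 \in D -> m2 \in D ->
  `|corr g u - (corr F u - a ^+ 2 * N)| <= 1/8 * (a ^+ 2 * N).
Proof.
move=> h1 h2.
have E : corr g u = corr F u - a * (\sum_x F x * ind B (x + u)) - a * (\sum_x F x * ind B (x - u))
   + a ^+ 2 * (\sum_x ind B x * ind B (x + u)).
  have -> : \sum_x F x * ind B (x - u) = \sum_x ind B x * F (x + u).
    by rewrite -(sum_shift _ u); apply: eq_bigr => x _; rewrite addrK mulrC.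
  rewrite /corr !mulr_sumr -!sumrB -big_split /=; apply: eq_bigr => x _.
  by rewrite /g; ring.
move: (cBB h1 h2) (cFB h2 h1) (cFB h1 h2).
rewrite -(opprB (m2 *+ 2)) -/u E.
move: (\sum_x ind B x * ind B (x + u)) (\sum_x F x * ind B (x - u)) (\sum_x F x * ind B (x + u)) => s1 s2 s3.
set r := corr F u.
rewrite !ler_norml => /andP[b1 b2] /andP[b3 b4] /andP[b5 b6].
have aN1 : a * N <= N by rewrite ler_piMl.
have aa : 0 <= a ^+ 2 by rewrite sqr_ge0.
have q1 : `|a * (s3 - a * N)| <= a * (a / 32 * N).
  by rewrite normrM ger0_norm // ler_wpM2l // ler_norml; apply/andP; split; lra.
have q2 : `|a * (s2 - a * N)| <= a * (a / 32 * N).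
  by rewrite normrM ger0_norm // ler_wpM2l // ler_norml; apply/andP; split; lra.
have q3 : `|a ^+ 2 * (s1 - N)| <= a ^+ 2 * (1 / 32 * N).
  rewrite normrM ger0_norm // ler_wpM2l // ler_norml; apply/andP; split; nra.
move: q1 q2 q3; rewrite !ler_norml expr2 => /andP[? ?] /andP[? ?] /andP[? ?].
apply/andP; split; lra.
Qed.

Let selfconv_g v : selfconv g v = selfconv F v - a * (\sum_x F x * ind B (x - v))
  - a * (\sum_x F x * ind B (x - v)) + a ^+ 2 * (\sum_x ind B x * ind B (x - v)).
Proof.
have -> : \sum_x ind B x * ind B (x - v) = \sum_x ind B x * ind B (v - x).
  by apply: eq_bigr => x _; rewrite -[ind B (v - x)]indBN opprB.
have E2 : \sum_x F x * ind B (x - v) = \sum_x F x * ind B (v - x).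
  by apply: eq_bigr => x _; rewrite -[ind B (v - x)]indBN opprB.
have E1 : \sum_x F x * ind B (x - v) = \sum_x ind B x * F (v - x).
  rewrite E2 -sum_opp -(sum_shift _ (- v)); apply: eq_bigr => x _.
  have -> : - (x - v) = v - x by rewrite opprB.
  by rewrite subKr mulrC.
rewrite {1}E2 E1 /selfconv !mulr_sumr -!sumrB -big_split /=; apply: eq_bigr => x _.
by rewrite /g; ring.
Qed.

(** The only representation of 2 (m2 - m1) as a sum of two elements of A is the trivial one, so
    [selfconv F] contributes at most 1 <= a^2 N / 16. The remaining terms are at most -2 (31/32) a^2
    N + a^2 N = -(15/16) a^2 N. *)
Let conv_g m1 m2 : m1 \in D -> m2 \in D -> m2 - m1 \in A ->
  selfconv g (m2 *+ 2 - m1 *+ 2) <= - (7/8 * (a ^+ 2 * N)).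
Proof.
move=> h1 h2 hA; set u := _ - _.
have uE : u = (m2 - m1) *+ 2 by rewrite mulrnBl.
have E := selfconv_g u.
have FF : selfconv F u <= 1.
  rewrite /selfconv (bigD1 (m2 - m1)) //= big1 => [|x xne].
    by rewrite addr0 mulr_ile1 ?ind_ge0 ?ind_le1.
  rewrite /F /ind; case xA: (x \in A :&: B); last by rewrite mul0r.
  case yA: (u - x \in A :&: B); last by rewrite mulr0.
  move: xA yA; rewrite !inE => /andP[xA _] /andP[yA _].
  by case/eqP: xne; apply: (AP3 xA hA yA); rewrite addrC subrK uE.
have := cFB h2 h1; rewrite -(opprB (m2 *+ 2)) -/u ler_norml => /andP[lo _].
have BB : \sum_x ind B x * ind B (x - u) <= N.
  by rewrite /N -sum_ind; apply: ler_sum => x _; rewrite ler_piMr ?ind_ge0 ?ind_le1.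
rewrite E; move: lo BB; set s1 := \sum_x _; set s2 := \sum_x _ => lo BB.
have q1 : a * (a * N - a / 32 * N) <= a * s1 by rewrite ler_wpM2l //; lra.
have q2 : a ^+ 2 * s2 <= a ^+ 2 * N by rewrite ler_wpM2l ?sqr_ge0.
move: Nbig q1 q2; rewrite expr2; lra.
Qed.

Variable k : nat.
Hypothesis k8 : (8 <= k)%N.
Hypothesis ak : 1 <= a / 2 * (7/6) ^+ k.*2.
Hypothesis AD : a / 2 * #|D|%:R ^+ 2 <= \sum_(m1 in D) \sum_(m2 in D) ind A (m2 - m1).
Let p := (4 * k.*2.+1)%N.

Let p64 : (64 <= p)%N.
Proof. by rewrite /p; move: k8; clear; lia. Qed.

Let aN := a ^+ 2 * N.
Let aN_gt0 : 0 < aN. Proof. by rewrite mulr_gt0 ?exprn_gt0. Qed.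

(** A proportion a/2 of the pairs has its difference in A, where the balanced convolution is at most
    -(7/8) a^2 N. By [ak] the factor a/2 costs no more than replacing 7/8 by 3/4 in the even moment.
    The moment passes to [corr g] and is unbalanced; the error 1/8 of [corr_g] is paid for by going
    from 3/2 down to 5/4. *)
Lemma corr_moment_large :
  (5/4 * (a ^+ 2 * N)) ^+ p * #|D|%:R ^+ 2 <=
  \sum_(m1 in D) \sum_(m2 in D) corr F (m2 *+ 2 - m1 *+ 2) ^+ p.
Proof.
pose Q := setX D D.
pose X (i : G * G) := corr g (i.2 *+ 2 - i.1 *+ 2) / aN.
pose Y (i : G * G) := corr F (i.2 *+ 2 - i.1 *+ 2) / aN.
have cQ : #|Q|%:R = #|D|%:R ^+ 2 :> R by rewrite cardsX natrM expr2.
have sumX j : \sum_(i in Q) X i ^+ j = (\sum_(m1 in D) \sum_(m2 in D) corr g (m2 *+ 2 - m1 *+ 2) ^+ j) / aN ^+ j.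
  rewrite -(@sum_setX D (fun m1 m2 => corr g (m2 *+ 2 - m1 *+ 2) ^+ j)) mulr_suml.
  by apply: eq_bigr => i _; rewrite /X expr_div_n.
have ev2k : ~~ odd k.*2 by rewrite odd_double.
have evp : ~~ odd p by rewrite /p oddM.
have unb : (3/2) ^+ p * #|Q|%:R <= \sum_(i in Q) (1 + X i) ^+ p.
  apply: unbalance; first exact: leq_trans k8.
    by rewrite sumX divr_ge0 ?corr_moment_ge0 // exprn_ge0 // ltW.
  rewrite sumX ler_pdivlMr ?exprn_gt0 //.
  apply: le_trans (selfconv_moment g k.*2 Dsym).
  apply: le_trans (_ : (7/8 * aN) ^+ k.*2 * (a / 2 * #|D|%:R ^+ 2) <= _).
    rewrite cQ mulrAC [X in _ <= X]mulrA ler_wpM2r ?exprn_ge0 //.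
    have -> : 7/8 * aN = (3/4 * aN) * (7/6) by lra.
    rewrite -exprMn [X in _ <= X * _]exprMn.
    have c0 : 0 <= (3/4 * aN) ^+ k.*2 by rewrite exprn_ge0 // mulr_ge0 ?(ltW aN_gt0) //; lra.
    by move: c0 ak; set c := (_ * _) ^+ _; set t := _ ^+ _ => c0 ak'; nra.
  apply: le_trans (ler_wpM2l _ AD) _; first by rewrite exprn_even_ge0.
  rewrite mulr_sumr; apply: ler_sum => m1 h1; rewrite mulr_sumr; apply: ler_sum => m2 h2.
  rewrite /ind; case hA: (m2 - m1 \in A); last by rewrite mulr0 exprn_even_ge0.
  rewrite mulr1 -[X in _ <= X](ger0_norm (exprn_even_ge0 _ ev2k)) normrX.
  have := conv_g h1 h2 hA; rewrite -/aN => H.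
  apply: lerXn2r; rewrite ?nnegrE ?normr_ge0 //; first by rewrite mulr_ge0 ?(ltW aN_gt0) //; lra.
  by rewrite ler_normr; apply/orP; right; lra.
have pt i : i \in Q -> (1 + X i) ^+ p <= (9/8) ^+ p * (Y i ^+ p + 1).
  rewrite inE => /andP[h1 h2].
  have Y0 : 0 <= Y i.
    rewrite /Y divr_ge0 ?(ltW aN_gt0) //; apply: sumr_ge0 => x _.
    by rewrite mulr_ge0 ?ind_ge0.
  have XY : `|1 + X i| <= Y i + 1/8.
    have := corr_g h1 h2; rewrite -/aN => H.
    have : `|X i - (Y i - 1)| <= 1/8.
      rewrite -(ler_pM2r aN_gt0) -[X in _ * X <= _](gtr0_norm aN_gt0) -normrM.
      have -> // : (X i - (Y i - 1)) * aN = corr g (i.2 *+ 2 - i.1 *+ 2) - (corr F (i.2 *+ 2 - i.1 *+ 2) - aN).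
      by rewrite /X /Y !mulrBl !divfK ?gt_eqF // mul1r.
    rewrite !ler_norml => /andP[? ?]; apply/andP; split; lra.
  rewrite -[X in X <= _](ger0_norm (exprn_even_ge0 _ evp)) normrX.
  apply: le_trans (_ : (Y i + 1/8) ^+ p <= _).
    by apply: lerXn2r; rewrite ?nnegrE ?normr_ge0 //; lra.
  have [Y1|Y1] := leP (Y i) 1.
    apply: le_trans (_ : (9/8) ^+ p <= _).
      by apply: lerXn2r; rewrite ?nnegrE //; lra.
    rewrite ler_peMr ?exprn_ge0 //; first by lra.
    by have := exprn_ge0 p Y0; lra.
  apply: le_trans (_ : (9/8 * Y i) ^+ p <= _).
    by apply: lerXn2r; rewrite ?nnegrE //; lra.
  by rewrite exprMn ler_wpM2l ?exprn_ge0 //; lra.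
have p5 := p64.
have Ysum : (5/4) ^+ p * #|Q|%:R <= \sum_(i in Q) Y i ^+ p.
  have H : (3/2) ^+ p * #|Q|%:R <= (9/8) ^+ p * (\sum_(i in Q) Y i ^+ p + #|Q|%:R).
    apply: le_trans unb _; apply: le_trans (ler_sum _ pt) _.
    by rewrite -mulr_sumr big_split /= sumr_const.
  have E : (3/2 : R) ^+ p = (9/8) ^+ p * (4/3) ^+ p by rewrite -exprMn; congr (_ ^+ _); lra.
  rewrite E -mulrA ler_pM2l in H; last by rewrite exprn_gt0 //; lra.
  have q0 : 0 <= #|Q|%:R :> R by exact: ler0n.
  (* 4/3 is (3/2) / (9/8). As 4/3 = (5/4) (16/15) and p >= 64, the additional 1 is swallowed. *)
  have e1 : 1 + (5/4 : R) ^+ p <= (4/3) ^+ p.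
    have -> : (4/3 : R) = (5/4) * (16/15) by lra.
    rewrite [in leRHS]exprMn.
    have b := @expr_bernoulli R (1/15) p.
    have b2 := @expr_bernoulli R (1/4) p.
    have p5' : 64 <= p%:R :> R by rewrite ler_nat.
    have -> : (16/15 : R) = 1 + 1/15 by lra.
    have -> : (5/4 : R) = 1 + 1/4 by lra.
    move: (b ltac:(lra)) (b2 ltac:(lra)).
    move: ((1 + 1 / 15) ^+ p) ((1 + 1 / 4) ^+ p) => t1 t2 c1 c2.
    have : 0 <= (t2 - 2) * (t1 - 4/3) by apply: mulr_ge0; lra.
    lra.
  have : (1 + (5/4) ^+ p) * #|Q|%:R <= (4/3) ^+ p * #|Q|%:R :> R by rewrite ler_wpM2r.
  lra.
rewrite exprMn -/aN.
have -> : \sum_(m1 in D) \sum_(m2 in D) corr F (m2 *+ 2 - m1 *+ 2) ^+ p = aN ^+ p * (\sum_(i in Q) Y i ^+ p).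
  rewrite -(@sum_setX D (fun m1 m2 => corr F (m2 *+ 2 - m1 *+ 2) ^+ p)) mulr_sumr.
  by apply: eq_bigr => i _; rewrite /Y expr_div_n mulrC divfK // gt_eqF // exprn_gt0.
by rewrite mulrAC mulrC ler_wpM2l -?cQ // exprn_ge0 // ltW.
Qed.

Definition popular u := 9/8 * (a ^+ 2 * N) < corr F u.

(** For a tuple f let T f consist of the m in D with all f_i + 2 m in [A :&: B]. Summed over f, the
    squares |T f|^2 give the p-th moment of [corr F], whereas an unpopular pair is counted at most
    (9/8 a^2 N)^p times. The first total wins by a factor (10/9)^p, so some T f is large and almost
    free of unpopular pairs. *)
Lemma sifting : (0 < #|D|)%N -> exists A1 : {set G}, [/\ A1 \subset D, a ^+ p * #|D|%:R <= #|A1|%:R, (0 < #|A1|)%N &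
  \sum_(m1 in A1) \sum_(m2 in A1) (~~ popular (m2 *+ 2 - m1 *+ 2))%:R <= 1/100 * #|A1|%:R ^+ 2 :> R].
Proof.
move=> D0; pose T (f : {ffun 'I_p -> G}) := [set m in D | [forall i, f i + m *+ 2 \in A :&: B]].
have TE (f : {ffun 'I_p -> G}) m : m \in D -> \prod_i F (f i + m *+ 2) = ind (T f) m.
  move=> mD; rewrite /ind inE mD /=; case: (boolP [forall i, _]) => [/forallP H|].
    by rewrite big1 // => i _; rewrite /F /ind H.
  by rewrite negb_forall => /existsP[i]; rewrite (bigD1 i) //= /F /ind => /negbTE ->; rewrite mul0r.
have TD f : T f \subset D by apply/subsetP => m; rewrite inE => /andP[].
have sumT f (h : G -> R) : \sum_(m in D) ind (T f) m * h m = \sum_(m in T f) h m.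
  rewrite big_mkcond [RHS]big_mkcond; apply: eq_bigr => m _; rewrite /ind.
  case mT: (m \in T f); first by rewrite (subsetP (TD f) _ mT) mul1r.
  by case: ifP; rewrite ?mul0r.
have tm f : tuple_mass F D f = #|T f|%:R.
  rewrite /tuple_mass (eq_bigr _ (fun m mD => TE f m mD)).
  by rewrite -sum1_card natr_sum -sumT; apply: eq_bigr => m _; rewrite mulr1.
have S2 : (5/4 * aN) ^+ p * #|D|%:R ^+ 2 <= \sum_f #|T f|%:R ^+ 2.
  by apply: le_trans corr_moment_large _; rewrite corr_moment (eq_bigr _ (fun f _ => congr1 (fun t => t ^+ 2) (tm f))).
have S1 : \sum_f #|T f|%:R = (a * N) ^+ p * #|D|%:R.
  under eq_bigr => f _ do rewrite -tm.
  rewrite /tuple_mass exchange_big /=.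
  have -> : (a * N) ^+ p * #|D|%:R = \sum_(m in D) (a * N) ^+ p by rewrite sumr_const mulr_natr.
  apply: eq_bigr => m _.
  by rewrite -(@sumX _ _ (fun n => F (n + m *+ 2))) (sum_shift F) sumF.
pose bad f : R := \sum_(m1 in T f) \sum_(m2 in T f) (~~ popular (m2 *+ 2 - m1 *+ 2))%:R.
have S3 : \sum_f bad f <= (9/8 * aN) ^+ p * #|D|%:R ^+ 2.
  have -> : \sum_f bad f = \sum_(m1 in D) \sum_(m2 in D)
      (~~ popular (m2 *+ 2 - m1 *+ 2))%:R * corr F (m2 *+ 2 - m1 *+ 2) ^+ p.
    rewrite /bad; under eq_bigr => f _.
      rewrite -sumT; under eq_bigr => m1 _ do rewrite -sumT mulr_sumr.
      over.
    rewrite exchange_big /=; apply: eq_bigr => m1 h1.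
    rewrite exchange_big /=; apply: eq_bigr => m2 h2.
    rewrite /corr -(sum_shift _ (m1 *+ 2)) sumX mulr_sumr; apply: eq_bigr => f _.
    rewrite -!TE // mulrA -big_split /= mulrC; congr (_ * _).
    by apply: eq_bigr => i _; rewrite addr_shiftK.
  have -> : (9/8 * aN) ^+ p * #|D|%:R ^+ 2 = \sum_(m1 in D) \sum_(m2 in D) (9/8 * aN) ^+ p.
    by rewrite !sumr_const -mulrnA expr2 -natrM mulr_natr.
  apply: ler_sum => m1 _; apply: ler_sum => m2 _.
  have c0 : 0 <= corr F (m2 *+ 2 - m1 *+ 2) by apply: sumr_ge0 => x _; rewrite mulr_ge0 ?ind_ge0.
  rewrite /popular -leNgt; case: (leP (corr F (m2 *+ 2 - m1 *+ 2)) (9/8 * (a ^+ 2 * N))) => H; rewrite /= ?mulr1n ?mulr0n ?mul1r ?mul0r.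
    by apply: lerXn2r; rewrite ?nnegrE // mulr_ge0 ?(ltW aN_gt0) //; lra.
  by rewrite exprn_ge0 // mulr_ge0 ?(ltW aN_gt0) //; lra.
have [/existsP[f /and3P[f1 f2 f3]]|nex] := boolP [exists f, [&& a ^+ p * #|D|%:R <= #|T f|%:R, (0 < #|T f|)%N & bad f <= 1/100 * #|T f|%:R ^+ 2]].
  by exists (T f); split.
(* If every f fails one of the three requirements, this holds for all f, and its sum contradicts
   [S1], [S2] and [S3]. *)
have pt f : #|T f|%:R ^+ 2 <= a ^+ p * #|D|%:R * #|T f|%:R + 100 * bad f.
  have b0 : 0 <= bad f by apply: sumr_ge0 => m1 _; apply: sumr_ge0 => m2 _; exact: ler0n.
  have t0 : 0 <= #|T f|%:R :> R by exact: ler0n.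
  move: nex; rewrite negb_exists => /forallP /(_ f); rewrite !negb_and -!ltNge => /or3P[H|H|H].
  - by rewrite expr2; have := ler_wpM2r t0 (ltW H); lra.
  - have -> : #|T f| = 0%N by apply/eqP; move: H; rewrite lt0n negbK.
    by rewrite expr0n mulr0 add0r mulr_ge0.
  - have : 0 <= a ^+ p * #|D|%:R * #|T f|%:R by rewrite !mulr_ge0 // exprn_ge0.
    lra.
have tot : \sum_f #|T f|%:R ^+ 2 <= \sum_f (a ^+ p * #|D|%:R * #|T f|%:R + 100 * bad f).
  by apply: ler_sum => f _; exact: pt.
rewrite big_split /= -!mulr_sumr S1 in tot.
have d0 : 0 < #|D|%:R ^+ 2 :> R by rewrite exprn_gt0 // ltr0n.
have key : (5/4 * aN) ^+ p * #|D|%:R ^+ 2 <= (a ^+ p * (a * N) ^+ p + 100 * (9/8 * aN) ^+ p) * #|D|%:R ^+ 2.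
  apply: le_trans S2 (le_trans tot _).
  rewrite [leRHS]mulrDl; apply: lerD; first by rewrite expr2 -!mulrA ler_wpM2l ?exprn_ge0 // mulrCA.
  by move: S3; lra.
rewrite ler_pM2r // in key.
have E1 : a ^+ p * (a * N) ^+ p = aN ^+ p by rewrite -exprMn mulrA -expr2.
rewrite E1 [(5/4 * aN) ^+ p]exprMn [(9/8 * aN) ^+ p]exprMn in key.
have key2 : (5/4) ^+ p <= 1 + 100 * (9/8) ^+ p :> R.
  by rewrite -(ler_pM2r (exprn_gt0 p aN_gt0)) [leRHS]mulrDl mul1r -[100 * _ * _]mulrA.
(* (10/9)^64 >= 2^8 = 256, to be compared with the 100 that comes from the proportion 1/100 of
   unpopular pairs. *)
have e8 : (2 : R) <= (10/9) ^+ 8 by rewrite !exprS expr0; lra.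
have e64 : (256 : R) <= (10/9) ^+ p.
  apply: le_trans (_ : ((10/9) ^+ 8) ^+ 8 <= _); last by rewrite -exprM; apply: ler_weXn2l => //; lra.
  have : (2 : R) ^+ 8 <= ((10/9) ^+ 8) ^+ 8 by apply: lerXn2r; rewrite ?nnegrE ?exprn_ge0 //; lra.
  by rewrite (_ : (2 : R) ^+ 8 = 256) //; rewrite !exprS expr0; lra.
have E2 : (5/4 : R) ^+ p = (9/8) ^+ p * (10/9) ^+ p by rewrite -exprMn; congr (_ ^+ _); lra.
have g1 : 1 <= (9/8 : R) ^+ p by apply: exprn_ege1; lra.
rewrite E2 in key2.
nra.
Qed.

End Lift.

(** * Croot--Sisask almost-periodicity *)

Section Exp.
Variable R : realType.

Lemma expR_le_quad (x : R) : x <= 1/2 -> expR x <= 1 + x + 2 * x ^+ 2.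
Proof.
move=> xh; have e0 := expR_gt0 x.
have : (1 - x) * expR x <= 1.
  have := expR_ge1Dx (- x); rewrite expRN => H.
  by rewrite -(ler_pM2r (_ : 0 < (expR x)^-1)) ?invr_gt0 // mul1r mulfK // gt_eqF.
move=> H; have px : 0 < 1 - x by lra.
rewrite -(ler_pM2l px); apply: le_trans H _.
have : 0 <= x ^+ 2 * (1/2 - x) by rewrite mulr_ge0 ?sqr_ge0 //; lra.
rewrite !expr2; nra.
Qed.

Lemma expR_le_1D (y : R) : - (1/2) <= y -> expR (y - 2 * y ^+ 2) <= 1 + y.
Proof.
move=> yh; set z := y - 2 * y ^+ 2.
have zq : (1 - z) * (1 + y) >= 1.
  rewrite /z; have : 0 <= y ^+ 2 * (1/2 + y) by rewrite mulr_ge0 ?sqr_ge0 //; lra.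
  by rewrite !expr2; nra.
have y0 : 0 < 1 + y by lra.
have := expR_ge1Dx (- z); rewrite expRN => H.
rewrite -(ler_pM2r (_ : 0 < (expR z)^-1)) ?invr_gt0 ?expR_gt0 // divff ?gt_eqF ?expR_gt0 //.
apply: le_trans zq _; rewrite mulrC; apply: ler_wpM2l; lra.
Qed.

Lemma expR_natM (x : R) n : expR x ^+ n = expR (n%:R * x).
Proof. by rewrite mulrC expRM_natr. Qed.

End Exp.

(** * Random samples: exponential moments and almost-periods *)

Section Chernoff.
Variables (R : realType) (G : finType) (A1 : {set G}).
Let n : R := #|A1|%:R.

Definition tuple_in k (f : {ffun 'I_k -> G}) : bool := [forall i, f i \in A1].

Lemma sum_tuple_in k (F : G -> R) :
  \sum_(f : {ffun 'I_k -> G} | tuple_in f) \prod_i F (f i) = (\sum_(x in A1) F x) ^+ k.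
Proof.
have -> : \sum_(x in A1) F x = \sum_x (if x \in A1 then F x else 0) by rewrite big_mkcond.
rewrite sumX [LHS]big_mkcond; apply: eq_bigr => f _; rewrite /tuple_in.
case: (boolP [forall i, _]) => [/forallP H|]; first by apply: eq_bigr => i _; rewrite H.
by rewrite negb_forall => /existsP[i /negbTE Hi]; rewrite (bigD1 i) //= Hi mul0r.
Qed.

Lemma chernoff k (Y : G -> R) (eps : R) : 0 < eps <= 1 ->
  (forall x, `|Y x| <= 1) -> \sum_(x in A1) Y x = 0 ->
  \sum_(f : {ffun 'I_k -> G} | tuple_in f) (k%:R * eps < \sum_i Y (f i))%R%:R <=
  n ^+ k * expR (- (eps ^+ 2 / 8 * k%:R)).
Proof.
(* The choice s = eps/4 maximises s eps - 2 s^2, with value eps^2 / 8. *)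
move=> /andP[e0 e1] Y1 Y0; pose s := eps / 4.
have s0 : 0 < s by rewrite /s; lra.
have sh : s <= 1/4 by rewrite /s; lra.
have sumE : \sum_(x in A1) expR (s * Y x) <= n * expR (2 * s ^+ 2).
  apply: le_trans (_ : \sum_(x in A1) (1 + s * Y x + 2 * s ^+ 2) <= _).
    apply: ler_sum => x _; have := Y1 x; rewrite ler_norml => /andP[Ya Yb].
    apply: le_trans (expR_le_quad _) _; first by nra.
    rewrite lerD2l exprMn ler_wpM2l // ler_piMr ?sqr_ge0 //.
    by rewrite -(ger0_norm (sqr_ge0 _)) normrX exprn_ile1 ?normr_ge0.
  have -> : \sum_(x in A1) (1 + s * Y x + 2 * s ^+ 2) = s * (\sum_(x in A1) Y x) + \sum_(x in A1) (1 + 2 * s ^+ 2).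
    by rewrite mulr_sumr -big_split /=; apply: eq_bigr => x _; ring.
  rewrite Y0 mulr0 add0r sumr_const -[_ *+ #|A1|]mulr_natl ler_wpM2l ?ler0n //; exact: expR_ge1Dx.
apply: le_trans (_ : \sum_(f | tuple_in f) \prod_(i < k) expR (s * Y (f i) - s * eps) <= _).
  apply: ler_sum => f _; rewrite -expR_sum.
  have -> : \sum_(i < k) (s * Y (f i) - s * eps) = s * (\sum_i Y (f i) - k%:R * eps).
    by rewrite sumrB sumr_const card_ord -mulr_sumr mulrBr; congr (_ - _); rewrite -mulr_natr; ring.
  case: ltP => H; last exact: expR_ge0.
  have : 0 <= s * (\sum_i Y (f i) - k%:R * eps) by rewrite mulr_ge0 ?(ltW s0) // subr_ge0 ltW.
  by move=> H2; apply: le_trans (expR_ge1Dx _); rewrite lerDl.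
rewrite (sum_tuple_in k (fun x => expR (s * Y x - s * eps))).
have -> : \sum_(x in A1) expR (s * Y x - s * eps) = expR (- (s * eps)) * \sum_(x in A1) expR (s * Y x).
  by rewrite mulr_sumr; apply: eq_bigr => x _; rewrite addrC expRD.
apply: le_trans (_ : (expR (- (s * eps)) * (n * expR (2 * s ^+ 2))) ^+ k <= _).
  apply: lerXn2r; rewrite ?nnegrE ?mulr_ge0 ?expR_ge0 ?ler0n //; last by rewrite ler_wpM2l ?expR_ge0.
  by apply: sumr_ge0 => x _; exact: expR_ge0.
rewrite mulrCA -expRD exprMn expR_natM ler_wpM2l ?exprn_ge0 ?ler0n // ler_expR.
rewrite /s le_eqVlt; apply/orP; left; by apply/eqP; field.
Qed.

End Chernoff.

Section Sampling.
Variables (R : realType) (G : finZmodType) (A1 D2 D' E : {set G}) (h : G -> R) (k : nat) (eps : R).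
Let n : R := #|A1|%:R.
Hypothesis h01 : forall x, 0 <= h x <= 1.
Hypothesis n_gt0 : (0 < #|A1|)%N.
Hypothesis k_gt0 : (0 < k)%N.
Hypothesis eps01 : 0 < eps <= 1.
Hypothesis AD' : forall a t, a \in A1 -> t \in D2 -> a + t \in D'.

Definition smooth x := (\sum_(m in A1) h (x - m)) / n.
Definition sampled (f : {ffun 'I_k -> G}) x : R := (\sum_i h (x - f i)) / k%:R.

Let n0 : 0 < n. Proof. by rewrite ltr0n. Qed.
Let k0 : 0 < k%:R :> R. Proof. by rewrite ltr0n. Qed.

Lemma smooth01 x : 0 <= smooth x <= 1.
Proof.
rewrite divr_ge0 ?(ltW n0) //=; last by apply: sumr_ge0 => m _; case/andP: (h01 (x - m)).
rewrite ler_pdivrMr // mul1r /n -sum1_card natr_sum; apply: ler_sum => m _.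
by case/andP: (h01 (x - m)).
Qed.

Let e0 := expR (- (eps ^+ 2 / 8 * k%:R)).
Let bad f := [set x in E | eps < `|sampled f x - smooth x|].

Let bad_sum : \sum_(f | tuple_in A1 f) #|bad f|%:R <= 2 * e0 * n ^+ k * #|E|%:R.
Proof.
have -> : \sum_(f | tuple_in A1 f) #|bad f|%:R =
    \sum_(x in E) \sum_(f | tuple_in A1 f) (eps < `|sampled f x - smooth x|)%R%:R :> R.
  rewrite exchange_big /=; apply: eq_bigr => f _.
  rewrite -sum1_card natr_sum big_mkcond [RHS]big_mkcond; apply: eq_bigr => x _.
  by rewrite /bad inE; case: (x \in E) => //=; case: (_ < _).
rewrite mulr_natr -sumr_const; apply: ler_sum => x _.
pose Y m := h (x - m) - smooth x.
have Y1 m : `|Y m| <= 1.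
  have /andP[? ?] := h01 (x - m); have /andP[? ?] := smooth01 x.
  by rewrite ler_norml /Y; apply/andP; split; lra.
have Y0 : \sum_(m in A1) Y m = 0.
  by rewrite sumrB sumr_const -[smooth x *+ _]mulr_natr /smooth divfK ?subrr // gt_eqF.
have N1 m : `|- Y m| <= 1 by rewrite normrN.
have N0 : \sum_(m in A1) - Y m = 0 by rewrite sumrN Y0 oppr0.
have := lerD (chernoff k eps01 Y1 Y0) (chernoff k eps01 N1 N0).
rewrite -big_split /= -/n -/e0 => H.
apply: le_trans (le_trans H _); last by rewrite -mulr2n -mulr_natl; rewrite le_eqVlt; apply/orP; left; apply/eqP; ring.
apply: ler_sum => f _.
have SE : \sum_i Y (f i) = k%:R * (sampled f x - smooth x).
  rewrite sumrB sumr_const card_ord mulrBr /sampled mulrC divfK ?gt_eqF //.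
  by rewrite -[smooth x *+ _]mulr_natl.
rewrite sumrN SE -[- (k%:R * _)]mulrN !ltr_pM2l // ltr_normr.
by case: (eps < _); case: (eps < _); rewrite /= ?mulr1n ?mulr0n; lra.
Qed.

Let good : {set {ffun 'I_k -> G}} := [set f | tuple_in A1 f && (#|bad f|%:R <= 4 * e0 * #|E|%:R)].

(** Markov's inequality: on average at most 2 e0 |E| points are bad, and a good tuple is allowed
    twice as many. *)
Let good_card : n ^+ k <= 2 * #|good|%:R.
Proof.
have tot : \sum_(f : {ffun 'I_k -> G} | tuple_in A1 f) (1 : R) = n ^+ k.
  have <- : \sum_(x in A1) (1 : R) = n by rewrite sumr_const.
  by rewrite -sum_tuple_in; apply: eq_bigr => f _; rewrite big1.
have ee : 0 < e0 by exact: expR_gt0.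
have [E0|Epos] := posnP #|E|.
  have -> : #|good|%:R = n ^+ k.
    rewrite -tot -sum1_card natr_sum; apply: eq_bigl => f; rewrite inE.
    have -> : bad f = set0; last by rewrite cards0 E0 mulr0 lexx andbT.
    by apply/setP => x; rewrite !inE; move/eqP: E0; rewrite cards_eq0 => /eqP ->; rewrite inE.
  have : 0 <= n ^+ k by rewrite exprn_ge0 // ltW.
  by lra.
have Ep : 0 < #|E|%:R :> R by rewrite ltr0n.
have gE : #|good|%:R = \sum_(f | tuple_in A1 f) (#|bad f|%:R <= 4 * e0 * #|E|%:R)%R%:R :> R.
  rewrite -sum1_card natr_sum big_mkcond [RHS]big_mkcond; apply: eq_bigr => f _.
  by rewrite inE; case: (tuple_in _ _) => //=; case: (_ <= _).
have c4 : 0 < 4 * e0 * #|E|%:R by rewrite !mulr_gt0.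
have : 4 * e0 * #|E|%:R * (n ^+ k - #|good|%:R) <= 2 * e0 * n ^+ k * #|E|%:R.
  apply: le_trans bad_sum; rewrite gE -tot -sumrB mulr_sumr; apply: ler_sum => f _.
  case: (leP #|bad f|%:R (4 * e0 * #|E|%:R)) => H; first by rewrite /= mulr1n subrr mulr0 ler0n.
  by rewrite /= mulr0n subr0 mulr1 ltW.
move=> H; have : 0 < 2 * e0 * #|E|%:R by rewrite !mulr_gt0.
move=> c2; rewrite -(ler_pM2l c2).
have -> : 2 * e0 * #|E|%:R * (2 * #|good|%:R) = 4 * e0 * #|E|%:R * #|good|%:R by ring.
move: H; rewrite mulrBr.
have -> : 2 * e0 * n ^+ k * #|E|%:R = 2 * e0 * #|E|%:R * n ^+ k by ring.
have -> : 4 * e0 * #|E|%:R * n ^+ k = 2 * (2 * e0 * #|E|%:R * n ^+ k) by ring.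
by lra.
Qed.

(** A good sample shifted by t in D2 lies in D'^k, so by pigeonhole one tuple z is such a shift for
    many t. For two of them, the value of [sampled z] at x + t approximates both [smooth x] and
    [smooth (x + t - t')], each approximation failing on at most 4 e0 |E| points. *)
Lemma sampling : (0 < #|D'|)%N -> exists T : {set G}, [/\ T \subset D2,
  (n / #|D'|%:R) ^+ k / 2 * #|D2|%:R <= #|T|%:R &
  forall t t', t \in T -> t' \in T ->
    #|[set x | [&& x \in E, x + t - t' \in E & 2 * eps < `|smooth (x + t - t') - smooth x|]]|%:R
      <= 8 * e0 * #|E|%:R].
Proof.
move=> D'0; have d'0 : 0 < #|D'|%:R :> R by rewrite ltr0n.
pose sh (z : {ffun 'I_k -> G}) t := [ffun i => z i - t] : {ffun 'I_k -> G}.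
pose T z := [set t in D2 | sh z t \in good].
have sumT : \sum_z #|T z|%:R = #|D2|%:R * #|good|%:R :> R.
  have -> : \sum_z #|T z|%:R = \sum_(t in D2) \sum_z (sh z t \in good)%:R :> R.
    rewrite exchange_big /=; apply: eq_bigr => z _.
    rewrite -sum1_card natr_sum big_mkcond [RHS]big_mkcond; apply: eq_bigr => t _.
    by rewrite inE; case: (t \in D2) => //=; case: (_ \in _).
  rewrite mulr_natl -sumr_const; apply: eq_bigr => t _.
  have inj : injective (fun z : {ffun 'I_k -> G} => [ffun i => z i + t] : {ffun 'I_k -> G}).
    by move=> z z' /ffunP H; apply/ffunP => i; have := H i; rewrite !ffunE => /addIr.
  rewrite (reindex_inj inj) /= -sum1_card natr_sum [RHS]big_mkcond; apply: eq_bigr => z _.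
  have -> : sh [ffun i => z i + t] t = z by apply/ffunP => i; rewrite !ffunE addrK.
  by case: (_ \in _).
have supp (z : {ffun 'I_k -> G}) : ~~ [forall i, z i \in D'] -> #|T z| = 0%N.
  rewrite negb_forall => /existsP[i zi]; apply/eqP; rewrite cards_eq0; apply/eqP/setP => t.
  rewrite !inE; apply/negbTE/negP => /andP[tD /andP[/forallP /(_ i)]].
  by rewrite ffunE => /AD' /(_ tD); rewrite subrK (negbTE zi).
have [z zT] : exists z, #|D2|%:R * #|good|%:R <= #|T z|%:R * #|D'|%:R ^+ k :> R.
  have [/existsP //|] := boolP [exists z, #|D2|%:R * #|good|%:R <= #|T z|%:R * #|D'|%:R ^+ k :> R].
  rewrite negb_exists => /forallP H; exfalso.
  have tot : \sum_(f : {ffun 'I_k -> G} | tuple_in D' f) (1 : R) = #|D'|%:R ^+ k.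
    have <- : \sum_(x in D') (1 : R) = #|D'|%:R by rewrite sumr_const.
    by rewrite -sum_tuple_in; apply: eq_bigr => f _; rewrite big1.
  have [z0 z0D'] : exists z0 : {ffun 'I_k -> G}, tuple_in D' z0.
    have /card_gt0P[d dD'] := D'0.
    by exists [ffun => d]; apply/forallP => i; rewrite ffunE.
  have : \sum_(z | tuple_in D' z) (#|T z|%:R * #|D'|%:R ^+ k) < \sum_(z : {ffun 'I_k -> G} | tuple_in D' z) (#|D2|%:R * #|good|%:R) :> R.
    apply: ltr_sum; first by apply/hasP; exists z0 => //; rewrite mem_index_enum.
    by move=> z _; have := H z; rewrite -ltNge.
  rewrite -mulr_suml.
  have -> : \sum_(z | tuple_in D' z) #|T z|%:R = #|D2|%:R * #|good|%:R :> R.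
    rewrite -sumT [LHS]big_mkcond; apply: eq_bigr => z _; case: ifP => // H2.
    by rewrite supp //; move: H2; rewrite /tuple_in => ->.
  have -> : \sum_(z : {ffun 'I_k -> G} | tuple_in D' z) (#|D2|%:R * #|good|%:R) = #|D2|%:R * #|good|%:R * #|D'|%:R ^+ k :> R.
    by rewrite -tot mulr_sumr; apply: eq_bigr => f _; rewrite mulr1.
  by rewrite ltxx.
exists (T z); split.
- by apply/subsetP => t; rewrite inE => /andP[].
- rewrite expr_div_n -(ler_pM2r (exprn_gt0 k d'0)); apply: le_trans zT.
  have -> : n ^+ k / #|D'|%:R ^+ k / 2 * #|D2|%:R * #|D'|%:R ^+ k = n ^+ k / 2 * #|D2|%:R.
    by field; rewrite gt_eqF ?exprn_gt0.
  rewrite mulrC ler_wpM2l ?ler0n //; have := good_card; lra.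
- move=> t t'; rewrite !inE => /andP[_ /andP[_ b1]] /andP[_ /andP[_ b2]].
  have shE u x : sampled (sh z u) x = sampled z (x + u).
    by congr (_ / _); apply: eq_bigr => i _; rewrite ffunE opprB addrA.
  pose b' := [set x | x + t - t' \in bad (sh z t')].
  have cb' : #|b'| = #|bad (sh z t')|.
    rewrite -[RHS](card_preimset _ (addIr (t - t'))).
    by apply: eq_card => x; rewrite !inE addrA.
  apply: le_trans (_ : #|bad (sh z t) :|: b'|%:R <= _).
    rewrite ler_nat subset_leq_card //; apply/subsetP => x; rewrite !inE => /and3P[xE x'E H].
    rewrite xE x'E /= !shE subrK; apply/orP; move: H.
    set p1 := smooth _; set p2 := smooth _; set q := sampled _ _ => H.
    case: (ltP eps `|q - p2|) => [|H1]; [by left|right].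
    rewrite ltNge; apply/negP => H3.
    have := ler_distD q p1 p2; rewrite (distrC p1 q) => H4; lra.
  apply: le_trans (_ : (#|bad (sh z t)| + #|b'|)%:R <= _).
    by rewrite ler_nat cardsU leq_subr.
  rewrite natrD cb'; have := lerD b1 b2; lra.
Qed.

End Sampling.

(** * Fourier analysis and Chang's lemma *)

Lemma sum_CauchySchwarz (R : realFieldType) (I : finType) (a b : I -> R) :
  (\sum_i a i * b i) ^+ 2 <= (\sum_i a i ^+ 2) * (\sum_i b i ^+ 2).
Proof.
have : 0 <= \sum_i \sum_j (a i * b j - a j * b i) ^+ 2.
  by apply: sumr_ge0 => i _; apply: sumr_ge0 => j _; exact: sqr_ge0.
have -> : \sum_i \sum_j (a i * b j - a j * b i) ^+ 2 =
  \sum_i \sum_j a i ^+ 2 * b j ^+ 2 + \sum_i \sum_j a j ^+ 2 * b i ^+ 2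
  - 2 * \sum_i \sum_j (a i * b i) * (a j * b j).
  rewrite mulr_sumr -big_split -sumrB /=; apply: eq_bigr => i _.
  by rewrite mulr_sumr -big_split -sumrB /=; apply: eq_bigr => j _; ring.
have -> : \sum_i \sum_j a i ^+ 2 * b j ^+ 2 = (\sum_i a i ^+ 2) * (\sum_i b i ^+ 2).
  by rewrite mulr_suml; apply: eq_bigr => i _; rewrite mulr_sumr.
have -> : \sum_i \sum_j a j ^+ 2 * b i ^+ 2 = (\sum_i a i ^+ 2) * (\sum_i b i ^+ 2).
  by rewrite exchange_big mulr_suml; apply: eq_bigr => i _; rewrite mulr_sumr.
have -> : \sum_i \sum_j (a i * b i) * (a j * b j) = (\sum_i a i * b i) ^+ 2.
  by rewrite expr2 mulr_suml; apply: eq_bigr => i _; rewrite mulr_sumr.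
lra.
Qed.

Section Averaging.
Variables (R : realFieldType) (G : finZmodType) (T : {set G}).
Implicit Types (h K : G -> R).

(** Convolution with the normalised autocorrelation of T: a self-adjoint operator with a nonnegative
    Fourier multiplier, called [theta] below. *)
Definition avg h x := (\sum_(t in T) \sum_(t' in T) h (x + t - t')) / #|T|%:R ^+ 2.

Lemma avg_adj K h : \sum_x avg K x * h x = \sum_x K x * avg h x.
Proof.
rewrite /avg; under eq_bigr => x _ do rewrite mulrAC mulr_suml.
under [in RHS]eq_bigr => x _ do rewrite mulrA mulr_sumr.
rewrite -!mulr_suml exchange_big /= [in RHS]exchange_big /=; congr (_ / _).
under eq_bigr => t _ do (under eq_bigr => x _ do rewrite mulr_suml; rewrite exchange_big /=).
under [in RHS]eq_bigr => t _ do (under eq_bigr => x _ do rewrite mulr_sumr; rewrite exchange_big /=).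
rewrite exchange_big /=; apply: eq_bigr => t' _; apply: eq_bigr => t _.
rewrite -(sum_shift _ (t' - t)); apply: eq_bigr => x _.
by rewrite !addrA subrK addrK.
Qed.

Lemma iter_avg_adj l K h : \sum_x iter l avg K x * h x = \sum_x K x * iter l avg h x.
Proof. by elim: l h => //= l IH h; rewrite avg_adj IH -iterSr. Qed.

Lemma iter_avg_shift l h u x : iter l avg (fun z => h (z + u)) x = iter l avg h (x + u).
Proof.
elim: l x => //= l IH x; rewrite /avg; congr (_ / _).
apply: eq_bigr => t _; apply: eq_bigr => t' _; rewrite IH; congr (iter l avg h _).
by rewrite addrAC; congr (_ - _); rewrite addrAC.
Qed.

Lemma iter_avg_le l h (V : R) : (0 < #|T|)%N -> (forall x, h x <= V) -> forall x, iter l avg h x <= V.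
Proof.
move=> T0 hV; elim: l => //= l IH x; rewrite /avg ler_pdivrMr ?exprn_gt0 ?ltr0n //.
apply: le_trans (_ : \sum_(t in T) \sum_(t' in T) V <= _).
  by apply: ler_sum => t _; apply: ler_sum => t' _.
by rewrite !sumr_const -mulrnA expr2 -natrM mulr_natr.
Qed.

End Averaging.

Section Fourier.
Variables (R : realType) (G : finComNzRingType) (c s : G -> R).
(* [c] and [s] are the real and imaginary parts of a generating character e of the additive group of
   the ring [G]: its other characters are x |-> e(xi * x). *)
Hypothesis c0 : c 0 = 1.
Hypothesis cD : forall x y, c (x + y) = c x * c y - s x * s y.
Hypothesis sD : forall x y, s (x + y) = s x * c y + c x * s y.
Hypothesis cN : forall x, c (- x) = c x.
Hypothesis sN : forall x, s (- x) = - s x.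
Hypothesis cs1 : forall x, c x ^+ 2 + s x ^+ 2 = 1.
Hypothesis orth : forall x, x != 0 -> \sum_xi c (xi * x) = 0.
Implicit Types (h : G -> R) (x y u xi eta : G) (T D : {set G}).

Lemma c_le1 x : `|c x| <= 1.
Proof. by have := cs1 x; rewrite -(expr_le1 (n := 2)) ?normr_ge0 // -normrX ger0_norm ?sqr_ge0 // => <-; rewrite lerDl sqr_ge0. Qed.

Lemma s_le1 x : `|s x| <= 1.
Proof. by have := cs1 x; rewrite -(expr_le1 (n := 2)) ?normr_ge0 // -normrX ger0_norm ?sqr_ge0 // => <-; rewrite lerDr sqr_ge0. Qed.

Lemma s0 : s 0 = 0.
Proof. by have := sN 0; rewrite oppr0 => H; lra. Qed.

(** The length |1 - e(x)|; [chordD] is the triangle inequality for |1 - e(x) e(y)|. *)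
Definition chord x : R := Num.sqrt ((1 - c x) ^+ 2 + s x ^+ 2).

Lemma chord_arg_ge0 x : 0 <= (1 - c x) ^+ 2 + s x ^+ 2.
Proof. by rewrite addr_ge0 ?sqr_ge0. Qed.

Lemma chord_sqr x : chord x ^+ 2 = (1 - c x) ^+ 2 + s x ^+ 2.
Proof. exact: sqr_sqrtr (chord_arg_ge0 x). Qed.

Lemma chord_ge0 x : 0 <= chord x. Proof. exact: sqrtr_ge0. Qed.

Lemma chord_le2 x : chord x <= 2.
Proof.
rewrite -(@ler_pXn2r _ 2) ?nnegrE ?chord_ge0 // chord_sqr.
have := cs1 x; have := c_le1 x; rewrite ler_norml => /andP[? ?].
rewrite !expr2; nra.
Qed.

Lemma chord0 : chord 0 = 0.
Proof. by rewrite /chord c0 s0 subrr expr0n addr0 sqrtr0. Qed.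

Lemma chordN x : chord (- x) = chord x.
Proof. by rewrite /chord cN sN sqrrN. Qed.

Lemma chordD x y : chord (x + y) <= chord x + chord y.
Proof.
rewrite -(@ler_pXn2r _ 2) ?nnegrE ?addr_ge0 ?chord_ge0 // sqrrD !chord_sqr cD sD.
pose X := 1 - c x; pose Y := 1 - c y.
(* Cauchy-Schwarz in the plane; the square introduced below is the remaining term of Lagrange's
   identity. *)
have cr : X * (c x * Y + s x * s y) + - s x * (s x * Y - c x * s y) <= chord x * chord y.
  apply: le_trans (ler_norm _) _; rewrite -(@ler_pXn2r _ 2) ?nnegrE ?normr_ge0 ?mulr_ge0 ?chord_ge0 //.
  rewrite -normrX ger0_norm ?sqr_ge0 // exprMn !chord_sqr.
  have e : (c x * Y + s x * s y) ^+ 2 + (s x * Y - c x * s y) ^+ 2 = Y ^+ 2 + s y ^+ 2.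
    rewrite -[RHS]mul1r -(cs1 x); ring.
  have := sqr_ge0 (X * (s x * Y - c x * s y) + s x * (c x * Y + s x * s y)).
  rewrite -/X -/Y -e; lra.
rewrite -mulr_natl.
have E : (1 - (c x * c y - s x * s y)) ^+ 2 + (s x * c y + c x * s y) ^+ 2 =
  (X ^+ 2 + s x ^+ 2) + (Y ^+ 2 + s y ^+ 2) * (c x ^+ 2 + s x ^+ 2)
   + 2 * (X * (c x * Y + s x * s y) + - s x * (s x * Y - c x * s y)).
  rewrite /X /Y; ring.
rewrite E cs1 mulr1; rewrite /X /Y in cr *; lra.
Qed.

Definition psi (L : seq G) x := \sum_(l <- L) chord (l * x).

Lemma psi_ge0 L x : 0 <= psi L x.
Proof. by apply: sumr_ge0 => l _; exact: chord_ge0. Qed.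

Lemma psi0 L : psi L 0 = 0.
Proof. by apply: big1 => l _; rewrite mulr0 chord0. Qed.

Lemma psiN L x : psi L (- x) = psi L x.
Proof. by apply: eq_bigr => l _; rewrite mulrN chordN. Qed.

Lemma psiD L x y : psi L (x + y) <= psi L x + psi L y.
Proof. by rewrite -big_split; apply: ler_sum => l _; rewrite mulrDr chordD. Qed.

Lemma psi_cat L L' x : psi (L ++ L') x = psi L x + psi L' x.
Proof. exact: big_cat. Qed.

Definition fc h xi := \sum_x h x * c (xi * x).
Definition fs h xi := \sum_x h x * s (xi * x).
Definition fq h xi := fc h xi ^+ 2 + fs h xi ^+ 2.

Lemma fq_ge0 h xi : 0 <= fq h xi.
Proof. by rewrite addr_ge0 ?sqr_ge0. Qed.

Lemma fqE h xi : fq h xi = \sum_x \sum_y h x * h y * c (xi * (x - y)).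
Proof.
rewrite /fq !expr2 /fc /fs !mulr_suml -big_split /=; apply: eq_bigr => x _.
rewrite !mulr_sumr -big_split /=; apply: eq_bigr => y _.
by rewrite mulrBr cD cN sN; ring.
Qed.

Lemma parseval h : \sum_xi fq h xi = #|G|%:R * \sum_x h x ^+ 2.
Proof.
under eq_bigr => xi _ do rewrite fqE.
rewrite exchange_big /= mulr_sumr; apply: eq_bigr => x _.
rewrite exchange_big /=; rewrite [LHS](bigD1 x) //= [X in _ + X]big1 => [|y yx].
  rewrite addr0 (eq_bigr (fun _ => h x ^+ 2)) => [|xi _]; last by rewrite subrr mulr0 c0 mulr1 expr2.
  by rewrite sumr_const cardT -cardE mulr_natl.
by rewrite -mulr_sumr orth ?mulr0 // subr_eq0 eq_sym.
Qed.

Lemma fq_shift h u xi : fq (fun x => h (x - u) - h x) xi = fq h xi * chord (xi * u) ^+ 2.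
Proof.
have E1 : fc (fun x => h (x - u) - h x) xi = fc h xi * c (xi * u) - fs h xi * s (xi * u) - fc h xi.
  rewrite /fc /fs; under eq_bigr => x _ do rewrite mulrBl.
  rewrite sumrB -(sum_shift _ u); congr (_ - _); rewrite !mulr_suml -sumrB.
  by apply: eq_bigr => x _; rewrite addrK mulrDr cD; ring.
have E2 : fs (fun x => h (x - u) - h x) xi = fs h xi * c (xi * u) + fc h xi * s (xi * u) - fs h xi.
  rewrite /fc /fs; under eq_bigr => x _ do rewrite mulrBl.
  rewrite sumrB -(sum_shift _ u); congr (_ - _); rewrite !mulr_suml -big_split /=.
  by apply: eq_bigr => x _; rewrite addrK mulrDr sD; ring.
by rewrite /fq E1 E2 chord_sqr; ring.
Qed.

Definition theta T xi := fq (ind R T) xi / #|T|%:R ^+ 2.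

Lemma theta_ge0 T xi : 0 <= theta T xi.
Proof. by rewrite divr_ge0 ?fq_ge0 ?sqr_ge0. Qed.

Lemma theta_le1 T xi : theta T xi <= 1.
Proof.
have [T0|T0] := posnP #|T|; first by rewrite /theta T0 expr0n invr0 mulr0 ler01.
rewrite ler_pdivrMr ?exprn_gt0 ?ltr0n // mul1r fqE.
apply: le_trans (_ : \sum_x \sum_y ind R T x * ind R T y <= _).
  apply: ler_sum => x _; apply: ler_sum => y _; rewrite ler_piMr ?mulr_ge0 ?ind_ge0 //.
  exact: le_trans (ler_norm _) (c_le1 _).
by under eq_bigr => x _ do rewrite -mulr_sumr sum_ind; rewrite -mulr_suml sum_ind expr2.
Qed.

Lemma avg_fourier T h xi :
  (fc (avg T h) xi = theta T xi * fc h xi) /\ (fs (avg T h) xi = theta T xi * fs h xi).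
Proof.
pose a := \sum_(t in T) c (xi * t); pose b := \sum_(t in T) s (xi * t).
have aE : fc (ind R T) xi = a by exact: sum_indM.
have bE : fs (ind R T) xi = b by exact: sum_indM.
have cc z : \sum_(t in T) \sum_(t' in T) c (z - xi * t + xi * t') = c z * (a ^+ 2 + b ^+ 2).
  rewrite (eq_bigr (fun t => (c z * c (xi * t) + s z * s (xi * t)) * a - (s z * c (xi * t) - c z * s (xi * t)) * b)) => [|t _].
    by rewrite sumrB -!mulr_suml !big_split /= sumrN -!mulr_sumr -/a -/b; ring.
  by rewrite /a /b !mulr_sumr -sumrB; apply: eq_bigr => t' _; rewrite !(cD, sD) cN sN; ring.
have ss z : \sum_(t in T) \sum_(t' in T) s (z - xi * t + xi * t') = s z * (a ^+ 2 + b ^+ 2).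
  rewrite (eq_bigr (fun t => (s z * c (xi * t) - c z * s (xi * t)) * a + (c z * c (xi * t) + s z * s (xi * t)) * b)) => [|t _].
    by rewrite big_split /= -!mulr_suml !big_split /= sumrN -!mulr_sumr -/a -/b; ring.
  by rewrite /a /b !mulr_sumr -big_split /=; apply: eq_bigr => t' _; rewrite !(cD, sD) cN sN; ring.
have gen (f : G -> R) : (forall z, \sum_(t in T) \sum_(t' in T) f (z - xi * t + xi * t') = f z * (a ^+ 2 + b ^+ 2)) ->
   \sum_x avg T h x * f (xi * x) = theta T xi * \sum_x h x * f (xi * x).
  move=> H; rewrite (avg_adj T h (fun x => f (xi * x))) mulr_sumr; apply: eq_bigr => x _.
  have -> : avg T (fun x => f (xi * x)) x = theta T xi * f (xi * x); last by rewrite mulrCA.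
  have -> : theta T xi = (a ^+ 2 + b ^+ 2) / #|T|%:R ^+ 2 by rewrite /theta /fq aE bE.
  rewrite mulrAC [_ * f _]mulrC -H /avg; congr (_ / _).
  rewrite exchange_big /=; apply: eq_bigr => t _; apply: eq_bigr => t' _.
  by rewrite mulrBr mulrDr addrAC.
by split; apply: gen.
Qed.

Lemma iter_avg_fq T h l xi : fq (iter l (avg T) h) xi = theta T xi ^+ l.*2 * fq h xi.
Proof.
elim: l => [|l IH]; first by rewrite mul1r.
rewrite iterS {1}/fq; have [-> ->] := avg_fourier T (iter l (avg T) h) xi.
move: IH; rewrite {1}/fq; move: (theta T xi) => th IH.
by rewrite !exprMn -mulrDr IH doubleS !exprS; ring.
Qed.

(** Frequencies in the large spectrum of T (theta > 1/4) are almost fixed by u, and the others are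
    damped by theta^l <= 4^-l. By Parseval the averaged indicator K of A1 moves by at most eps^2
    |A1| in squared L^2 norm; Cauchy-Schwarz against h, supported on E, concludes. *)
Lemma avg_almost_invariant T (A1 E : {set G}) h l (eps : R) u : (0 < #|A1|)%N -> (0 < #|T|)%N -> 0 <= eps ->
  2 * (1/4) ^+ l <= eps -> (forall xi, 1/4 < theta T xi -> chord (xi * u) <= eps) ->
  (forall x, 0 <= h x <= ind R E x) ->
  (\sum_(m in A1) iter l (avg T) h (m + u) - \sum_(m in A1) iter l (avg T) h m) ^+ 2
   <= eps ^+ 2 * #|E|%:R * #|A1|%:R.
Proof.
move=> A0 T0 e0 el sp hE; pose K := iter l (avg T) (ind R A1).
have P v : \sum_(m in A1) iter l (avg T) h (m + v) = \sum_x K (x - v) * h x.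
  rewrite -sum_indM; under eq_bigr => x _ do rewrite -iter_avg_shift.
  rewrite -iter_avg_adj -/K -(sum_shift _ (- v)); apply: eq_bigr => x _.
  by rewrite subrK.
have -> : \sum_(m in A1) iter l (avg T) h m = \sum_x K x * h x.
  have := P 0; under eq_bigr => m _ do rewrite addr0; move=> ->.
  by apply: eq_bigr => x _; rewrite subr0.
rewrite P -sumrB; under eq_bigr => x _ do rewrite -mulrBl.
apply: le_trans (sum_CauchySchwarz _ _) _.
have hh : \sum_x h x ^+ 2 <= #|E|%:R.
  rewrite -(sum_ind R E); apply: ler_sum => x _; have /andP[h0 h1] := hE x.
  apply: le_trans h1; rewrite expr2 ler_piMr //.
  by apply: le_trans (ind_le1 R E x); case/andP: (hE x).
have M0 : 0 < #|G|%:R :> R by rewrite ltr0n; apply/card_gt0P; exists 0.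
have KK : \sum_x (K (x - u) - K x) ^+ 2 <= eps ^+ 2 * #|A1|%:R.
  rewrite -(ler_pM2l M0) -parseval.
  apply: le_trans (_ : \sum_xi eps ^+ 2 * fq (ind R A1) xi <= _).
    apply: ler_sum => xi _; rewrite fq_shift iter_avg_fq mulrAC ler_wpM2r ?fq_ge0 //.
    have t0 := theta_ge0 T xi; have t1 := theta_le1 T xi; have q0 := chord_ge0 (xi * u).
    rewrite -mul2n mulnC exprM -exprMn.
    apply: lerXn2r; rewrite ?nnegrE ?mulr_ge0 ?exprn_ge0 //.
    have [tb|ts] := ltP (1/4) (theta T xi).
      by apply: le_trans (sp _ tb); rewrite ler_piMl // exprn_ile1.
    apply: le_trans el; rewrite mulrC; apply: ler_pM; rewrite ?exprn_ge0 ?chord_le2 //.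
    by apply: lerXn2r; rewrite ?nnegrE //; lra.
  rewrite -mulr_sumr parseval mulrCA ler_wpM2l ?(ltW M0) // ler_wpM2l ?sqr_ge0 //.
  rewrite -(sum_ind R A1); apply: ler_sum => x _; by rewrite expr2 ind_sqr.
rewrite mulrAC; apply: ler_pM => //; apply: sumr_ge0 => x _; exact: sqr_ge0.
Qed.

Variables (T D : {set G}).
Hypothesis Dsym : forall x, (- x \in D) = (x \in D).
Hypothesis TD : T \subset D.
Hypothesis T0 : (0 < #|T|)%N.

Let D0 : 0 < #|D|%:R :> R.
Proof. by rewrite ltr0n; apply: leq_trans T0 (subset_leq_card TD). Qed.

Let T0' : 0 < #|T|%:R :> R. Proof. by rewrite ltr0n. Qed.

(** The normalised Fourier coefficient of D, which is real because D is symmetric. *)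
Definition mu xi := (\sum_(x in D) c (xi * x)) / #|D|%:R.

Lemma sum_sin0 xi : \sum_(x in D) s (xi * x) = 0.
Proof.
have : \sum_(x in D) s (xi * x) = - \sum_(x in D) s (xi * x).
  rewrite {1}(reindex_inj oppr_inj) /= -sumrN; apply: eq_big => [x|x _]; first exact: Dsym.
  by rewrite mulrN sN.
by move=> H; lra.
Qed.

Fixpoint spn (L : seq G) : seq G :=
  if L is l :: L' then spn L' ++ map (fun v => v + l) (spn L') ++ map (fun v => v - l) (spn L') else [:: 0].

Lemma chord_spn L v u : v \in spn L -> chord (v * u) <= psi L u.
Proof.
elim: L v => [|l L IH] v /=; first by rewrite inE => /eqP ->; rewrite mul0r chord0 psi_ge0.
have pE : psi (l :: L) u = chord (l * u) + psi L u by rewrite /psi big_cons.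
rewrite pE !mem_cat => /or3P[/IH H|/mapP[w /IH H ->]|/mapP[w /IH H ->]].
- by have := chord_ge0 (l * u); lra.
- by rewrite mulrDl; have := chordD (w * u) (l * u); lra.
- by rewrite mulrBl; have := chordD (w * u) (- (l * u)); rewrite chordN; lra.
Qed.

(* Dissociativity relative to D: up to the bias kap, no element of the list is a combination with
   coefficients in {-1, 0, 1} of those after it. *)
Fixpoint diss (kap : R) (L : seq G) : bool :=
  if L is l :: L' then all (fun v => `|mu (l + v)| <= kap) (spn L') && diss kap L' else true.

Variables (p q : G -> R).
Hypothesis pq1 : forall l, `|p l| <= 1 /\ `|q l| <= 1.

(** 1 + [yv] is a factor of a Riesz product. The weight 1/16 keeps it positive and makes the
    quadratic loss 2 y^2 <= 1/128 smaller than the gain theta/16 >= 1/64. *)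
Definition yv l n := 1/16 * (p l * c (l * n) + q l * s (l * n)).

(* Product-to-sum formulas: each factor 1 + yv l spreads the frequency eta to eta + l and eta - l. *)
Lemma riesz_coef kap L : forall eta (P Q m : R), 0 <= kap -> `|P| <= m -> `|Q| <= m ->
  (forall v, v \in spn L -> `|mu (eta + v)| <= kap) ->
  `|\sum_(n in D) (P * c (eta * n) + Q * s (eta * n)) * \prod_(l <- L) (1 + yv l n)|
   <= m * kap * 2 ^+ size L * #|D|%:R.
Proof.
elim: L => [|l L IH] eta P Q m k0 Pm Qm H.
  under eq_bigr => n _ do rewrite big_nil mulr1.
  rewrite big_split /= -!mulr_sumr sum_sin0 mulr0 addr0 expr0 mulr1.
  have := H 0; rewrite inE eqxx addr0 => /(_ isT) Hm.
  have -> : \sum_(n in D) c (eta * n) = mu eta * #|D|%:R by rewrite /mu divfK // gt_eqF.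
  rewrite mulrA normrM (gtr0_norm D0) ler_wpM2r ?(ltW D0) // normrM.
  by apply: ler_pM => //; exact: normr_ge0.
have m0 : 0 <= m by apply: le_trans Pm; exact: normr_ge0.
have Ha v : v \in spn L -> `|mu (eta + v)| <= kap by move=> vL; apply: H; rewrite /= mem_cat vL.
have Hb v : v \in spn L -> `|mu (eta + l + v)| <= kap.
  move=> vL; rewrite -addrA (addrC l); apply: H; rewrite /= !mem_cat.
  by apply/or3P/Or32/mapP; exists v.
have Hc v : v \in spn L -> `|mu (eta - l + v)| <= kap.
  move=> vL; rewrite -addrA (addrC (- l)); apply: H; rewrite /= !mem_cat.
  by apply/or3P/Or33/mapP; exists v.
have [p1 q1] := pq1 l.
pose P1 := 1/32 * (P * p l - Q * q l); pose Q1 := 1/32 * (P * q l + Q * p l).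
pose P2 := 1/32 * (P * p l + Q * q l); pose Q2 := 1/32 * (Q * p l - P * q l).
have bd (x1 x2 y1 y2 : R) : `|x1| <= m -> `|x2| <= m -> `|y1| <= 1 -> `|y2| <= 1 ->
   `|1/32 * (x1 * y1 + x2 * y2)| <= 1/16 * m.
  move=> h1 h2 h3 h4; rewrite normrM ger0_norm; last by lra.
  have e1 : `|x1 * y1| <= m by rewrite normrM -[m]mulr1; apply: ler_pM.
  have e2 : `|x2 * y2| <= m by rewrite normrM -[m]mulr1; apply: ler_pM.
  by have := ler_normD (x1 * y1) (x2 * y2); lra.
have N1 : `|P1| <= 1/16 * m by rewrite /P1 -mulrN; apply: bd; rewrite ?normrN.
have N2 : `|Q1| <= 1/16 * m by apply: bd.
have N3 : `|P2| <= 1/16 * m by apply: bd.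
have N4 : `|Q2| <= 1/16 * m by rewrite /Q2 -mulrN; apply: bd; rewrite ?normrN.
have i1 := IH eta P Q m k0 Pm Qm Ha.
have i2 := IH (eta + l) P1 Q1 _ k0 N1 N2 Hb.
have i3 := IH (eta - l) P2 Q2 _ k0 N3 N4 Hc.
have -> : \sum_(n in D) (P * c (eta * n) + Q * s (eta * n)) * \prod_(j <- l :: L) (1 + yv j n) =
  \sum_(n in D) (P * c (eta * n) + Q * s (eta * n)) * \prod_(j <- L) (1 + yv j n)
  + (\sum_(n in D) (P1 * c ((eta + l) * n) + Q1 * s ((eta + l) * n)) * \prod_(j <- L) (1 + yv j n)
  + \sum_(n in D) (P2 * c ((eta - l) * n) + Q2 * s ((eta - l) * n)) * \prod_(j <- L) (1 + yv j n)).
  rewrite -!big_split /=; apply: eq_bigr => n _; rewrite big_cons /yv.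
  have -> : (eta + l) * n = eta * n + l * n by rewrite mulrDl.
  have -> : (eta - l) * n = eta * n - l * n by rewrite mulrBl.
  by rewrite !(cD, sD) cN sN /P1 /Q1 /P2 /Q2; field.
apply: le_trans (ler_normD _ _) _; apply: le_trans (lerD i1 (le_trans (ler_normD _ _) (lerD i2 i3))) _.
have : 0 <= m * kap * 2 ^+ size L * #|D|%:R by rewrite !mulr_ge0 ?exprn_ge0 ?ler0n.
rewrite /= exprS; lra.
Qed.

(** When one factor is opened, the summand 1 leaves the shorter product, and by dissociativity the
    frequency l is almost orthogonal to that product on D. The error kap 2^|L| fits since 2^|L| +
    4^|L| <= 4^(|L|+1). *)
Lemma riesz_mean kap L : 0 <= kap -> diss kap L ->
  \sum_(n in D) \prod_(l <- L) (1 + yv l n) <= (1 + kap * 4 ^+ size L) * #|D|%:R.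
Proof.
move=> k0; elim: L => [|l L IH] /=.
  move=> _; under eq_bigr => n _ do rewrite big_nil.
  by rewrite sumr_const expr0 mulr1 mulrDl mul1r lerDl mulr_ge0 ?ler0n.
case/andP => /allP Hl /IH {}IH.
have [p1 q1] := pq1 l.
have b1 : `|1/16 * p l| <= 1 by rewrite normrM ger0_norm; lra.
have b2 : `|1/16 * q l| <= 1 by rewrite normrM ger0_norm; lra.
have H := riesz_coef k0 b1 b2 Hl.
have -> : \sum_(n in D) \prod_(j <- l :: L) (1 + yv j n) =
  \sum_(n in D) \prod_(j <- L) (1 + yv j n) +
  \sum_(n in D) (1/16 * p l * c (l * n) + 1/16 * q l * s (l * n)) * \prod_(j <- L) (1 + yv j n).
  rewrite -big_split /=; apply: eq_bigr => n _; rewrite big_cons /yv.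
  by field.
have H2 := le_trans (ler_norm _) H.
have e1 : kap * 2 ^+ size L * #|D|%:R <= kap * 4 ^+ size L * #|D|%:R.
  rewrite ler_wpM2r ?ler0n // ler_wpM2l //; apply: lerXn2r; rewrite ?nnegrE //; lra.
have : 0 <= kap * 4 ^+ size L * #|D|%:R by rewrite !mulr_ge0 ?exprn_ge0 ?ler0n.
rewrite exprS; move: H2; rewrite mul1r; lra.
Qed.

End Fourier.

Section Chang.
Variables (R : realType) (G : finComNzRingType) (c s : G -> R).
Hypothesis c0 : c 0 = 1.
Hypothesis cD : forall x y, c (x + y) = c x * c y - s x * s y.
Hypothesis sD : forall x y, s (x + y) = s x * c y + c x * s y.
Hypothesis cN : forall x, c (- x) = c x.
Hypothesis sN : forall x, s (- x) = - s x.
Hypothesis cs1 : forall x, c x ^+ 2 + s x ^+ 2 = 1.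
Variables (T D : {set G}).
Hypothesis Dsym : forall x, (- x \in D) = (x \in D).
Hypothesis TD : T \subset D.
Hypothesis T0 : (0 < #|T|)%N.
Local Notation theta := (theta c s T).
Local Notation mu := (mu c D).
Local Notation diss := (diss c D).
Local Notation chord := (chord c s).
Local Notation psi := (psi c s).

Let T0' : 0 < #|T|%:R :> R. Proof. by rewrite ltr0n. Qed.
Let D0 : 0 < #|D|%:R :> R.
Proof. by rewrite ltr0n; apply: leq_trans T0 (subset_leq_card TD). Qed.

(** With the Fourier coefficients of T as weights the Riesz product is large on T: each frequency
    adds at least 1/64 - 1/128 to the mean exponent, and convexity of exp (its tangent at z) gives
    the mean exp(|L|/128) on T. Over D the product sums to at most 2 |D|. *)
Lemma diss_size (kap : R) L : 0 <= kap -> diss kap L -> all (fun l => 1/4 < theta l) L ->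
  kap * 4 ^+ size L <= 1 -> expR ((size L)%:R / 128 : R) * #|T|%:R <= 2 * #|D|%:R.
Proof.
move=> k0 dL sL kL.
pose p l := fc c (ind R T) l / #|T|%:R; pose q l := fs s (ind R T) l / #|T|%:R.
have pqE l : p l ^+ 2 + q l ^+ 2 = theta l by rewrite /p /q /theta /fq !expr_div_n -mulrDl.
have pq1 l : `|p l| <= 1 /\ `|q l| <= 1.
  have := theta_le1 cD cN sN cs1 T l; rewrite -/(theta l) -pqE => H.
  have := sqr_ge0 (p l); have := sqr_ge0 (q l) => h1 h2.
  by split; rewrite -(expr_le1 (n := 2)) ?normr_ge0 // -normrX ger0_norm ?sqr_ge0 //; lra.
have := riesz_mean cD sD cN sN Dsym TD T0 pq1 k0 dL => H.
pose y := yv c s p q; pose Z n := \sum_(l <- L) (y l n - 2 * y l n ^+ 2).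
have yb l n : `|y l n| <= 1/16.
  rewrite /y /yv normrM ger0_norm; last by lra.
  suff : `|p l * c (l * n) + q l * s (l * n)| <= 1 by lra.
  rewrite -(expr_le1 (n := 2)) ?normr_ge0 // -normrX ger0_norm ?sqr_ge0 //.
  have := theta_le1 cD cN sN cs1 T l; rewrite -/(theta l) -pqE -[p l ^+ 2 + _]mulr1 -(cs1 (l * n)) => h1.
  have := sqr_ge0 (p l * s (l * n) - q l * c (l * n)); lra.
have pZ n : expR (Z n) <= \prod_(l <- L) (1 + y l n).
  rewrite /Z expR_sum; elim: (L) => [|l L' IH]; first by rewrite !big_nil.
  rewrite !big_cons; have := yb l n; rewrite ler_norml => /andP[? ?].
  apply: ler_pM => //; [exact: expR_ge0|by apply: prodr_ge0 => j _; exact: expR_ge0|].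
  by apply: expR_le_1D; lra.
have pr0 n : 0 <= \prod_(l <- L) (1 + y l n) by apply: le_trans (pZ n); exact: expR_ge0.
pose z := (size L)%:R / 128 : R.
have Zs : z * #|T|%:R <= \sum_(n in T) Z n.
  rewrite /Z exchange_big /=.
  have -> : z * #|T|%:R = \sum_(l <- L) (1/128 * #|T|%:R).
    by rewrite big_const_seq count_predT iter_addr_0 /z -mulr_natl; field.
  rewrite big_seq [leRHS]big_seq; apply: ler_sum => l lL.
  have tl := allP sL _ lL.
  have -> : \sum_(n in T) (y l n - 2 * y l n ^+ 2) = \sum_(n in T) y l n - \sum_(n in T) 2 * y l n ^+ 2 by rewrite sumrB.
  have s1 : \sum_(n in T) y l n = 1/16 * theta l * #|T|%:R.
    rewrite /y /yv -mulr_sumr big_split /= -!mulr_sumr.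
    have -> : \sum_(n in T) c (l * n) = p l * #|T|%:R by rewrite /p divfK ?gt_eqF // /fc sum_indM.
    have -> : \sum_(n in T) s (l * n) = q l * #|T|%:R by rewrite /q divfK ?gt_eqF // /fs sum_indM.
    by rewrite -pqE; ring.
  have s2 : \sum_(n in T) 2 * y l n ^+ 2 <= 1/128 * #|T|%:R.
    have -> : 1/128 * #|T|%:R = \sum_(n in T) (1/128 : R) by rewrite sumr_const mulr_natr.
    apply: ler_sum => n _.
    have : `|y l n| ^+ 2 <= (1/16) ^+ 2 by apply: lerXn2r; rewrite ?nnegrE ?normr_ge0 //; lra.
    by rewrite -normrX ger0_norm ?sqr_ge0 // !expr2; lra.
  have : 1/4 * #|T|%:R <= theta l * #|T|%:R by rewrite ler_wpM2r ?(ltW T0') // ltW.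
  by rewrite s1; lra.
have J : expR z * #|T|%:R <= \sum_(n in T) \prod_(l <- L) (1 + y l n).
  apply: le_trans (_ : \sum_(n in T) expR z * (1 + (Z n - z)) <= _).
    rewrite -mulr_sumr ler_wpM2l ?expR_ge0 // big_split /= sumrB !sumr_const -[z *+ _]mulr_natr; lra.
  apply: ler_sum => n _; apply: le_trans (pZ n).
  have -> : expR (Z n) = expR z * expR (Z n - z) by rewrite -expRD; congr expR; ring.
  by rewrite ler_wpM2l ?expR_ge0 // expR_ge1Dx.
apply: le_trans J (le_trans _ (le_trans H _)).
  rewrite [leLHS]big_mkcond [leRHS]big_mkcond; apply: ler_sum => n _.
  case nT: (n \in T); first by rewrite (subsetP TD _ nT).
  by case: ifP.
rewrite ler_wpM2r ?ler0n //; lra.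
Qed.

(** A dissociated list inside the large spectrum is extended greedily. By [diss_size] it cannot
    reach length K0, so it stops, and then every large frequency correlates with D after a
    translation by the span. *)
Lemma diss_maximal (kap : R) K0 : 0 <= kap -> kap * 4 ^+ K0 <= 1 ->
  2 * #|D|%:R < expR (K0%:R / 128 : R) * #|T|%:R ->
  exists L : seq G, (size L <= K0)%N /\
    forall xi, 1/4 < theta xi -> exists2 v, v \in spn L & kap < `|mu (xi + v)|.
Proof.
move=> k0 kK big.
suff : forall j, (j <= K0)%N -> (exists L : seq G, (size L <= K0)%N /\
    forall xi, 1/4 < theta xi -> exists2 v, v \in spn L & kap < `|mu (xi + v)|) \/
   (exists L : seq G, [/\ size L = j, diss kap L & all (fun l => 1/4 < theta l) L]).
  move/(_ K0 (leqnn _)) => [//|[L [sL dL aL]]].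
  by have := diss_size k0 dL aL; rewrite sL => /(_ kK); rewrite leNgt big.
elim => [|j IH] jK; first by right; exists [::].
have [|[L [sL dL aL]]] := IH (ltnW jK); first by left.
case: (boolP [forall xi, (1/4 < theta xi) ==> has (fun v => kap < `|mu (xi + v)|) (spn L)]) => [/forallP H|].
  left; exists L; rewrite sL; split; first exact: ltnW.
  by move=> xi txi; have /implyP/(_ txi)/hasP[v vL kv] := H xi; exists v.
rewrite negb_forall => /existsP[xi]; rewrite negb_imply => /andP[txi /hasPn H].
right; exists (xi :: L); split => /=; first by rewrite sL.
  by rewrite dL andbT; apply/allP => v /H; rewrite -leNgt.
by rewrite txi.
Qed.

(** Translation by u rotates the Fourier coefficient of D at eta by the angle of eta u and changes
    it by no more than the shift error; a coefficient above kap forces the rotation to be close to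
    1. Real and imaginary parts are bounded by e separately. *)
Lemma mu_large_shift (kap e : R) eta u : 0 < kap -> kap < `|mu eta| ->
  shift_err R D u <= kap * e * #|D|%:R -> chord (eta * u) <= 2 * e.
Proof.
move=> k0 km err; pose C := \sum_(x in D) c (eta * x).
have CE : `|C| = `|mu eta| * #|D|%:R.
  by rewrite -[X in _ * X](gtr0_norm D0) -normrM /mu divfK // gt_eqF.
have S0 := sum_sin0 sN Dsym eta.
have e1 (f : G -> R) : (forall x, `|f x| <= 1) ->
   `|\sum_x (ind R D (x + u) - ind R D x) * f x| <= shift_err R D u.
  move=> f1; apply: le_trans (ler_norm_sum _ _ _) _; apply: ler_sum => x _.
  by rewrite normrM ler_piMr.
have E1 : \sum_x (ind R D (x + u) - ind R D x) * c (eta * x) = - (C * (1 - c (eta * u))).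
  under eq_bigr => x _ do rewrite mulrBl.
  rewrite sumrB sum_indM -(sum_shift _ (- u)).
  have -> : \sum_x ind R D (x - u + u) * c (eta * (x - u)) = \sum_(x in D) c (eta * x) * c (eta * u) + \sum_(x in D) s (eta * x) * s (eta * u).
    rewrite -big_split /= -sum_indM; apply: eq_bigr => x _; rewrite subrK mulrBr cD cN sN; ring.
  by rewrite -!mulr_suml S0 -/C; ring.
have E2 : \sum_x (ind R D (x + u) - ind R D x) * s (eta * x) = - (C * s (eta * u)).
  under eq_bigr => x _ do rewrite mulrBl.
  rewrite sumrB sum_indM S0 -(sum_shift _ (- u)).
  have -> : \sum_x ind R D (x - u + u) * s (eta * (x - u)) = \sum_(x in D) s (eta * x) * c (eta * u) - \sum_(x in D) c (eta * x) * s (eta * u).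
    rewrite -sumrB /= -sum_indM; apply: eq_bigr => x _; rewrite subrK mulrBr sD cN sN; ring.
  by rewrite -!mulr_suml S0 -/C; ring.
have m0 : 0 < `|mu eta| by apply: lt_trans km.
have fin (t : R) : `|C * t| <= shift_err R D u -> `|t| <= e.
  move=> H; have : `|mu eta| * #|D|%:R * `|t| <= `|mu eta| * e * #|D|%:R.
    rewrite -CE -normrM; apply: le_trans H (le_trans err _).
    have e0 : 0 <= e.
      have : 0 <= kap * e * #|D|%:R by apply: le_trans err; apply: sumr_ge0 => x _; exact: normr_ge0.
      by rewrite pmulr_lge0 // pmulr_rge0.
    by rewrite ler_wpM2r ?(ltW D0) // ler_wpM2r // ltW.
  by rewrite mulrAC -mulrA -[leRHS]mulrA ler_pM2l // ler_pM2r.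
have a1 : `|1 - c (eta * u)| <= e.
  by apply: fin; have := e1 _ (fun x => c_le1 cs1 (eta * x)); rewrite E1 normrN.
have a2 : `|s (eta * u)| <= e.
  by apply: fin; have := e1 _ (fun x => s_le1 cs1 (eta * x)); rewrite E2 normrN.
have e0 : 0 <= e by apply: le_trans a2; exact: normr_ge0.
rewrite -(@ler_pXn2r _ 2) ?nnegrE ?chord_ge0 ?mulr_ge0 // chord_sqr.
have q1 : (1 - c (eta * u)) ^+ 2 <= e ^+ 2.
  by rewrite -(ger0_norm (sqr_ge0 _)) normrX; apply: lerXn2r; rewrite ?nnegrE ?normr_ge0.
have q2 : s (eta * u) ^+ 2 <= e ^+ 2.
  by rewrite -(ger0_norm (sqr_ge0 _)) normrX; apply: lerXn2r; rewrite ?nnegrE ?normr_ge0.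
by rewrite exprMn; have := sqr_ge0 e; rewrite !expr2 in q1 q2 *; lra.
Qed.

Lemma chang (kap : R) K0 (e : R) : 0 < kap -> kap * 4 ^+ K0 <= 1 ->
  2 * #|D|%:R < expR (K0%:R / 128 : R) * #|T|%:R ->
  exists L : seq G, (size L <= K0)%N /\
    forall u, shift_err R D u <= kap * e * #|D|%:R ->
    forall xi, 1/4 < theta xi -> chord (xi * u) <= 2 * e + psi L u.
Proof.
move=> k0 kK big; have [L [sL H]] := diss_maximal (ltW k0) kK big.
exists L; split=> // u err xi /H[v vL kv].
have h1 := mu_large_shift k0 kv err.
have h2 := chord_spn c0 cD sD cN sN cs1 u vL.
have -> : xi * u = (xi + v) * u - v * u by rewrite mulrDl addrK.
have := @chordD R G c s cD sD cs1 ((xi + v) * u) (- (v * u)).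
by rewrite (chordN cN sN); lra.
Qed.

End Chang.

(** * Density increment on Bohr balls *)

Lemma sum_exists_ge (R : realFieldType) (I : finType) (w f : I -> R) (v : R) :
  (forall i, 0 <= w i) -> 0 < \sum_i w i -> v * (\sum_i w i) <= \sum_i w i * f i ->
  exists2 i, 0 < w i & v <= f i.
Proof.
move=> w0 wp H.
have [/existsP[i /andP[? ?]]|] := boolP [exists i, (0 < w i) && (v <= f i)]; first by exists i.
rewrite negb_exists => /forallP N; exfalso; move: H; apply/negP; rewrite -ltNge mulr_sumr.
have [i _ wi] : exists2 i, true & 0 < w i.
  have [/existsP[i ?]|] := boolP [exists i, 0 < w i]; first by exists i.
  rewrite negb_exists => /forallP Z; move: wp; rewrite big1 ?ltxx // => i _.
  by apply/eqP; rewrite eq_le w0 leNgt Z.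
rewrite (bigD1 i) //= [ltRHS](bigD1 i) //=; apply: ltr_leD.
  by have := N i; rewrite wi /= -ltNge mulrC => ?; rewrite ltr_pM2r.
apply: ler_sum => j _; have := N j; rewrite negb_and -!leNgt -ltNge => /orP[wj|fj].
  have -> : w j = 0 by apply/eqP; rewrite eq_le wj w0.
  by rewrite mulr0 mul0r.
by rewrite [v * _]mulrC ler_wpM2l // ltW.
Qed.

Lemma iter_avg_sum (R : realFieldType) (G : finZmodType) (T C : {set G}) (h : G -> R) l x :
  iter l (avg T) (fun z => \sum_(u in C) h (z + u)) x = \sum_(u in C) iter l (avg T) h (x + u).
Proof.
elim: l x => //= l IH x.
have avgE (f : G -> R) z : avg T f z = (\sum_(t in T) \sum_(t' in T) f (z + t - t')) / #|T|%:R ^+ 2 by [].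
rewrite avgE (eq_bigr (fun t => \sum_(u in C) \sum_(t' in T) iter l (avg T) h (x + t - t' + u))); last first.
  by move=> t _; rewrite exchange_big; apply: eq_bigr => t' _; exact: IH.
rewrite exchange_big mulr_suml; apply: eq_bigr => u _; rewrite avgE; congr (_ / _).
apply: eq_bigr => t _; apply: eq_bigr => t' _; congr (iter l (avg T) h _).
by rewrite addrAC; congr (_ - _); rewrite addrAC.
Qed.

Section Core.
Variables (R : realType) (G : finComNzRingType) (c s : G -> R).
Hypothesis c0 : c 0 = 1.
Hypothesis cD : forall x y, c (x + y) = c x * c y - s x * s y.
Hypothesis sD : forall x y, s (x + y) = s x * c y + c x * s y.
Hypothesis cN : forall x, c (- x) = c x.
Hypothesis sN : forall x, s (- x) = - s x.
Hypothesis cs1 : forall x, c x ^+ 2 + s x ^+ 2 = 1.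
Hypothesis orth : forall x, x != 0 -> \sum_xi c (xi * x) = 0.
Local Notation psi := (psi c s).
Local Notation ind := (ind R).
Local Notation shift_err := (shift_err R).

(* Bohr sets for the l^1 norm [psi] instead of the usual maximum: [psi] is additive in the list of
   frequencies, so that intersecting two balls amounts to concatenating their lists. *)
Definition ball (L : seq G) (rho : R) : {set G} := [set x | psi L x <= rho].

Lemma ball_sym L rho x : (- x \in ball L rho) = (x \in ball L rho).
Proof. by rewrite !inE (psiN cN sN). Qed.

Lemma ball0 L rho : 0 <= rho -> 0 \in ball L rho.
Proof. by move=> r0; rewrite inE (psi0 c0 sN). Qed.

Lemma ball_card_gt0 L rho : 0 <= rho -> (0 < #|ball L rho|)%N.
Proof. by move=> r0; apply/card_gt0P; exists 0; exact: ball0. Qed.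

Lemma ball_sub L r r' : r <= r' -> ball L r \subset ball L r'.
Proof. by move=> rr; apply/subsetP => x; rewrite !inE => /le_trans; apply. Qed.

Variables (A B : {set G}) (L : seq G) (rD r2 : R) (k l kk K0 : nat) (eps kap : R).
Hypothesis AP3 : forall x y z, x \in A -> y \in A -> z \in A -> x + z = y *+ 2 -> x = y.
Let N : R := #|B|%:R.
Let a : R := #|A :&: B|%:R / N.
Let D := ball L rD.
Let D2 := ball L r2.
(** Room for a subset of D moved by l differences of elements of D2. *)
Let E := ball L (rD + (l * 2)%:R * r2).
Let p := (4 * k.*2.+1)%N.
Let sig := a ^+ p.

Hypothesis Bsym : forall x, (- x \in B) = (x \in B).
Hypothesis Binv : forall d, psi L d <= 4 * rD -> shift_err B d <= a / 32 * N.
Hypothesis Nbig : 16 <= a ^+ 2 * N.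
Hypothesis k8 : (8 <= k)%N.
Hypothesis ak : 1 <= a / 2 * (7/6) ^+ k.*2.
Hypothesis rD0 : 0 <= rD.
Hypothesis r20 : 0 <= r2.
Hypothesis AD : a / 2 * #|D|%:R ^+ 2 <= \sum_(m1 in D) \sum_(m2 in D) ind A (m2 - m1).
Hypothesis Ereg : #|E|%:R <= 2 * #|D|%:R :> R.
Hypothesis l0 : (0 < l)%N.
Hypothesis kk0 : (0 < kk)%N.
Hypothesis n1 : 16 * expR (- ((1 / (400 * l%:R)) ^+ 2 / 8 * kk%:R)) <= sig / (200 * l%:R).
Hypothesis n2 : 2 * (1/4) ^+ l <= eps.
Hypothesis n2' : eps ^+ 2 * 2 * 10000 <= sig.
Hypothesis kap0 : 0 < kap.
Hypothesis n3 : kap * 4 ^+ K0 <= 1.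
Hypothesis n3' : 2 < expR (K0%:R / 128 : R) * ((sig / 2) ^+ kk / 2).

Let a_gt0 : 0 < a.
Proof.
have : 0 <= a by rewrite divr_ge0 ?ler0n.
rewrite le_eqVlt => /orP[/eqP E0|//]; move: Nbig; rewrite -E0 expr0n mul0r; lra.
Qed.

Let sig_gt0 : 0 < sig. Proof. exact: exprn_gt0. Qed.

Let lR : 0 < l%:R :> R. Proof. by rewrite ltr0n. Qed.

Let Dcard : (0 < #|D|)%N. Proof. exact: ball_card_gt0. Qed.
Let Ecard : (0 < #|E|)%N.
Proof. by apply: ball_card_gt0; rewrite addr_ge0 ?mulr_ge0 ?ler0n. Qed.

Let eps_gt0 : 0 < eps.
Proof. by apply: lt_le_trans n2; rewrite mulr_gt0 ?exprn_gt0 //; lra. Qed.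

Let F := ind (A :&: B).
Let pop := @popular R G A B.
Let h x := (pop (x *+ 2))%:R : R.

(** Popularity of most points 2 (w + u) makes the sum of [corr F] over them at least (97/100) (9/8)
    >= 17/16 times the expected one. That sum is a weighted average over x in [A :&: B], so some x
    attains the density. *)
Lemma density_transfer (C : {set G}) w : (0 < #|C|)%N ->
  97/100 * #|C|%:R <= \sum_(u in C) h (w + u) ->
  exists z, 17/16 * a * #|C|%:R <= \sum_(u in C) ind A (z + u *+ 2).
Proof.
move=> C0 H.
have aN0 : 0 <= a ^+ 2 * N by apply: le_trans Nbig; lra.
have H1 : 17/16 * (a ^+ 2 * N) * #|C|%:R <= \sum_(u in C) corr F ((w + u) *+ 2).
  apply: le_trans (_ : 9/8 * (a ^+ 2 * N) * (\sum_(u in C) h (w + u)) <= _).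
    apply: le_trans (_ : 9/8 * (a ^+ 2 * N) * (97/100 * #|C|%:R) <= _).
      move: (a ^+ 2 * N) aN0 => t t0.
      have : 0 <= t * #|C|%:R by rewrite mulr_ge0 ?ler0n.
      by lra.
    by rewrite ler_wpM2l // mulr_ge0 //; lra.
  rewrite mulr_sumr; apply: ler_sum => u _; rewrite /h.
  case P: (pop _); first by rewrite mulr1 ltW.
  by rewrite mulr0; apply: sumr_ge0 => x _; rewrite mulr_ge0 ?ind_ge0.
have N0 : 0 < N.
  by rewrite lt_neqAle ler0n andbT; apply/eqP => E0; move: Nbig; rewrite -E0 mulr0; lra.
have sF : \sum_x F x = a * N by rewrite sum_ind /a divfK // gt_eqF.
have [|||x _ Hx] := @sum_exists_ge R G F (fun x => \sum_(u in C) F (x + (w + u) *+ 2)) (17/16 * a * #|C|%:R).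
- by move=> x; exact: ind_ge0.
- by rewrite sF mulr_gt0.
- rewrite sF; move: H1; rewrite /corr exchange_big /=.
  under eq_bigr => x _ do rewrite -mulr_sumr.
  by apply: le_trans; rewrite le_eqVlt; apply/orP; left; apply/eqP; rewrite expr2; ring.
exists (x + w *+ 2); apply: le_trans Hx _; apply: ler_sum => u _.
by rewrite mulrnDl addrA /F /ind inE ler_nat; case: (_ \in A); case: (_ \in B).
Qed.

(** On the pairs of A1 the function h has mean at least 99/100. The l-fold average over T - T costs
    1/100 by sampling, and a translation by u in C another 1/100 by Chang's lemma and Parseval.
    Since averages stay below the maximum, some translate of C keeps the proportion 97/100. *)
Lemma increment_core : exists Lam : seq G, (size Lam <= K0)%N /\
  forall C : {set G}, (0 < #|C|)%N ->
   (forall u, u \in C -> shift_err D2 u <= kap * (eps / 4) * #|D2|%:R /\ psi Lam u <= eps / 2) ->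
   exists z, 17/16 * a * #|C|%:R <= \sum_(u in C) ind A (z + u *+ 2).
Proof.
have Binv' m1 m2 : m1 \in D -> m2 \in D -> shift_err B (m2 *+ 2 - m1 *+ 2) <= a / 32 * N.
  rewrite !inE => h1 h2; apply: Binv; rewrite !mulr2n opprD.
  have t := psiD cD sD cs1 L.
  have := t (m2 + m2) (- m1 - m1); have := t m2 m2; have := t (- m1) (- m1).
  by rewrite (psiN cN sN); lra.
have [A1 [A1D A1c A10 bad]] := sifting Bsym (ball_sym L rD) Binv' AP3 Nbig k8 ak AD Dcard.
set n : R := #|A1|%:R in A1c bad.
have {}A1c : sig * #|D|%:R <= n by exact: A1c.
have n0 : 0 < n by rewrite ltr0n.
have h01 x : 0 <= h x <= 1 by rewrite /h; case: (pop _); rewrite /= ?lexx ?ler01.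
have e01 : 0 < (1 / (400 * l%:R) : R) <= 1.
  rewrite divr_gt0 ?mulr_gt0 //= ler_pdivrMr ?mulr_gt0 // mul1r.
  have : 1 <= l%:R :> R by rewrite ler1n.
  lra.
pose ep : R := 1 / (400 * l%:R).
have AE a0 t : a0 \in A1 -> t \in D2 -> a0 + t \in E.
  move=> /(subsetP A1D); rewrite !inE => ha ht.
  apply: le_trans (psiD cD sD cs1 L _ _) _; apply: lerD => //; apply: le_trans ht _.
  by rewrite ler_peMl // ler1n muln_gt0 l0.
have [T [TD2 Tc Tinv]] := @sampling R G A1 D2 E E h kk ep h01 A10 kk0 e01 AE Ecard.
set H := smooth A1 h in Tinv.
have H01 x : 0 <= H x <= 1 by exact: smooth01.
have sE : sig / 2 <= n / #|E|%:R.
  rewrite ler_pdivlMr ?ltr0n //; apply: le_trans A1c.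
  by move: (ler_wpM2l (ltW sig_gt0) Ereg); move: sig => sg; lra.
have D2c : 0 < #|D2|%:R :> R by rewrite ltr0n ball_card_gt0.
have Tc2 : (sig / 2) ^+ kk / 2 * #|D2|%:R <= #|T|%:R.
  apply: le_trans Tc; rewrite ler_wpM2r ?(ltW D2c) // ler_wpM2r //; first by lra.
  by apply: lerXn2r; rewrite ?nnegrE ?divr_ge0 ?(ltW sig_gt0) ?ler0n.
have T0 : (0 < #|T|)%N.
  rewrite -(@ltr0n R); apply: lt_le_trans Tc2; by rewrite mulr_gt0 // divr_gt0 // exprn_gt0 // divr_gt0.
have big : 2 * #|D2|%:R < expR (K0%:R / 128 : R) * #|T|%:R.
  apply: lt_le_trans (_ : expR (K0%:R / 128 : R) * ((sig / 2) ^+ kk / 2 * #|D2|%:R) <= _).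
    by rewrite [ltRHS]mulrA ltr_pM2r.
  by rewrite ler_wpM2l ?expR_ge0.
have [Lam [sLam HLam]] := chang c0 cD sD cN sN cs1 (ball_sym L r2) TD2 T0 (eps / 4) kap0 n3 big.
exists Lam; split=> // C C0 HC.
(* The cutoff to E makes the Cauchy-Schwarz bound depend on |E| <= 2 |D|. *)
pose H' x := ind E x * H x.
have H'E x : x \in E -> H' x = H x by move=> xE; rewrite /H' /ind xE mul1r.
have H'01 x : 0 <= H' x <= ind E x.
  have /andP[? ?] := H01 x; rewrite /H' mulr_ge0 ?ind_ge0 //=.
  by rewrite ler_piMr ?ind_ge0.
(* The loss allowed in each of the l averages: 2 ep = 1/(200 l) for the sampling accuracy and 1/(200
   l) for the exceptional points. *)
pose err : R := 1 / (100 * l%:R).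
have one v t t' : psi L v <= ((l - 1) * 2)%:R * r2 -> t \in T -> t' \in T ->
   \sum_(m in A1) H' (m + v) - err * n <= \sum_(m in A1) H' (m + (v + t - t')).
  move=> pv tT t'T.
  have ht := subsetP TD2 _ tT; have ht' := subsetP TD2 _ t'T; rewrite !inE in ht ht'.
  have inE1 m : m \in A1 -> m + v \in E.
    move=> /(subsetP A1D); rewrite !inE => hm; apply: le_trans (psiD cD sD cs1 L _ _) _.
    apply: lerD => //; apply: le_trans pv _; rewrite ler_wpM2r // ler_nat leq_mul2r leq_subr orbT //.
  have inE2 m : m \in A1 -> m + v + t - t' \in E.
    move=> /(subsetP A1D); rewrite !inE => hm.
    have q := psiD cD sD cs1 L; have := q (m + v + t) (- t'); have := q (m + v) t; have := q m v.
    rewrite (psiN cN sN).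
    have e2 : (l * 2)%:R = ((l - 1) * 2)%:R + 2 :> R.
      by rewrite -natrD; congr (_%:R); move: l0; clear; lia.
    rewrite e2; lra.
  have bdc := Tinv t t' tT t'T; rewrite -/ep in bdc.
  set X := [set x | _] in bdc.
  have pt m : m \in A1 -> H' (m + v) - (2 * ep + ind X (m + v)) <= H' (m + (v + t - t')).
    move=> mA; rewrite !addrA H'E ?inE1 // H'E ?inE2 //.
    have /andP[a1 a2] := H01 (m + v); have /andP[a3 a4] := H01 (m + v + t - t').
    have ep0 : 0 < ep by case/andP: e01.
    rewrite /ind inE inE1 // inE2 //=.
    case: (ltP (2 * ep) `|H (m + v + t - t') - H (m + v)|) => b /=; first by lra.
    by move: b; rewrite ler_norml => /andP[? ?]; lra.
  apply: le_trans (ler_sum _ pt); rewrite sumrB lerB // big_split /= sumr_const -[_ *+ #|A1|]mulr_natr -/n.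
  have iX : \sum_(m in A1) ind X (m + v) <= #|X|%:R.
    rewrite -(sum_ind R X) -(sum_shift (ind X) v) -sum_indM; apply: ler_sum => x _.
    by rewrite ler_piMl ?ind_ge0 ?ind_le1.
  set e0 := expR _ in bdc.
  have q1 : 8 * e0 * #|E|%:R <= 1 / (200 * l%:R) * n.
    apply: le_trans (_ : 8 * e0 * (2 * #|D|%:R) <= _).
      by rewrite ler_wpM2l // mulr_ge0 // expR_ge0.
    apply: le_trans (_ : sig / (200 * l%:R) * #|D|%:R <= _).
      have := n1; rewrite -/ep -/e0 => q; have := ler_wpM2r (ler0n R #|D|) q; lra.
    have -> : sig / (200 * l%:R) * #|D|%:R = 1 / (200 * l%:R) * (sig * #|D|%:R) by field; rewrite gt_eqF.
    by rewrite ler_wpM2l // divr_ge0 ?mulr_ge0 // ltW.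
  have -> : err * n = 2 * ep * n + 1 / (200 * l%:R) * n by rewrite /err /ep; field; rewrite gt_eqF.
  by rewrite lerD2l; apply: le_trans iX (le_trans bdc q1).
(* The radius allowed for v shrinks by 2 r2 with each average, so that v + t - t' is admissible for
   the previous one. *)
have chain i : (i <= l)%N -> forall v, psi L v <= ((l - i) * 2)%:R * r2 ->
   \sum_(m in A1) H' (m + v) - i%:R * (err * n) <= \sum_(m in A1) iter i (avg T) H' (m + v).
  elim: i => [|i IH] il v pv; first by rewrite mul0r subr0.
  have T2 : 0 < #|T|%:R ^+ 2 :> R by rewrite exprn_gt0 // ltr0n.
  have -> : \sum_(m in A1) iter i.+1 (avg T) H' (m + v) =
     (\sum_(t in T) \sum_(t' in T) \sum_(m in A1) iter i (avg T) H' (m + (v + t - t'))) / #|T|%:R ^+ 2.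
    rewrite /= {1}/avg -mulr_suml; congr (_ / _).
    rewrite exchange_big /=; apply: eq_bigr => t _; rewrite exchange_big /=; apply: eq_bigr => t' _.
    by apply: eq_bigr => m _; rewrite !addrA.
  rewrite ler_pdivlMr //.
  have -> : (\sum_(m in A1) H' (m + v) - i.+1%:R * (err * n)) * #|T|%:R ^+ 2 =
     \sum_(t in T) \sum_(t' in T) (\sum_(m in A1) H' (m + v) - i.+1%:R * (err * n)).
    by rewrite !sumr_const -mulrnA expr2 -natrM mulr_natr.
  apply: ler_sum => t tT; apply: ler_sum => t' t'T.
  have ht := subsetP TD2 _ tT; have ht' := subsetP TD2 _ t'T; rewrite !inE in ht ht'.
  have e2 : ((l - i) * 2)%:R = ((l - i.+1) * 2)%:R + 2 :> R.
    by rewrite -natrD; congr (_%:R); move: il; clear; lia.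
  have pv' : psi L (v + t - t') <= ((l - i) * 2)%:R * r2.
    have q := psiD cD sD cs1 L; have := q (v + t) (- t'); have := q v t.
    rewrite (psiN cN sN) e2; lra.
  have := IH (ltnW il) _ pv'.
  have pv1 : psi L v <= ((l - 1) * 2)%:R * r2.
    apply: le_trans pv _; rewrite ler_wpM2r // ler_nat leq_mul2r /= leq_sub2l //.
  have := one v t t' pv1 tT t'T.
  rewrite -natr1; lra.
have P0 : 98/100 * n <= \sum_(m in A1) iter l (avg T) H' m.
  have := chain l (leqnn l) 0; rewrite (psi0 c0 sN) mulr_ge0 ?ler0n // => /(_ isT).
  under eq_bigr => m _ do rewrite addr0.
  under [in X in _ <= X -> _]eq_bigr => m _ do rewrite addr0.
  have -> : l%:R * (err * n) = 1/100 * n by rewrite /err; field; rewrite gt_eqF.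
  have : 99/100 * n <= \sum_(m in A1) H' m.
    have -> : \sum_(m in A1) H' m = (\sum_(m2 in A1) \sum_(m1 in A1) h (m2 - m1)) / n.
      rewrite mulr_suml; apply: eq_bigr => m mA; rewrite H'E //.
      have := AE m 0 mA; rewrite addr0; apply; exact: ball0.
    rewrite ler_pdivlMr //.
    have : \sum_(m2 in A1) \sum_(m1 in A1) h (m2 - m1) =
       n ^+ 2 - \sum_(m1 in A1) \sum_(m2 in A1) (~~ pop (m2 *+ 2 - m1 *+ 2))%:R.
      have -> : n ^+ 2 = \sum_(m1 in A1) \sum_(m2 in A1) 1.
        by rewrite !sumr_const -mulrnA expr2 -natrM.
      rewrite exchange_big -sumrB /=; apply: eq_bigr => m1 _; rewrite -sumrB; apply: eq_bigr => m2 _.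
      by rewrite /h mulrnBl; case: (pop _); rewrite /= ?subr0 ?subrr.
    move=> ->; move: bad; rewrite -/pop expr2; lra.
  lra.
have Pu u : u \in C -> 97/100 * n <= \sum_(m in A1) iter l (avg T) H' (m + u).
  move=> /HC[u1 u2].
  have sp xi : 1/4 < theta c s T xi -> chord c s (xi * u) <= eps.
    by move=> tx; have := HLam u u1 xi tx; lra.
  have := avg_almost_invariant c0 cD sD cN sN cs1 orth A10 T0 (ltW eps_gt0) n2 sp H'01.
  set P1 := \sum_(m in A1) _; set P2 := \sum_(m in A1) _ => Hq.
  have : `|P1 - P2| <= 1/100 * n.
    rewrite -(@ler_pXn2r _ 2) ?nnegrE ?normr_ge0 ?mulr_ge0 ?(ltW n0) //; last by lra.
    rewrite -normrX ger0_norm ?sqr_ge0 //; apply: le_trans Hq _.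
    rewrite -/n exprMn [leRHS]mulrC expr2 -!mulrA mulrC -!mulrA.
    have q1 : eps ^+ 2 * #|E|%:R <= 1/10000 * n.
      apply: le_trans (_ : eps ^+ 2 * (2 * #|D|%:R) <= _); first by rewrite ler_wpM2l ?sqr_ge0.
      apply: le_trans (_ : 1/10000 * (sig * #|D|%:R) <= _).
        have := ler_wpM2r (ler0n R #|D|) n2'; lra.
      by rewrite ler_wpM2l //; lra.
    have := ler_wpM2l (ltW n0) q1; rewrite !expr2; lra.
  rewrite ler_norml => /andP[? ?]; move: P0; rewrite -/P2; lra.
pose h2 x := \sum_(u in C) H' (x + u).
pose x0 := [arg max_(x > 0) h2 x]%O.
have x0P x : h2 x <= h2 x0 by rewrite /x0; case: arg_maxP => // i _; exact.
have V : 97/100 * #|C|%:R <= h2 x0.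
  have q1 : \sum_(u in C) (97/100 * n) <= \sum_(u in C) \sum_(m in A1) iter l (avg T) H' (m + u) by apply: ler_sum => u /Pu.
  have q2 : \sum_(u in C) \sum_(m in A1) iter l (avg T) H' (m + u) <= n * h2 x0.
    rewrite exchange_big /= mulr_natl -sumr_const; apply: ler_sum => m _.
    by rewrite -iter_avg_sum; apply: iter_avg_le.
  have q3 := le_trans q1 q2.
  have e : 97/100 * n * #|C|%:R = \sum_(u in C) (97/100 * n) by rewrite sumr_const mulr_natr.
  rewrite -e in q3; rewrite -(ler_pM2l n0); apply: le_trans q3.
  by rewrite le_eqVlt; apply/orP; left; apply/eqP; ring.
have [|||m mA Hm] := @sum_exists_ge R G (ind A1) (fun m => \sum_(u in C) h (x0 - m + u)) (97/100 * #|C|%:R).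
- by move=> m; exact: ind_ge0.
- by rewrite sum_ind.
- rewrite sum_ind -/n sum_indM exchange_big /=.
  apply: le_trans (ler_wpM2r (ltW n0) V) _; rewrite /h2 mulr_suml; apply: ler_sum => u _.
  apply: le_trans (_ : H (x0 + u) * n <= _).
    rewrite ler_wpM2r ?(ltW n0) // /H' ler_piMl ?ind_le1 //; by case/andP: (H01 (x0 + u)).
  rewrite /H /smooth divfK ?gt_eqF // le_eqVlt; apply/orP; left; apply/eqP/eq_bigr => m _.
  by rewrite addrAC.
exact: density_transfer Hm.
Qed.

End Core.

(** * Choice of parameters *)

(** 201/200 is also reached in the other alternative of a step, where a density 101/100 al loses at
    most al/512 through regularity. *)
Lemma gain_bound (R : realFieldType) (a al : R) :
  0 < al -> 98/100 * al <= a -> 201/200 * al <= 17/16 * a.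
Proof. lra. Qed.

Section HalfPowers.
Variable R : realType.
(** Radii and accuracies are compared with powers of 1/2, so that losses are recorded by adding
    exponents. *)
Definition hp n : R := (1/2) ^+ n.
Lemma hp_gt0 n : 0 < hp n. Proof. by rewrite exprn_gt0 //; lra. Qed.
Lemma hp_ge0 n : 0 <= hp n. Proof. exact: ltW (hp_gt0 n). Qed.
Lemma hpD m n : hp (m + n) = hp m * hp n. Proof. exact: exprD. Qed.
Lemma hpS n : hp n.+1 = hp n / 2. Proof. by rewrite /hp exprSr; lra. Qed.
Lemma hpX m n : hp m ^+ n = hp (m * n). Proof. by rewrite /hp exprM. Qed.
Lemma hp_le m n : (m <= n)%N -> hp n <= hp m.
Proof. by move=> mn; apply: ler_wiXn2l => //; lra. Qed.
Lemma hpV n : (hp n)^-1 = 2 ^+ n.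
Proof. by rewrite /hp -exprVn div1r invrK. Qed.
Lemma hp2 n : hp n * 2 ^+ n = 1.
Proof. by rewrite -hpV divff // gt_eqF // hp_gt0. Qed.
Lemma hp_nat n : n%:R * hp n <= 1.
Proof.
rewrite -[leRHS](hp2 n) mulrC ler_wpM2l ?hp_ge0 // -natrX ler_nat; apply: ltnW; exact: ltn_expl.
Qed.
Lemma expR_ge_pow2 n : 2 ^+ n <= expR (n%:R : R).
Proof.
have -> : expR (n%:R : R) = expR 1 ^+ n by rewrite expR_natM mulr1.
by apply: lerXn2r; rewrite ?nnegrE ?expR_ge0 //; have := expR_ge1Dx (1 : R); lra.
Qed.
Lemma expRN_le_hp n : expR (- (n%:R : R)) <= hp n.
Proof.
have e := expR_ge_pow2 n.
by rewrite expRN -[hp n]invrK hpV lef_pV2 // posrE ?exprn_gt0 ?expR_gt0.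
Qed.
End HalfPowers.

(* For density at least 2^-q in a group of order at most 2^2^q: the moment is par_p, the sifted set has
   relative density at least 2^-par_g, 2^-par_e is the Fourier accuracy, par_l the number of iterated
   averages, par_kk the sample size, par_K0 bounds the number of new frequencies, 2^-par_d is the
   regularity required by Chang's lemma, and the radius shrinks by 2^-par_W in each step. *)
Definition par_k q := (3 * q + 6)%N.
Definition par_p q := (4 * (par_k q).*2.+1)%N.
Definition par_g q := (q.+1 * par_p q)%N.
Definition par_e q := (par_g q + 15)%N.
Definition par_l q := (par_e q).+1.
Definition par_kk q := (8 * (400 * par_l q) ^ 2 * (par_g q + par_l q + 12))%N.
Definition par_K0 q := (128 * ((par_g q).+1 * par_kk q + 3))%N.
Definition par_d q := (2 * par_K0 q + par_e q + 3)%N.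
Definition par_W q := (7 * q + 41 + par_l q + par_d q + par_e q + 1)%N.

Lemma par_W_sum n q l d e :
  (n + (q + 10 + q + 2) + (q + 10 + q + 2) + 2 + (q + 10 + q + 2) + l + 1 + (d + q + 2) + e + 1 =
   n + (7 * q + 41 + l + d + e + 1))%N.
Proof. lia. Qed.

Lemma par_k_double q : (par_k q).*2 = (6 * (q + 2))%N.
Proof. rewrite /par_k; lia. Qed.

Lemma par_k_ge8 q : (1 <= q)%N -> (8 <= par_k q)%N.
Proof. rewrite /par_k; lia. Qed.

Lemma par_kk_gt0 q : (0 < par_kk q)%N.
Proof. by rewrite /par_kk !muln_gt0 ?expn_gt0 /= ?addn_gt0 ?orbT. Qed.

Lemma par_kkE (R : realType) q :
  (par_kk q)%:R = 8 * (400 * (par_l q)%:R) ^+ 2 * (par_g q + par_l q + 12)%:R :> R.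
Proof.
rewrite /par_kk; move: (par_g q + par_l q + 12)%N (par_l q) => x y.
by rewrite natrM natrM (natrX _ (400 * y) 2) natrM.
Qed.

Lemma par_K0E (R : realType) q : (par_K0 q)%:R / 128 = ((par_g q).+1 * par_kk q + 3)%:R :> R.
Proof. by rewrite /par_K0; move: (_ + 3)%N => x; rewrite natrM; field. Qed.

Lemma ball_radius_index n q : ((n + (q + 10 + q + 2)).+1 <= n + 2 * q + 13)%N.
Proof. lia. Qed.

Lemma double_exponent q : (2 * q + 6 = q.+1 * 2 + 4)%N.
Proof. lia. Qed.

Section Numeric.
Variables (R : realType) (q : nat) (a : R).
Hypothesis a0 : 0 < a.
Local Notation hp := (hp R).
Hypothesis aq : hp q.+1 <= a.
Let sig := a ^+ par_p q.
Let l := par_l q.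

Let lR : 0 < l%:R :> R. Proof. by rewrite ltr0n. Qed.
Let lhp : l%:R * hp l <= 1. Proof. exact: hp_nat. Qed.

Let sg : hp (par_g q) <= sig.
Proof. by rewrite /par_g -hpX; apply: lerXn2r; rewrite ?nnegrE ?hp_ge0 ?(ltW a0). Qed.

Let num_k : 1 <= a / 2 * (7/6) ^+ (par_k q).*2.
Proof.
rewrite par_k_double exprM.
(* (7/6)^6 >= 2 compensates one halving, and a/2 >= 2^-(q+2); hence the even exponent 6 (q + 2). *)
have b6 : 2 ^+ (q + 2) <= ((7/6 : R) ^+ 6) ^+ (q + 2).
  apply: lerXn2r; rewrite ?nnegrE ?exprn_ge0 //; [lra|].
  by rewrite !exprS expr0; lra.
have aa : hp (q + 2) <= a / 2 by rewrite (_ : q + 2 = q.+2)%N ?addn2 // hpS; move: aq; lra.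
rewrite -[leLHS](hp2 R (q + 2)); apply: ler_pM => //; [exact: hp_ge0|exact: exprn_ge0].
Qed.

Let num_sample : 16 * expR (- ((1 / (400 * l%:R)) ^+ 2 / 8 * (par_kk q)%:R)) <= sig / (200 * l%:R).
Proof.
have -> : (1 / (400 * l%:R)) ^+ 2 / 8 * (par_kk q)%:R = (par_g q + l + 12)%:R :> R.
  by rewrite par_kkE -/l; field; rewrite gt_eqF.
have := expRN_le_hp R (par_g q + l + 12); rewrite !hpD.
have -> : hp 12 = 1/64 * (1/64).
  by rewrite (_ : 12 = 6 + 6)%N // hpD; congr (_ * _); rewrite /hp !exprS expr0; field.
rewrite ler_pdivlMr ?mulr_gt0 //.
move: lhp sg (hp_ge0 R (par_g q)) lR; move: (hp (par_g q)) (hp l) (l%:R : R) => g' h' l' lh sg' g0 l0.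
set e := expR _ => e1.
have e2 := ler_wpM2r (ltW l0) e1.
have e3 := ler_wpM2l g0 lh.
move: e2 e3 sg' g0; lra.
Qed.

Let num_eps : 2 * (1/4) ^+ l <= hp (par_e q).
Proof.
have -> : (1/4 : R) ^+ l = hp (2 * l) by rewrite /hp exprM; congr (_ ^+ _); rewrite !exprS expr0; field.
have := hp_le R (_ : (par_e q).+1 <= 2 * l)%N; rewrite hpS leq_pmull // => /(_ isT).
by move: (hp (2 * l)) (hp (par_e q)) => x y; lra.
Qed.

Let num_eps2 : hp (par_e q) ^+ 2 * 2 * 10000 <= sig.
Proof.
have h5 : hp 5 = 1/32 by rewrite /hp !exprS expr0; field.
have e1 : hp (par_e q) <= 1 by have := hp_le R (leq0n (par_e q)); rewrite [hp 0]expr0.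
have e2 : hp (par_e q) = hp (par_g q) * (1/32 * (1/32) * (1/32)).
  by rewrite /par_e hpD (_ : 15 = 5 + 5 + 5)%N // !hpD h5.
have e4 : hp (par_e q) ^+ 2 <= hp (par_e q) by rewrite expr2 ler_piMr ?hp_ge0.
move: e2 e4 sg (hp_ge0 R (par_g q)); move: (hp (par_e q) ^+ 2) (hp (par_e q)) (hp (par_g q)) => x y z.
by lra.
Qed.

Let num_kap : hp (2 * par_K0 q) * 4 ^+ par_K0 q <= 1.
Proof.
have -> : (4 : R) ^+ par_K0 q = 2 ^+ (2 * par_K0 q).
  by rewrite exprM; congr (_ ^+ _); rewrite !exprS expr0; ring.
by rewrite hp2.
Qed.

Let num_chang : 2 < expR ((par_K0 q)%:R / 128 : R) * ((sig / 2) ^+ par_kk q / 2).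
Proof.
rewrite par_K0E; move: (par_kk q) (par_g q) sg => kk g sg'.
have e1 := expR_ge_pow2 R (g.+1 * kk + 3).
have e2 : hp (g.+1 * kk) <= (sig / 2) ^+ kk.
  rewrite -hpX hpS; apply: lerXn2r; rewrite ?nnegrE ?divr_ge0 ?hp_ge0 ?exprn_ge0 ?(ltW a0) //.
  by rewrite ler_wpM2r //; lra.
have e3 : 2 ^+ (g.+1 * kk + 3) * hp (g.+1 * kk) = 8.
  by rewrite exprD mulrAC [2 ^+ _ * _]mulrC hp2 mul1r !exprS expr0; ring.
have : 2 ^+ (g.+1 * kk + 3) * hp (g.+1 * kk) <= expR ((g.+1 * kk + 3)%:R : R) * (sig / 2) ^+ kk.
  by apply: ler_pM => //; [exact: exprn_ge0|exact: hp_ge0].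
rewrite e3 mulrA; move: (expR _ * _) => t; lra.
Qed.

Lemma par_numeric : [/\ 1 <= a / 2 * (7/6) ^+ (par_k q).*2,
  16 * expR (- ((1 / (400 * (par_l q)%:R)) ^+ 2 / 8 * (par_kk q)%:R)) <= a ^+ par_p q / (200 * (par_l q)%:R),
  2 * (1/4) ^+ par_l q <= hp (par_e q) &
  [/\ hp (par_e q) ^+ 2 * 2 * 10000 <= a ^+ par_p q,
    hp (2 * par_K0 q) * 4 ^+ par_K0 q <= 1 &
    2 < expR ((par_K0 q)%:R / 128 : R) * ((a ^+ par_p q / 2) ^+ par_kk q / 2)]].
Proof. by do ![split]; [exact: num_k|exact: num_sample|exact: num_eps|exact: num_eps2|exact: num_kap|exact: num_chang]. Qed.

End Numeric.

(** * Regular Bohr balls and a single density increment *)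

Section Step.
Variables (R : realType) (G : finComNzRingType) (c s : G -> R).
Hypothesis c0 : c 0 = 1.
Hypothesis cD : forall x y, c (x + y) = c x * c y - s x * s y.
Hypothesis sD : forall x y, s (x + y) = s x * c y + c x * s y.
Hypothesis cN : forall x, c (- x) = c x.
Hypothesis sN : forall x, s (- x) = - s x.
Hypothesis cs1 : forall x, c x ^+ 2 + s x ^+ 2 = 1.
Hypothesis orth : forall x, x != 0 -> \sum_xi c (xi * x) = 0.
Variable half : G.
Hypothesis halfP : half *+ 2 = 1.
Local Notation psi := (psi c s).
Local Notation ind := (ind R).
Local Notation shift_err := (shift_err R).
Local Notation ball := (ball c s).
Local Notation hp := (hp R).

Lemma pigeonhole_size (M : nat) (a : nat -> nat) (d : R) K :
  0 <= d -> (0 < a 0)%N -> (forall i, (a i <= M)%N) -> M%:R < (1 + d) ^+ K ->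
  exists2 i, (i < K)%N & (a i.+1)%:R <= (1 + d) * (a i)%:R.
Proof.
move=> d0 a0 aM MK.
have [/existsP[i Hi]|] := boolP [exists i : 'I_K, (a i.+1)%:R <= (1 + d) * (a i)%:R :> R]; first by exists i.
rewrite negb_exists => /forallP N; exfalso.
have grow i : (i <= K)%N -> (1 + d) ^+ i <= (a i)%:R.
  elim: i => [|i IH] iK; first by rewrite expr0 ler1n.
  have := N (Ordinal iK); rewrite -ltNge /= => H.
  apply: le_trans (ltW H); rewrite exprS ler_wpM2l ?addr_ge0 //; exact: IH (ltnW iK).
have := grow K (leqnn K); apply/negP; rewrite -ltNge; apply: le_lt_trans MK; by rewrite ler_nat.
Qed.

(** Along K equal steps from rho/2 to rho the ball cannot grow by the factor 1 + d each time,
    because |G| < (1 + d)^K. A translation by less than the spacing moves points only into the thin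
    shell so found; u and -u together account for the factor 2. *)
Lemma regular L (rho d : R) K : 0 < rho -> 0 <= d -> (0 < K)%N -> #|G|%:R < (1 + d) ^+ K ->
  exists r, [/\ rho / 2 <= r <= rho,
    #|ball L (r + rho / (2 * K%:R))|%:R <= (1 + d) * #|ball L r|%:R :> R &
    forall x, psi L x <= rho / (2 * K%:R) -> shift_err (ball L r) x <= 2 * d * #|ball L r|%:R].
Proof.
move=> r0 d0 K0 MK; pose nu := rho / (2 * K%:R).
have KR : 0 < K%:R :> R by rewrite ltr0n.
have nu0 : 0 < nu by rewrite divr_gt0 // mulr_gt0.
pose a i := #|ball L (rho / 2 + i%:R * nu)|.
have [||i iK Hi] := @pigeonhole_size #|G| a d K d0 _ _ MK.
- by apply: ball_card_gt0 => //; rewrite mul0r addr0; lra.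
- by move=> i; exact: max_card.
set r := rho / 2 + i%:R * nu.
have rE : rho / 2 + i.+1%:R * nu = r + nu by rewrite /r -natr1; ring.
rewrite /a rE -/r in Hi.
exists r; split => //.
  rewrite /r lerDl mulr_ge0 ?ler0n ?(ltW nu0) //=.
  have : i%:R * nu <= K%:R * nu by rewrite ler_wpM2r ?(ltW nu0) // ler_nat ltnW.
  have -> : K%:R * nu = rho / 2 by rewrite /nu; field; rewrite gt_eqF.
  lra.
move=> x px; set B := ball L r; set B' := ball L (r + nu).
have BB' : B \subset B' by apply: ball_sub; rewrite lerDl ltW.
have sub y z : psi L z <= nu -> y \in B -> y + z \in B'.
  by rewrite !inE => h1 h2; apply: le_trans (psiD cD sD cs1 L _ _) _; apply: lerD.
have cnt z : psi L z <= nu -> \sum_y ind B (y + z) * (1 - ind B y) <= d * #|B|%:R.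
  move=> pz; apply: le_trans (_ : #|B'|%:R - #|B|%:R <= _); last by move: Hi; rewrite -/B -/B'; lra.
  rewrite -!(sum_ind R) -sumrB; apply: ler_sum => y _; rewrite /ind.
  case yB: (y \in B); first by rewrite (subsetP BB' _ yB) /= mulr1n subrr mulr0.
  rewrite /= mulr0n subr0 mulr1 subr0 ler_nat.
  case yzB: (y + z \in B) => //.
  have := @sub (y + z) (- z); rewrite (psiN cN sN) addrK => /(_ pz yzB) -> //.
have -> : shift_err B x = \sum_y ind B (y + x) * (1 - ind B y) + \sum_y ind B (y - x) * (1 - ind B y).
  rewrite -[in X in _ + X](sum_shift _ x) -big_split /=; apply: eq_bigr => y _.
  rewrite addrK /ind; case: (_ \in _); case: (_ \in _); rewrite /= ?subrr ?subr0 ?sub0r ?normrN ?normr1 ?normr0; lra.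
have h1 := cnt x px; have := cnt (- x); rewrite (psiN cN sN) => /(_ px) h2; lra.
Qed.

Lemma sum_translate (A B : {set G}) (e : R) x d : shift_err B d <= e ->
  \sum_(y in B) ind A (x + y) - e <= \sum_(y in B) ind A (x + y + d).
Proof.
move=> He.
have h01 y : 0 <= ind A (x + y) <= 1 by rewrite ind_ge0 ind_le1.
have := shift_sum_bound B (- d) h01; rewrite shift_errN => H.
have E1 : \sum_y ind A (x + y) * ind B (y - d) = \sum_(y in B) ind A (x + y + d).
  by rewrite -sum_indM -(sum_shift _ d); apply: eq_bigr => y _; rewrite addrK addrA mulrC.
have E2 : \sum_y ind A (x + y) * ind B y = \sum_(y in B) ind A (x + y).
  by rewrite -sum_indM; apply: eq_bigr => y _; rewrite mulrC.
by move: H; rewrite E1 E2 ler_norml => /andP[? ?]; lra.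
Qed.

Lemma sum_translate_avg (A B C : {set G}) (al e nu : R) (L : seq G) x :
  (forall d, psi L d <= nu -> shift_err B d <= e * #|B|%:R) ->
  (forall u, u \in C -> psi L u <= nu) ->
  al * #|B|%:R <= \sum_(y in B) ind A (x + y) ->
  (al - e) * #|B|%:R * #|C|%:R <= \sum_(y in B) \sum_(u in C) ind A (x + y + u).
Proof.
move=> inv sub H; rewrite exchange_big /= mulr_natr -sumr_const; apply: ler_sum => u uC.
by apply: le_trans (sum_translate A x (inv u (sub u uC))); rewrite mulrBl lerB.
Qed.

Variable A : {set G}.
Hypothesis AP3 : forall x y z, x \in A -> y \in A -> z \in A -> x + z = y *+ 2 -> x = y.

(** All radii up to 2^-n are allowed, each with its own translate, so that the next step may choose
    a regular radius. *)
Definition dense (L : seq G) (n : nat) (al : R) :=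
  forall r, 0 < r -> r <= hp n -> exists x, al * #|ball L r|%:R <= \sum_(y in ball L r) ind A (x + y).

(** Averaging over translates by a smaller ball: almost invariance under its elements costs only
    e. *)
Lemma dense_of_regular (B : {set G}) L nu n al e x : (0 < #|B|)%N -> hp n <= nu ->
  (forall d, psi L d <= nu -> shift_err B d <= e * #|B|%:R) ->
  al * #|B|%:R <= \sum_(y in B) ind A (x + y) -> dense L n (al - e).
Proof.
move=> B0 hn inv H r r0 rn.
have sub u : u \in ball L r -> psi L u <= nu by rewrite inE => h; lra.
have q := sum_translate_avg inv sub H.
have [|||y _ Hy] := @sum_exists_ge R G (ind B) (fun y => \sum_(u in ball L r) ind A (x + y + u)) ((al - e) * #|ball L r|%:R).
- by move=> y; exact: ind_ge0.
- by rewrite sum_ind ltr0n.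
- by rewrite sum_ind sum_indM; apply: le_trans q; rewrite mulrAC.
by exists (x + y).
Qed.

Section Params.
Variable q : nat.
Hypothesis q1 : (1 <= q)%N.
Hypothesis Gq : (#|G| <= 2 ^ 2 ^ q)%N.

Lemma card_lt_pow d : #|G|%:R < (1 + hp d) ^+ (2 ^ (d + q.+1)).
Proof.
rewrite expnD exprM.
have b : 2 <= (1 + hp d) ^+ (2 ^ d).
  have := expr_bernoulli (2 ^ d) (hp_ge0 R d); rewrite natrX mulrC hp2; lra.
apply: lt_le_trans (_ : 2 ^+ (2 ^ q.+1) <= _); last first.
  by apply: lerXn2r => //; rewrite nnegrE; lra.
rewrite -natrX ltr_nat; apply: leq_ltn_trans Gq _.
by rewrite ltn_exp2l // ltn_exp2l.
Qed.

Let d0 := (q + 10)%N.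

Let nuE (rho : R) d : rho / (2 * (2 ^ (d + q.+1))%:R) = rho * hp (d + q + 2).
Proof.
have -> : (d + q + 2 = (d + q.+1).+1)%N by lia.
by rewrite natrX -hpV hpS; field; rewrite gt_eqF ?hp_gt0.
Qed.

Lemma regular_hp L n d : exists r, [/\ hp n.+1 <= r <= hp n,
    #|ball L (r + hp (n + (d + q + 2)))|%:R <= (1 + hp d) * #|ball L r|%:R :> R &
    forall x, psi L x <= hp (n + (d + q + 2)) -> shift_err (ball L r) x <= 2 * hp d * #|ball L r|%:R].
Proof.
have K0 : (0 < 2 ^ (d + q.+1))%N by rewrite expn_gt0.
have := regular L (hp_gt0 R n) (hp_ge0 R d) K0 (card_lt_pow d).
by rewrite nuE -hpD hpS.
Qed.


Lemma half_double x : (half * x) *+ 2 = x.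
Proof. by rewrite -mulrnAl halfP mul1r. Qed.

(** Halved frequencies turn the dilate of a ball by 2, on which the increment is found, into a
    ball. *)
Lemma psi_half L x : psi [seq half * l | l <- L] (x *+ 2) = psi L x.
Proof.
rewrite /psi big_map; apply: eq_bigr => l _; congr chord.
by rewrite mulrnAr -mulrnAl half_double.
Qed.

Lemma sum_ball_half L r (f : G -> R) :
  \sum_(w in ball [seq half * l | l <- L] r) f w = \sum_(u in ball L r) f (u *+ 2).
Proof.
have inj : injective (fun u : G => u *+ 2).
  by move=> u v /(congr1 (fun w => half * w)); rewrite !mulrnAr -!mulrnAl !halfP !mul1r.
rewrite (reindex_inj inj) /=; apply: eq_bigl => u.
by rewrite !inE psi_half.
Qed.

Lemma card_ball_half L r : #|ball [seq half * l | l <- L] r|%:R = #|ball L r|%:R :> R.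
Proof.
have := sum_ball_half L r (fun _ => 1).
by rewrite !sumr_const.
Qed.

(** Four nested regular balls B0, B, D, D2. If a translate of B or D already has density above
    101/100 al, the list is kept. Otherwise this ceiling forces, on a common translate, both the
    density of A in B and the proportion of pairs of D with difference in A to be at least 98/100
    al, as [increment_core] requires. *)
Lemma step L n al : hp q <= al -> dense L n al ->
  (2 ^ (2 * q + 6) <= #|ball L (hp (n + 2 * q + 13))|)%N ->
  exists L' : seq G, (size L' <= size L + par_K0 q)%N /\ dense L' (n + par_W q) (201/200 * al).
Proof.
move=> alq den vol.
have al0 : 0 < al by apply: lt_le_trans alq; exact: hp_gt0.
have d0al : 2 * hp d0 <= al / 512.
  rewrite /d0 hpD; have -> : hp 10 = 1/1024 by rewrite /hp !exprS expr0; field.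
  by have := hp_ge0 R q; lra.
have [r0 [/andP[r0a r0b] _ inv0]] := regular_hp L n d0.
have r0p : 0 < r0 by apply: lt_le_trans r0a; exact: hp_gt0.
set nB := (n + (d0 + q + 2))%N in inv0.
have [rB [/andP[rBa rBb] _ invB]] := regular_hp L nB d0.
have rBp : 0 < rB by apply: lt_le_trans rBa; exact: hp_gt0.
set nB' := (nB + (d0 + q + 2))%N in invB.
(* The + 2 in the exponent yields 4 rD <= 2^-nB', the range in which B is almost invariant. *)
have [rD [/andP[rDa rDb] regD invD]] := regular_hp L (nB' + 2) d0.
have rDp : 0 < rD by apply: lt_le_trans rDa; exact: hp_gt0.
set nD' := (nB' + 2 + (d0 + q + 2))%N in regD invD.
set l := par_l q.
(* The + l + 1 yields 2 l r2 <= 2^-nD', as l 2^-l <= 1; thus the enlarged ball of the core lies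
   within the regular shell of D. *)
have [r2 [/andP[r2a r2b] _ inv2]] := regular_hp L (nD' + l + 1) (par_d q).
have r2p : 0 < r2 by apply: lt_le_trans r2a; exact: hp_gt0.
set n2 := (nD' + l + 1 + (par_d q + q + 2))%N in inv2.
have n2W : (n2 + par_e q + 1 = n + par_W q)%N.
  exact: par_W_sum.
have nBW : (nB' <= n + par_W q)%N by rewrite -n2W /n2 /nD' -!(addnA nB') leq_addr.
have nDW : (nD' <= n + par_W q)%N by rewrite -n2W /n2 -!(addnA nD') leq_addr.
set B0 := ball L r0 in inv0; set B := ball L rB in invB; set D := ball L rD in regD invD; set D2 := ball L r2 in inv2.
have [x Hx] := den r0 r0p r0b; rewrite -/B0 in Hx.
have cB0 : (0 < #|B0|)%N by apply: ball_card_gt0 => //; exact: ltW.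
have cB : (0 < #|B|)%N by apply: ball_card_gt0 => //; exact: ltW.
have cD' : (0 < #|D|)%N by apply: ball_card_gt0 => //; exact: ltW.
have cB0R : 0 < #|B0|%:R :> R by rewrite ltr0n.
have cBR : 0 < #|B|%:R :> R by rewrite ltr0n.
have cDR : 0 < #|D|%:R :> R by rewrite ltr0n.
have mono al1 al2 L1 n1 : al2 <= al1 -> dense L1 n1 al1 -> dense L1 n1 al2.
  move=> a12 dd r rp rn; have [z Hz] := dd r rp rn; exists z.
  by apply: le_trans Hz; rewrite ler_wpM2r ?ler0n.
have inc (E : {set G}) nE : (0 < #|E|)%N -> (nE <= n + par_W q)%N ->
   (forall d, psi L d <= hp nE -> shift_err E d <= 2 * hp d0 * #|E|%:R) ->
   [exists z, 101/100 * al * #|E|%:R < \sum_(y in E) ind A (z + y)] ->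
   exists L' : seq G, (size L' <= size L + par_K0 q)%N /\ dense L' (n + par_W q) (201/200 * al).
  move=> cE nEW invE /existsP[z /ltW Hz]; exists L; split; first exact: leq_addr.
  have := dense_of_regular cE (hp_le R nEW) invE Hz; apply: mono; lra.
have [/(inc _ _ cB nBW invB) //|] := boolP [exists z, 101/100 * al * #|B|%:R < \sum_(y in B) ind A (z + y)].
rewrite negb_exists => /forallP maxB.
have [/(inc _ _ cD' nDW invD) //|] := boolP [exists z, 101/100 * al * #|D|%:R < \sum_(y in D) ind A (z + y)].
rewrite negb_exists => /forallP maxD.
have subB u : u \in B -> psi L u <= hp nB by rewrite inE => h; apply: le_trans h rBb.
have av1 := sum_translate_avg inv0 subB Hx.
have av2 : (al - 2 * hp d0) * #|B0|%:R * #|D|%:R ^+ 2 <=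
    \sum_(y in B0) \sum_(m1 in D) \sum_(m2 in D) ind A (x + y + (m2 - m1)).
  rewrite exchange_big /= expr2 mulrA [leLHS]mulr_natr -sumr_const; apply: ler_sum => m1 m1D.
  rewrite exchange_big /= mulr_natr -sumr_const; apply: ler_sum => m2 m2D.
  have pm : psi L (m2 - m1) <= hp nB.
    apply: le_trans (psiD cD sD cs1 L _ _) _; rewrite (psiN cN sN).
    move: m1D m2D; rewrite !inE => h1 h2.
    have : hp (nB' + 2) <= hp (nB + 2) by apply: hp_le; rewrite /nB' leq_add2r leq_addr.
    rewrite [hp (nB + 2)]hpD; have -> : hp 2 = 1/4 by rewrite /hp !exprS expr0; field.
    by have := hp_ge0 R nB; lra.
  by apply: le_trans (sum_translate A x (inv0 _ pm)); rewrite mulrBl lerB.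
pose f1 y := \sum_(u in B) ind A (x + y + u).
pose f2 y := \sum_(m1 in D) \sum_(m2 in D) ind A (x + y + (m2 - m1)).
(* The two densities are averaged together: at some y their sum is at least 2 (1 - 1/512) al, and
   neither exceeds 101/100 al. *)
have [|||y _ Hy] := @sum_exists_ge R G (ind B0) (fun y => f1 y / #|B|%:R + f2 y / #|D|%:R ^+ 2) (2 * (al - 2 * hp d0)).
- by move=> y; exact: ind_ge0.
- by rewrite sum_ind.
- rewrite sum_ind sum_indM big_split /= -!mulr_suml.
  have e1 : (al - 2 * hp d0) * #|B0|%:R <= (\sum_(i in B0) f1 i) / #|B|%:R by rewrite ler_pdivlMr.
  have e2 : (al - 2 * hp d0) * #|B0|%:R <= (\sum_(i in B0) f2 i) / #|D|%:R ^+ 2.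
    by rewrite ler_pdivlMr // exprn_gt0.
  by lra.
have u1 : f1 y / #|B|%:R <= 101/100 * al.
  by rewrite ler_pdivrMr // leNgt; exact: maxB.
have u2 : f2 y / #|D|%:R ^+ 2 <= 101/100 * al.
  rewrite ler_pdivrMr ?exprn_gt0 // expr2 mulrA mulr_natr -sumr_const; apply: ler_sum => m1 _.
  have := maxD (x + y - m1); rewrite -leNgt; apply: le_trans.
  by apply: ler_sum => m2 _; rewrite addrA addrAC.
pose t := x + y; pose A' := [set v | t + v \in A].
have indA' v : ind A' v = ind A (t + v) by rewrite /ind inE.
have AP3' v1 v2 v3 : v1 \in A' -> v2 \in A' -> v3 \in A' -> v1 + v3 = v2 *+ 2 -> v1 = v2.
  rewrite !inE => h1 h2 h3 e; apply: (addrI t); apply: (AP3 h1 h2 h3).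
  by rewrite addrACA e mulrnDl mulr2n.
have aE : #|A' :&: B|%:R = f1 y.
  rewrite /f1 -(sum_ind R) -sum_indM; apply: eq_bigr => v _; rewrite -/t -indA' /ind inE.
  by case: (v \in A'); case: (v \in B); rewrite /= ?mulr0 ?mulr1.
set a := #|A' :&: B|%:R / #|B|%:R : R.
have alo : 98/100 * al <= a by rewrite /a aE; move: Hy u2 d0al; set p1 := f1 y / _; set p2 := f2 y / _; lra.
have ahi : a <= 101/100 * al by rewrite /a aE.
have aq : hp q.+1 <= a by rewrite hpS; lra.
have a0 : 0 < a by lra.
have f2lo : 98/100 * al <= f2 y / #|D|%:R ^+ 2.
  by move: Hy u1 d0al; set p1 := f1 y / _; set p2 := f2 y / _; lra.
have AD : a / 2 * #|D|%:R ^+ 2 <= \sum_(m1 in D) \sum_(m2 in D) ind A' (m2 - m1).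
  have -> : \sum_(m1 in D) \sum_(m2 in D) ind A' (m2 - m1) = f2 y.
    by apply: eq_bigr => m1 _; apply: eq_bigr => m2 _; rewrite indA'.
  by rewrite -ler_pdivlMr ?exprn_gt0 //; lra.
have Binv d : psi L d <= 4 * rD -> shift_err B d <= a / 32 * #|B|%:R.
  move=> pd; apply: le_trans (invB d _) _.
    apply: le_trans pd _; move: rDb; rewrite hpD.
    have -> : hp 2 = 1/4 by rewrite /hp !exprS expr0; field.
    by lra.
  by rewrite ler_wpM2r ?ler0n //; lra.
have Nbig : 16 <= a ^+ 2 * #|B|%:R.
  have v1 : 2 ^+ (2 * q + 6) <= #|B|%:R :> R.
    rewrite -natrX ler_nat; apply: leq_trans vol (subset_leq_card (ball_sub _ _ _ _)).
    apply: le_trans rBa; apply: hp_le; exact: ball_radius_index.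
  have v2 : hp q.+1 ^+ 2 <= a ^+ 2 by apply: lerXn2r; rewrite ?nnegrE ?hp_ge0 ?(ltW a0).
  have v3 : hp q.+1 ^+ 2 * 2 ^+ (2 * q + 6) = 16.
    rewrite hpX double_exponent.
    by rewrite exprD mulrA hp2 mul1r !exprS expr0; lra.
  rewrite -v3; apply: ler_pM => //; first by rewrite exprn_ge0 ?hp_ge0.
  by rewrite exprn_ge0.
have k8 := par_k_ge8 q1.
have l0 : (0 < l)%N by [].
have lhp : l%:R * hp l <= 1 by exact: hp_nat.
have lR : 0 < l%:R :> R by rewrite ltr0n.
have Ereg : #|ball L (rD + (l * 2)%:R * r2)|%:R <= 2 * #|D|%:R :> R.
  apply: le_trans (_ : #|ball L (rD + hp nD')|%:R <= _).
    rewrite ler_nat subset_leq_card // ball_sub // lerD2l.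
    have r2l : r2 <= hp nD' * hp l / 2 by apply: le_trans r2b _; rewrite addn1 hpS hpD.
    have := ler_wpM2l (ltW lR) r2l; have := ler_wpM2l (hp_ge0 R nD') lhp.
    by rewrite natrM; lra.
  apply: le_trans regD _; rewrite ler_wpM2r ?ler0n //.
  by have := hp_le R (leq0n d0); rewrite [hp 0]expr0; lra.
have [ak n1' n2' [n2'' n3 n3']] := par_numeric a0 aq.
set K0 := par_K0 q in n3 n3'; pose eps := hp (par_e q); pose kap := hp (2 * K0).
have [Lam [sLam HLam]] := increment_core c0 cD sD cN sN cs1 orth AP3' (ball_sym cN sN L rB) Binv Nbig k8 ak
  (ltW rDp) (ltW r2p) AD Ereg l0 (par_kk_gt0 q) n1' n2' n2'' (hp_gt0 R _) n3 n3'.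
move: HLam {n1' n2' n2'' n3 n3' ak sLam} (sLam) => HLam sLam.
exists [seq half * l | l <- L ++ Lam]; split.
  by rewrite size_map size_cat leq_add2l.
move=> r rp rn.
have [|u uC|z Hz] := HLam (ball (L ++ Lam) r).
- by apply: ball_card_gt0 => //; exact: ltW.
- move: uC; rewrite inE psi_cat => pu.
  have pL := psi_ge0 c s L u; have pLam := psi_ge0 c s Lam u.
  have rn2 : r <= hp n2 by apply: le_trans rn _; apply: hp_le; rewrite -n2W -addnA leq_addr.
  have re : r <= eps / 2 by apply: le_trans rn _; rewrite -hpS; apply: hp_le; rewrite -n2W addn1 ltnS leq_addl.
  split; last by apply: le_trans re; apply: le_trans pu; rewrite lerDr.
  apply: le_trans (inv2 u _) _; first by apply: le_trans rn2; apply: le_trans pu; rewrite lerDl.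
  rewrite ler_wpM2r ?ler0n // /par_d !hpD -/K0 -/kap -/eps.
  have -> : hp 3 = 1/8 by rewrite /hp !exprS expr0; field.
  have gen (k' e : R) : 2 * (k' * e * (1/8)) = k' * (e / 4) by field.
  by rewrite gen.
exists (t + z); rewrite sum_ball_half card_ball_half.
apply: le_trans (_ : 17 / 16 * a * #|ball (L ++ Lam) r|%:R <= _).
  by rewrite ler_wpM2r ?ler0n //; apply: gain_bound.
by apply: le_trans Hz _; apply: ler_sum => u _; rewrite indA' addrA.
Qed.

End Params.
End Step.

(** * Iteration *)

Lemma fibre_pigeonhole (I T : finType) (X : {set I}) (f : I -> T) (t0 : T) :
  exists t, (#|X| <= #|[set x in X | f x == t]| * #|T|)%N.
Proof.
have E : #|X| = (\sum_t #|[set x in X | f x == t]|)%N.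
  rewrite -sum1_card (partition_big f xpredT) //=; apply: eq_bigr => t _.
  by rewrite -sum1_card; apply: eq_bigl => x; rewrite inE.
pose t1 := [arg max_(t > t0) #|[set x in X | f x == t]|].
exists t1; rewrite {1}E mulnC -sum_nat_const; apply: leq_sum => t _.
by rewrite /t1; case: arg_maxnP => // t' _; exact.
Qed.

(* The density gains a factor 201/200 per step, hence exceeds 1 after par_J steps. *)
Definition par_J q := (200 * q.+1)%N.
(** For groups of order at least 2^par_P, every ball met during the iteration still has the 2^(2q+6)
    points demanded by a step. *)
Definition par_P q := (2 * q + 6 + 2 * (par_J q * par_W q + 2 * q + 13 + 3 + par_J q * par_K0 q) * (par_J q * par_K0 q))%N.

Section Iterate.
Variables (R : realType) (G : finComNzRingType) (c s : G -> R).
Hypothesis c0 : c 0 = 1.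
Hypothesis cD : forall x y, c (x + y) = c x * c y - s x * s y.
Hypothesis sD : forall x y, s (x + y) = s x * c y + c x * s y.
Hypothesis cN : forall x, c (- x) = c x.
Hypothesis sN : forall x, s (- x) = - s x.
Hypothesis cs1 : forall x, c x ^+ 2 + s x ^+ 2 = 1.
Hypothesis orth : forall x, x != 0 -> \sum_xi c (xi * x) = 0.
Variable half : G.
Hypothesis halfP : half *+ 2 = 1.
Local Notation psi := (psi c s).
Local Notation chord := (chord c s).
Local Notation ind := (ind R).
Local Notation ball := (ball c s).
Local Notation hp := (hp R).

Lemma trunc_close (m : nat) (x y : R) : (0 < m)%N -> -1 <= x -> -1 <= y ->
  Num.trunc ((x + 1) * m%:R / 2) = Num.trunc ((y + 1) * m%:R / 2) -> `|x - y| <= 2 / m%:R.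
Proof.
move=> m0 x1 y1 e; have mR : 0 < m%:R :> R by rewrite ltr0n.
have X0 : 0 <= (x + 1) * m%:R / 2 by rewrite divr_ge0 ?mulr_ge0 ?(ltW mR) //; lra.
have Y0 : 0 <= (y + 1) * m%:R / 2 by rewrite divr_ge0 ?mulr_ge0 ?(ltW mR) //; lra.
have /andP[a1 a2] := truncn_itv X0; have /andP[b1 b2] := truncn_itv Y0.
rewrite e in a1 a2; rewrite -[(Num.trunc _).+1%:R]natr1 in a2 b2.
rewrite ler_pdivlMr // -{1}(gtr0_norm mR) -normrM.
have -> : (x - y) * m%:R = 2 * ((x + 1) * m%:R / 2 - (y + 1) * m%:R / 2) by field.
move: a1 a2 b1 b2; move: ((x + 1) * _ / 2) ((y + 1) * _ / 2) => u v a1 a2 b1 b2.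
rewrite ler_norml; apply/andP; split; lra.
Qed.

Lemma trunc_le (m : nat) (x : R) : x <= 1 -> (Num.trunc ((x + 1) * m%:R / 2) < m.+1)%N.
Proof.
move=> x1; rewrite ltnS truncn_le_nat -[m.+1%:R]natr1.
have : 0 <= (1 - x) * m%:R by rewrite mulr_ge0 ?ler0n //; lra.
lra.
Qed.

(** The square [-1, 1]^2 is cut into cells of side 2/m; if e(g x) and e(g y) share a cell, their
    distance is at most sqrt 8 / m <= 3/m. The coordinate 1 falls into an extra cell, hence m +
    1. *)
Lemma cell_pigeonhole (X : {set G}) (m : nat) g : (0 < m)%N ->
  exists X' : {set G}, [/\ X' \subset X, (#|X| <= #|X'| * m.+1 ^ 2)%N &
    forall x y, x \in X' -> y \in X' -> chord (g * (x - y)) <= 3 / m%:R].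
Proof.
move=> m0; have mR : 0 < m%:R :> R by rewrite ltr0n.
pose cell x : 'I_m.+1 * 'I_m.+1 := (inord (Num.trunc ((c (g * x) + 1) * m%:R / 2)),
  inord (Num.trunc ((s (g * x) + 1) * m%:R / 2))).
have [t Ht] := fibre_pigeonhole X cell (ord0, ord0).
exists [set x in X | cell x == t]; split.
- by apply/subsetP => x; rewrite inE => /andP[].
- by move: Ht; rewrite card_prod card_ord.
move=> x y; rewrite !inE => /andP[_ /eqP cx] /andP[_ /eqP cy].
have := etrans cx (esym cy); rewrite /cell => -[].
have bc z : -1 <= c z <= 1 by rewrite -ler_norml (c_le1 cs1).
have bs z : -1 <= s z <= 1 by rewrite -ler_norml (s_le1 cs1).
move=> /(congr1 (@nat_of_ord _)); rewrite !inordK ?trunc_le //; try by case/andP: (bc (g * x)); case/andP: (bc (g * y)).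
move=> e1 /(congr1 (@nat_of_ord _)); rewrite !inordK ?trunc_le //; try by case/andP: (bs (g * x)); case/andP: (bs (g * y)).
move=> e2.
have h1 : `|c (g * x) - c (g * y)| <= 2 / m%:R.
  by apply: trunc_close => //; [case/andP: (bc (g * x))|case/andP: (bc (g * y))].
have h2 : `|s (g * x) - s (g * y)| <= 2 / m%:R.
  by apply: trunc_close => //; [case/andP: (bs (g * x))|case/andP: (bs (g * y))].
have E : chord (g * (x - y)) ^+ 2 = (c (g * x) - c (g * y)) ^+ 2 + (s (g * x) - s (g * y)) ^+ 2.
  rewrite chord_sqr mulrBr; have e := cs1 (g * x - g * y); have := cs1 (g * x); have := cs1 (g * y).
  have -> : (1 - c (g * x - g * y)) ^+ 2 + s (g * x - g * y) ^+ 2 = 2 - 2 * c (g * x - g * y).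
    by rewrite -[in RHS](_ : 1 + 1 = 2) // -{2}e; ring.
  by rewrite cD cN sN; move: (c (g * x)) (s (g * x)) (c (g * y)) (s (g * y)) => u v w z; rewrite !expr2; lra.
rewrite -(@ler_pXn2r _ 2) ?nnegrE ?chord_ge0 ?divr_ge0 ?ler0n // E.
have sq (u v : R) : `|u| <= v -> u ^+ 2 <= v ^+ 2.
  move=> uv; rewrite -[u ^+ 2]ger0_norm ?sqr_ge0 // normrX; apply: lerXn2r => //; rewrite nnegrE ?normr_ge0 //.
  by apply: le_trans uv; exact: normr_ge0.
have := sq _ _ h1; have := sq _ _ h2.
have -> : 2 / m%:R = 2 * (1 / m%:R) :> R by rewrite mulrA mulr1.
have -> : 3 / m%:R = 3 * (1 / m%:R) :> R by rewrite mulrA mulr1.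
move: (1 / m%:R : R) => i.
have := sqr_ge0 i; rewrite ![(_ * i) ^+ 2]exprMn; move: (i ^+ 2) => w w0.
rewrite (_ : (2 : R) ^+ 2 = 4); last by rewrite expr2 -natrM.
rewrite (_ : (3 : R) ^+ 2 = 9); last by rewrite expr2 -natrM.
lra.
Qed.

(** One pigeonhole per frequency leaves a set whose differences lie in the ball; subtracting one of
    its elements embeds it there. *)
Lemma volume L m : (0 < m)%N ->
  (#|G| <= #|ball L ((size L)%:R * (3 / m%:R))| * (m.+1 ^ 2) ^ size L)%N.
Proof.
move=> m0.
have [X' [X0 cX HX]] : exists X' : {set G}, [/\ (0 < #|X'|)%N, (#|G| <= #|X'| * (m.+1 ^ 2) ^ size L)%N &
   forall x y, x \in X' -> y \in X' -> psi L (x - y) <= (size L)%:R * (3 / m%:R)].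
  elim: L => [|l L [X [X0 cX HX]]].
    exists setT; split; [by rewrite cardsT; apply/card_gt0P; exists 0|by rewrite cardsT expn0 muln1|].
    by move=> x y _ _; rewrite /psi big_nil mul0r.
  have [X' [sX cX' HX']] := cell_pigeonhole X l m0.
  exists X'; split.
  - have := leq_trans X0 cX'; by rewrite muln_gt0 => /andP[].
  - apply: leq_trans cX _; rewrite /= (expnS (m.+1 ^ 2)) mulnA leq_mul2r; apply/orP; right; exact: cX'.
  - move=> x y xX yX; rewrite /psi big_cons -/(psi L (x - y)) /= -natr1 mulrDl mul1r addrC.
    apply: lerD; last exact: HX'.
    by apply: HX; exact: (subsetP sX).
have /card_gt0P[x0 x0X] := X0.
apply: leq_trans cX _; rewrite leq_mul2r; apply/orP; right.
rewrite -(card_imset (mem X') (addIr (- x0))); apply: subset_leq_card.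
by apply/subsetP => z /imsetP[x xX ->]; rewrite inE; exact: HX.
Qed.

Lemma volume_hp L n : (#|G| <= #|ball L (hp n)| * 2 ^ (2 * (n + 3 + size L) * size L))%N.
Proof.
have m0 : (0 < 2 ^ (n + 2 + size L))%N by rewrite expn_gt0.
apply: leq_trans (volume L m0) _; apply: leq_mul.
  apply: subset_leq_card; apply: ball_sub.
  rewrite natrX -hpV invrK !hpD.
  have -> : hp 2 = 1/4 by rewrite /hp !exprS expr0; field.
  have h := hp_nat R (size L); have := ler_wpM2l (hp_ge0 R n) h; have := hp_ge0 R n.
  by move: (hp n) (hp (size L)) ((size L)%:R : R) => x y z; lra.
rewrite -expnM; apply: leq_trans (_ : (2 ^ (n + 3 + size L)) ^ (2 * size L) <= _)%N.
  case: (size L) m0 => [|k] m0; first by rewrite muln0 !expn0.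
  rewrite leq_exp2r ?muln_gt0 //.
  rewrite (_ : n + 3 + k.+1 = (n + 2 + k.+1).+1)%N ?expnS; last by lia.
  by move: m0; move: (2 ^ _)%N => x; lia.
by rewrite -expnM leq_exp2l // mulnA [(_ * 2)%N]mulnC.
Qed.

Variable A : {set G}.
Hypothesis AP3 : forall x y z, x \in A -> y \in A -> z \in A -> x + z = y *+ 2 -> x = y.
Variable q : nat.
Hypothesis q1 : (1 <= q)%N.
Hypothesis Gq : (#|G| <= 2 ^ 2 ^ q)%N.
Hypothesis GP : (2 ^ par_P q <= #|G|)%N.
Hypothesis Aq : hp q * #|G|%:R <= #|A|%:R.
Local Notation dense := (dense c s A).

Lemma ball_large L n : (size L <= par_J q * par_K0 q)%N -> (n <= par_J q * par_W q)%N ->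
  (2 ^ (2 * q + 6) <= #|ball L (hp (n + 2 * q + 13))|)%N.
Proof.
move=> sL nW; have := leq_trans GP (volume_hp L (n + 2 * q + 13)).
rewrite /par_P; move: (par_J q * par_W q)%N (par_J q * par_K0 q)%N sL nW => w r sL nW.
set t := (2 * (w + _ + _ + _ + r) * r)%N; set t' := (2 * _ * size L)%N.
have tt' : (t' <= t)%N.
  rewrite /t /t'; apply: leq_mul => //; rewrite leq_mul2l /=.
  by apply: leq_add => //; rewrite leq_add2r leq_add2r leq_add2r.
rewrite expnD => H; rewrite -(leq_pmul2r (_ : 0 < 2 ^ t')%N) ?expn_gt0 //.
by apply: leq_trans H; rewrite leq_mul2l leq_exp2l // tt' orbT.
Qed.

Lemma iterate j : (j <= par_J q)%N -> exists L : seq G,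
  (size L <= j * par_K0 q)%N /\ dense L (j * par_W q) ((201/200) ^+ j * hp q).
Proof.
elim: j => [|j IH] jJ.
  exists [::]; split => // r r0 _; exists 0.
  have -> : ball [::] r = setT by apply/setP => x; rewrite !inE /psi big_nil ltW.
  rewrite cardsT expr0 mul1r; apply: le_trans Aq _; rewrite -(sum_ind R A) le_eqVlt; apply/orP; left.
  by apply/eqP; rewrite [RHS]big_mkcond /=; apply: eq_bigr => x _; rewrite inE add0r.
have [L [sL dL]] := IH (ltnW jJ).
have aq : hp q <= (201/200) ^+ j * hp q.
  by rewrite ler_peMl ?hp_ge0 // exprn_ege1 //; lra.
have bl := @ball_large L (j * par_W q) (leq_trans sL (leq_mul (ltnW jJ) (leqnn _))) (leq_mul (ltnW jJ) (leqnn _)).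
have [L' [sL' dL']] := step c0 cD sD cN sN cs1 orth halfP AP3 q1 Gq aq dL bl.
exists L'; split; first by rewrite mulSn addnC; apply: leq_trans sL' _; rewrite leq_add2r.
by rewrite mulSn addnC exprS -mulrA.
Qed.

(** (201/200)^200 >= 2 by Bernoulli, so 200 (q + 1) steps would lift the density 2^-q to at least
    2. *)
Lemma no_dense_AP3_free : False.
Proof.
have [L [_ dL]] := iterate (leqnn _).
have [x Hx] := dL _ (hp_gt0 R _) (lexx _).
have b0 : 0 < #|ball L (hp (par_J q * par_W q))|%:R :> R by rewrite ltr0n ball_card_gt0 // hp_ge0.
have up : \sum_(y in ball L (hp (par_J q * par_W q))) ind A (x + y) <= #|ball L (hp (par_J q * par_W q))|%:R.
  by rewrite -sum1_card natr_sum; apply: ler_sum => y _; exact: ind_le1.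
have := le_trans Hx up; apply/negP; rewrite -ltNge -[ltLHS]mul1r ltr_pM2r //.
rewrite /par_J exprM.
have b : 2 <= (201/200 : R) ^+ 200.
  have -> : (201/200 : R) = 1 + 1/200 by lra.
  by have := @expr_bernoulli R (1/200) 200; lra.
have : 2 ^+ q.+1 <= ((201/200 : R) ^+ 200) ^+ q.+1 by apply: lerXn2r; rewrite ?nnegrE //; lra.
move=> H; have := ler_wpM2r (hp_ge0 R q) H; rewrite exprS -mulrA [_ * hp q]mulrC hp2; lra.
Qed.

End Iterate.

(** * Characters of the cyclic group of odd order 2k + 3 *)

Section Cyclic.
Variables (R : realType) (k : nat).
Let M := k.*2.+3.
Local Notation G := 'I_(k.*2.+3).
Let ang (n : nat) : R := pi *+ 2 * n%:R / M%:R.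

Let angD m n : ang (m + n) = ang m + ang n.
Proof. by rewrite /ang natrD mulrDr mulrDl. Qed.

Let ang_mod n : cos (ang n) = cos (ang (n %% M)) /\ sin (ang n) = sin (ang (n %% M)).
Proof.
rewrite {1 3}(divn_eq n M) addnC angD.
elim: (n %/ M)%N => [|d [IH1 IH2]].
  by rewrite /ang mul0n mulr0 mul0r addr0.
have -> : ang (d.+1 * M) = ang (d * M) + pi *+ 2.
  by rewrite mulSn addnC angD; congr (_ + _); rewrite /ang mulfK // gt_eqF.
have P (x : R) : cos (x + pi *+ 2) = cos x by rewrite cosD cos2pi sin2pi mulr1 mulr0 subr0.
have Q (x : R) : sin (x + pi *+ 2) = sin x by rewrite sinD cos2pi sin2pi mulr1 mulr0 addr0.
by rewrite addrA P Q IH1 IH2.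
Qed.

Definition ccos (x : G) : R := cos (ang x).
Definition csin (x : G) : R := sin (ang x).

Lemma ccos0 : ccos 0 = 1.
Proof. by rewrite /ccos /ang mulr0 mul0r cos0. Qed.

Lemma ccosD x y : ccos (x + y) = ccos x * ccos y - csin x * csin y.
Proof. by rewrite /ccos /csin -cosD -angD; have [-> _] := ang_mod (x + y). Qed.

Lemma csinD x y : csin (x + y) = csin x * ccos y + ccos x * csin y.
Proof. by rewrite /ccos /csin -sinD -angD; have [_ ->] := ang_mod (x + y). Qed.

Lemma ccs1 x : ccos x ^+ 2 + csin x ^+ 2 = 1.
Proof. exact: cos2Dsin2. Qed.

Lemma csin0 : csin 0 = 0.
Proof. by rewrite /csin /ang mulr0 mul0r sin0. Qed.

Lemma ccosN x : ccos (- x) = ccos x.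
Proof.
have := ccosD x (- x); have := csinD x (- x); rewrite subrr ccos0 csin0 => e1 e2.
rewrite -[LHS]mul1r -(ccs1 x).
have -> : (ccos x ^+ 2 + csin x ^+ 2) * ccos (- x) =
  ccos x * (ccos x * ccos (- x) - csin x * csin (- x)) + csin x * (csin x * ccos (- x) + ccos x * csin (- x)) by ring.
by rewrite -e1 -e2 mulr1 mulr0 addr0.
Qed.

Lemma csinN x : csin (- x) = - csin x.
Proof.
have := ccosD x (- x); have := csinD x (- x); rewrite subrr ccos0 csin0 => e1 e2.
rewrite -[LHS]mul1r -(ccs1 x).
have -> : (ccos x ^+ 2 + csin x ^+ 2) * csin (- x) =
  ccos x * (csin x * ccos (- x) + ccos x * csin (- x)) - csin x * (ccos x * ccos (- x) - csin x * csin (- x)) by ring.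
by rewrite -e1 -e2 mulr1 mulr0 add0r.
Qed.

(** With u half the angle, 0 < u < pi and 1 - cos 2u = 2 sin^2 u > 0. *)
Lemma ccos_neq1 (x : G) : x != 0 -> ccos x != 1.
Proof.
move=> x0; have xn : (0 < x)%N by rewrite lt0n; apply: contraNN x0 => /eqP e; apply/eqP/val_inj.
pose u : R := pi * x%:R / M%:R.
have aE : ang x = u + u by rewrite /ang /u mulr2n !mulrDl.
have u0 : 0 < u < pi.
  rewrite divr_gt0 ?mulr_gt0 ?pi_gt0 ?ltr0n //= ltr_pdivrMr // ltr_pM2l ?pi_gt0 // ltr_nat.
  exact: ltn_ord.
have su := sin_gt0_pi u0.
rewrite /ccos aE cosD -!expr2; have := cos2Dsin2 u => e.
have : 0 < sin u ^+ 2 by rewrite exprn_gt0.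
by move=> h; rewrite neq_lt; apply/orP; left; lra.
Qed.

(** Shifting xi by 1 multiplies the sum of the characters by e(x), and its imaginary part vanishes
    by symmetry. *)
Lemma ccos_orth (x : G) : x != 0 -> \sum_xi ccos (xi * x) = 0.
Proof.
move=> x0; have S0 : \sum_xi csin (xi * x) = 0.
  have : \sum_xi csin (xi * x) = - \sum_xi csin (xi * x).
    by rewrite {1}(reindex_inj oppr_inj) /= -sumrN; apply: eq_bigr => xi _; rewrite mulNr csinN.
  by move=> H; lra.
have : \sum_xi ccos (xi * x) = \sum_xi ccos (xi * x) * ccos x - \sum_xi csin (xi * x) * csin x.
  by rewrite {1}(reindex_inj (addIr 1)) /= -sumrB; apply: eq_bigr => xi _; rewrite mulrDl mul1r ccosD.
rewrite -!mulr_suml S0 mul0r subr0 => H.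
have : (\sum_xi ccos (xi * x)) * (1 - ccos x) = 0 by rewrite mulrBr mulr1 -H subrr.
move/eqP; rewrite mulf_eq0 => /orP[/eqP //|]; rewrite subr_eq0 eq_sym => e.
by move: (ccos_neq1 x0); rewrite e.
Qed.

Definition chalf : G := (k.+2)%:R.

Lemma chalfP : chalf *+ 2 = 1.
Proof.
rewrite /chalf -mulrnA.
have -> : (k.+2 * 2 = k.*2.+3 + 1)%N by lia.
by rewrite Zp_nat; apply/val_inj; rewrite /= modnDl.
Qed.

Lemma AP3_free_cyclic (A : {set G}) q : (1 <= q)%N -> (k.*2.+3 <= 2 ^ 2 ^ q)%N ->
  (2 ^ par_P q <= k.*2.+3)%N -> (k.*2.+3 <= 2 ^ q * #|A|)%N ->
  (forall x y z, x \in A -> y \in A -> z \in A -> x + z = y *+ 2 -> x = y) -> False.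
Proof.
move=> q1 Gq GP Aq AP3.
apply: (@no_dense_AP3_free R G ccos csin ccos0 ccosD csinD ccosN csinN ccs1 ccos_orth chalf chalfP A AP3 q q1); rewrite ?card_ord //.
rewrite -(@ler_pM2l _ (2 ^+ q)) ?exprn_gt0 // mulrA [2 ^+ q * _]mulrC hp2 mul1r.
by rewrite -natrX -natrM ler_nat.
Qed.

End Cyclic.

End DensityIncrement.

(** * Progression-free sets of integers *)

Module Integers.
Import all_boot all_order all_algebra finalg zify reals Rstruct.
Import DensityIncrement.

Definition AP3_free (X N : nat) (P : pred nat) :=
  forall n d, 0 < d -> X < n -> n + 2 * d <= X + N -> P n -> P (n + d) -> P (n + 2 * d) -> False.

(* The interval embeds into the integers mod 2N+1: the modulus is odd, so 2 is invertible, and too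
   large for new progressions to wrap around. *)
Lemma AP3_free_sparse X k (P : pred nat) q (N := k.+1) : AP3_free X N P ->
  1 <= q -> k.*2.+3 <= 2 ^ 2 ^ q -> 2 ^ par_P q <= k.*2.+3 ->
  2 ^ q * count P (iota X.+1 N) < k.*2.+3.
Proof.
move=> free q1 Gq GP; rewrite ltnNge; apply/negP => big.
pose A : {set 'I_(k.*2.+3)} := [set x : 'I_(k.*2.+3) | (x < N) && P (X.+1 + x)].
have cA : #|A| = count P (iota X.+1 N).
  rewrite -sum1_card -sum1_count.
  rewrite (_ : iota X.+1 N = [seq X.+1 + i | i <- iota 0 N]); last by rewrite -{1}[X.+1]addn0 iotaDl.
  rewrite big_map -[iota 0 N]/(index_iota 0 N) big_mkord.
  have le : N <= k.*2.+3 by rewrite /N; lia.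
  rewrite (big_ord_widen_cond _ (fun i => P (X.+1 + i)) (fun _ => 1) le).
  by apply: eq_bigl => x; rewrite inE andbC.
apply: (@AP3_free_cyclic Rdefinitions.R k A q q1 Gq GP); first by rewrite cA.
have main (x z : 'I_(k.*2.+3)) (y : nat) : x < N -> z < N -> P (X.+1 + x) -> P (X.+1 + z) -> P (X.+1 + y) ->
   x + z = y.*2 -> x < y -> False.
  move=> xN zN Px Pz Py e xy; apply: (free (X.+1 + x) (y - x)); first by lia.
  - by lia.
  - by move: xN zN; rewrite /N; lia.
  - exact: Px.
  - by rewrite (_ : X.+1 + x + (y - x) = X.+1 + y) //; lia.
  - by rewrite (_ : X.+1 + x + 2 * (y - x) = X.+1 + z) //; lia.
move=> x y z; rewrite !inE GRing.mulr2n => /andP[xN Px] /andP[yN Py] /andP[zN Pz] /(congr1 val) /=.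
move=> e; have {}e : (x : nat) + z = (y : nat).*2.
  move: e; rewrite !modn_small -?addnn //; move: xN yN zN; rewrite /N; lia.
apply/val_inj => /=; case: (ltngtP x y) => // xy; exfalso.
  exact: (main x z y).
by apply: (main z x y) => //; lia.
Qed.

(** * Polynomial growth of the parameters and the bound for progression-free sets *)

Definition poly_bounded (f : nat -> nat) := exists C E, forall q, 1 <= q -> f q <= C * q ^ E.

Lemma poly_bounded_const c : poly_bounded (fun=> c).
Proof. by exists c, 0 => q _; rewrite expn0 muln1. Qed.

Lemma poly_bounded_id : poly_bounded id.
Proof. by exists 1, 1 => q _; rewrite expn1 mul1n. Qed.

Lemma poly_bounded_add f g : poly_bounded f -> poly_bounded g -> poly_bounded (fun q => f q + g q).
Proof.
move=> [C [E H]] [C' [E' H']]; exists (C + C'), (E + E') => q q1.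
rewrite mulnDl; apply: leq_add.
  by apply: leq_trans (H q q1) _; rewrite leq_mul2l leq_pexp2l ?leq_addr ?orbT.
by apply: leq_trans (H' q q1) _; rewrite leq_mul2l leq_pexp2l ?leq_addl ?orbT.
Qed.

Lemma poly_bounded_mul f g : poly_bounded f -> poly_bounded g -> poly_bounded (fun q => f q * g q).
Proof.
move=> [C [E H]] [C' [E' H']]; exists (C * C'), (E + E') => q q1.
by rewrite expnD mulnACA; apply: leq_mul; [exact: H|exact: H'].
Qed.

Lemma poly_bounded_par_P : poly_bounded par_P.
Proof.
have ext f g : f =1 g -> poly_bounded g -> poly_bounded f.
  by move=> fg [c [E H]]; exists c, E => q q1; rewrite fg H.
have S f : poly_bounded f -> poly_bounded (fun q => (f q).+1).
  by move=> pf; apply: ext (poly_bounded_add pf (poly_bounded_const 1)) => q; rewrite addn1.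
have k : poly_bounded par_k by apply: poly_bounded_add (poly_bounded_const 6); apply: poly_bounded_mul poly_bounded_id; exact: poly_bounded_const.
have k2 : poly_bounded (fun q => (par_k q).*2) by apply: ext (poly_bounded_add k k) => q; rewrite -addnn.
have p : poly_bounded par_p by exact: poly_bounded_mul (poly_bounded_const 4) (S _ k2).
have g : poly_bounded par_g by exact: poly_bounded_mul (S _ poly_bounded_id) p.
have e : poly_bounded par_e by apply: poly_bounded_add g (poly_bounded_const 15).
have l : poly_bounded par_l by exact: (S _ e).
have kk : poly_bounded par_kk.
  apply: poly_bounded_mul; last by apply: poly_bounded_add (poly_bounded_const 12); exact: poly_bounded_add.
  apply: poly_bounded_mul (poly_bounded_const 8) _; have l4 := poly_bounded_mul (poly_bounded_const 400) l.
  by apply: ext (poly_bounded_mul l4 l4) => q; rewrite -mulnn.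
have K0 : poly_bounded par_K0.
  by apply: poly_bounded_mul (poly_bounded_const 128) _; apply: poly_bounded_add (poly_bounded_const 3); exact: poly_bounded_mul (S _ g) kk.
have d : poly_bounded par_d.
  by apply: poly_bounded_add (poly_bounded_const 3); apply: poly_bounded_add e; apply: poly_bounded_mul (poly_bounded_const 2) K0.
have W : poly_bounded par_W.
  apply: poly_bounded_add (poly_bounded_const 1); apply: poly_bounded_add e; apply: poly_bounded_add d;
  apply: poly_bounded_add l; apply: poly_bounded_add (poly_bounded_const 41);
  exact: poly_bounded_mul (poly_bounded_const 7) poly_bounded_id.
have J : poly_bounded par_J by exact: poly_bounded_mul (poly_bounded_const 200) (S _ poly_bounded_id).
have JK := poly_bounded_mul J K0; have JW := poly_bounded_mul J W.
have q2 := poly_bounded_mul (poly_bounded_const 2) poly_bounded_id.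
have T := poly_bounded_add (poly_bounded_add (poly_bounded_add (poly_bounded_add JW q2)
  (poly_bounded_const 13)) (poly_bounded_const 3)) JK.
exact: poly_bounded_add (poly_bounded_add q2 (poly_bounded_const 6))
  (poly_bounded_mul (poly_bounded_mul (poly_bounded_const 2) T) JK).
Qed.

(** With v the integer part of u/(E+1), each factor 2u + 2 is at most 2 (E+1) 2^v. The constants
    gather into K <= v <= 2^v, and v (E+1) <= u. *)
Lemma poly_le_exp C E : exists u0, forall u, u0 <= u -> C * (2 * u + 2) ^ E <= 2 ^ u.
Proof.
pose K := C * (2 * E.+1) ^ E; exists (E.+1 * K) => u uK.
pose v := u %/ E.+1.
have vu : v * E.+1 <= u by exact: leq_trunc_div.
have uv : u < v.+1 * E.+1 by rewrite ltn_ceil.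
have Kv : K <= v by rewrite leq_divRL // mulnC.
have v2 : v.+1 <= 2 ^ v by exact: ltn_expl.
have b1 : (2 * u + 2) ^ E <= (2 * E.+1) ^ E * 2 ^ (v * E).
  rewrite expnM -expnMn; case: (E) uv => [|E'] uv; first by rewrite !expn0.
  rewrite leq_exp2r //; apply: leq_trans (_ : 2 * E'.+2 * v.+1 <= _); first by lia.
  by rewrite leq_mul2l v2 orbT.
apply: leq_trans (_ : K * 2 ^ (v * E) <= _); first by rewrite /K -mulnA leq_mul2l b1 orbT.
apply: leq_trans (_ : 2 ^ v * 2 ^ (v * E) <= _).
  by rewrite leq_mul2r; apply/orP; right; apply: leq_trans Kv (ltnW v2).
by rewrite -expnD leq_exp2l // -mulnS.
Qed.

(* For q about 2 log log N, 2^q exceeds log^2 N while par_P q, polynomial in q, stays below log N. *)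
Theorem roth_log2 : exists C, forall X N (P : pred nat), AP3_free X N P ->
  count P (iota X.+1 N) * trunc_log 2 N ^ 2 <= C * N.
Proof.
have [C [E HP]] := poly_bounded_par_P.
have [u0 Hu] := poly_le_exp C E.
exists (3 + (2 ^ u0) ^ 2) => X N P free.
have cN : count P (iota X.+1 N) <= N by rewrite -{2}(size_iota X.+1 N) count_size.
case: N cN free => [|k] cN free; first by rewrite /= mul0n.
set N := k.+1 in cN free *; set t := trunc_log 2 N.
have [tb /andP[_ tu]] : 2 ^ t <= N /\ 2 ^ t <= N < 2 ^ t.+1.
  by have := trunc_log_bounds (isT : 1 < 2) (isT : 0 < N); move=> h; split=> //; case/andP: h.
rewrite mulnDl.
(* For bounded log N the trivial count N suffices; it accounts for the summand (2^u0)^2 of the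
   constant. *)
have [small|big] := ltnP t (2 ^ u0).
  apply: leq_trans (_ : N * (2 ^ u0) ^ 2 <= _); last by rewrite mulnC leq_addl.
  by apply: leq_mul => //; rewrite leq_exp2r // ltnW.
apply: leq_trans (_ : 3 * N <= _); last by rewrite leq_addr.
have t0 : 0 < t by apply: leq_trans big; rewrite expn_gt0.
pose u := trunc_log 2 t.
have /andP[ub uu] := trunc_log_bounds (isT : 1 < 2) t0; rewrite -/u in ub uu.
have u0u : u0 <= u.
  by rewrite -ltnS -(@ltn_exp2l 2) //; apply: leq_ltn_trans big _.
pose q := 2 * u + 2.
have Pq : par_P q <= t.
  apply: leq_trans (HP q _) _; first by rewrite /q addn2.
  exact: leq_trans (Hu u u0u) ub.
have q2 : t ^ 2 <= 2 ^ q.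
  rewrite /q (_ : 2 * u + 2 = u.+1 * 2); last by lia.
  by rewrite expnM leq_exp2r // ltnW.
have Gq : k.*2.+3 <= 2 ^ 2 ^ q.
  apply: leq_trans (_ : 2 ^ t.+2 <= _).
    by rewrite expnS; move: tu; rewrite /N; move: (2 ^ t.+1) => z; lia.
  rewrite leq_exp2l //; apply: leq_trans (_ : t.+1 ^ 2 <= _); first by rewrite -mulnn; lia.
  rewrite /q (_ : 2 * u + 2 = u.+1 * 2); last by lia.
  by rewrite expnM leq_exp2r.
have GP : 2 ^ par_P q <= k.*2.+3.
  apply: leq_trans (_ : 2 ^ t <= _); first by rewrite leq_exp2l.
  by apply: leq_trans tb _; rewrite /N; lia.
have q1 : 1 <= q by rewrite /q addn2.
have := AP3_free_sparse free q1 Gq GP; rewrite -/N => H.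
apply: leq_trans (_ : 2 ^ q * count P (iota X.+1 N) <= _).
  by rewrite mulnC leq_mul2r q2 orbT.
by apply: leq_trans (ltnW H) _; rewrite /N; lia.
Qed.

(** * Squarefull numbers *)

Lemma Nat_pow2 p : Nat.pow p 2 = p ^ 2.
Proof. by rewrite -mulnn -[LHS]/(p * (p * 1)) muln1. Qed.

Lemma squarefullP n : squarefull n -> 0 < n /\ forall p, p \in primes n -> p ^ 2 %| n.
Proof. by case/andP => n0 /allP H; split=> // p /H; rewrite Nat_pow2. Qed.

Lemma squarefullI n : 0 < n -> (forall p, p \in primes n -> p ^ 2 %| n) -> squarefull n.
Proof. by move=> n0 H; rewrite /squarefull n0; apply/allP => p /H; rewrite Nat_pow2. Qed.

Definition rad n := \prod_(p <- primes n) p.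

Lemma prod_primes_exp_dvd (s : seq nat) e X : uniq s -> all prime s ->
  (forall p, p \in s -> p ^ e %| X) -> \prod_(p <- s) p ^ e %| X.
Proof.
elim: s => [|p s IH] /=; first by rewrite big_nil dvd1n.
move=> /andP[ps us] /andP[pp aps] H; rewrite big_cons Gauss_dvd.
  rewrite H ?mem_head //=; apply: IH => // r rs; apply: H; by rewrite inE rs orbT.
rewrite big_seq; apply: (big_ind (fun m => coprime (p ^ e) m)).
- exact: coprimen1.
- by move=> m n h1 h2; rewrite coprimeMr h1.
move=> r rs; rewrite coprimeXl // coprimeXr // prime_coprime //.
rewrite dvdn_prime2 //; last exact: (allP aps).
by apply: contraNN ps => /eqP ->.
Qed.

Lemma prod_primes_dvd (s : seq nat) X : uniq s -> all prime s ->
  (forall p, p \in s -> p %| X) -> \prod_(p <- s) p %| X.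
Proof.
move=> us aps H; have := @prod_primes_exp_dvd s 1 X us aps.
rewrite (eq_bigr id) => [|p _]; last exact: expn1.
by apply => p ps; rewrite expn1 H.
Qed.

Lemma all_prime_primes n : all prime (primes n).
Proof. by apply/allP => p; rewrite mem_primes => /andP[]. Qed.

Lemma rad_gt0 n : 0 < rad n.
Proof.
rewrite /rad big_seq; apply: (big_ind (fun m => 0 < m)) => // [x y x0 y0|p]; first by rewrite muln_gt0 x0.
by rewrite mem_primes => /andP[/prime_gt0].
Qed.

Lemma rad_dvd n X : (forall p, p \in primes n -> p %| X) -> rad n %| X.
Proof. by apply: prod_primes_dvd; [exact: primes_uniq|exact: all_prime_primes]. Qed.

Lemma rad_le n : 0 < n -> rad n <= n.
Proof. by move=> n0; apply: dvdn_leq => //; apply: rad_dvd => p; rewrite mem_primes => /and3P[]. Qed.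

Lemma dvd_rad p n : p \in primes n -> p %| rad n.
Proof. by move=> pn; rewrite /rad (big_rem p) //= dvdn_mulr. Qed.

Lemma rad_mul m n : 0 < m -> 0 < n -> rad (m * n) <= rad m * rad n.
Proof.
move=> m0 n0; apply: dvdn_leq; first by rewrite muln_gt0 !rad_gt0.
apply: rad_dvd => p; rewrite primesM // => /orP[/dvd_rad h|/dvd_rad h]; [exact: dvdn_mulr|exact: dvdn_mull].
Qed.

Lemma rad_dvd_le m n : m %| n -> 0 < n -> rad m <= rad n.
Proof.
move=> mn n0; apply: dvdn_leq; first exact: rad_gt0.
apply: rad_dvd => p; rewrite mem_primes => /and3P[pp m0 pm]; apply: dvd_rad.
by rewrite mem_primes pp n0 (dvdn_trans pm mn).
Qed.

Lemma rad_sqr n : rad (n ^ 2) = rad n.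
Proof. by rewrite /rad primesX. Qed.

Lemma squarefull_rad n : squarefull n -> rad n ^ 2 <= n.
Proof.
case/squarefullP => n0 H; apply: dvdn_leq => //.
rewrite /rad (big_morph (fun m => m ^ 2) (id1 := 1) (op1 := muln)) //; last by move=> x y; rewrite expnMn.
by apply: prod_primes_exp_dvd; [exact: primes_uniq|exact: all_prime_primes|exact: H].
Qed.

(* Dividing by the gcd keeps the identity and only improves the radical bound, since the radical of
   d^2 / g is bounded by d^2 / g itself. *)
Lemma AP3_abc_triple n d : 0 < d -> d < n -> squarefull (n - d) -> squarefull n -> squarefull (n + d) ->
  exists a b c g, [/\ a + b = c, coprime a b, [&& 0 < a, 0 < b, 0 < c & 0 < g], c * g = n ^ 2 &
    (rad (a * b * c) * g) ^ 2 <= n ^ 3 * d ^ 4].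
Proof.
move=> d0 dn s1 s2 s3.
have n0 : 0 < n by exact: leq_ltn_trans dn.
pose x := (n - d) * (n + d); pose y := d ^ 2.
have x0 : 0 < x by rewrite muln_gt0 subn_gt0 dn addn_gt0 n0.
have y0 : 0 < y by rewrite expn_gt0 d0.
have xy : x + y = n ^ 2.
  by rewrite /x /y -!mulnn; move: dn; clear; nia.
pose g := gcdn x y.
have g0 : 0 < g by rewrite gcdn_gt0 x0.
have gx : g %| x by exact: dvdn_gcdl.
have gy : g %| y by exact: dvdn_gcdr.
have gz : g %| n ^ 2 by rewrite -xy dvdn_add.
pose a := x %/ g; pose b := y %/ g; pose c := n ^ 2 %/ g.
have aE : a * g = x by exact: divnK.
have bE : b * g = y by exact: divnK.
have cE : c * g = n ^ 2 by exact: divnK.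
have a0 : 0 < a by move: x0; rewrite -aE muln_gt0 => /andP[].
have b0 : 0 < b by move: y0; rewrite -bE muln_gt0 => /andP[].
have c0 : 0 < c by have : 0 < n ^ 2 by [rewrite expn_gt0 n0]; rewrite -cE muln_gt0 => /andP[].
exists a, b, c, g; split => //.
- by apply/eqP; rewrite -(eqn_pmul2r g0) mulnDl aE bE cE xy.
- rewrite /coprime; apply/eqP/eqP; rewrite -(eqn_pmul2r g0) muln_gcdl aE bE -/g mul1n //.
- by rewrite a0 b0 c0.
have ab0 : 0 < a * b by rewrite muln_gt0 a0.
have r1 : rad (a * b * c) <= rad a * rad b * rad c.
  by apply: leq_trans (rad_mul ab0 c0) _; rewrite leq_mul2r rad_mul ?orbT.
have r2 : rad a <= rad (n - d) * rad (n + d).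
  apply: leq_trans (rad_mul _ _); rewrite ?subn_gt0 ?addn_gt0 ?n0 //.
  by apply: rad_dvd_le => //; rewrite -/x -aE dvdn_mulr.
have r3 : rad c <= rad n.
  by rewrite -(rad_sqr n); apply: rad_dvd_le; [rewrite -cE dvdn_mulr|rewrite expn_gt0 n0].
have r4 := rad_le b0.
have q1 := squarefull_rad s1; have q2 := squarefull_rad s2; have q3 := squarefull_rad s3.
apply: leq_trans (_ : (rad (n - d) * rad (n + d) * b * rad n * g) ^ 2 <= _).
  rewrite leq_exp2r // leq_mul2r; apply/orP; right; apply: leq_trans r1 _.
  by apply: leq_mul => //; apply: leq_mul.
have -> : rad (n - d) * rad (n + d) * b * rad n * g = rad (n - d) * rad (n + d) * rad n * (b * g).
  by rewrite -!mulnA; congr (_ * (_ * _)); rewrite mulnCA.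
rewrite bE /y (expnMn _ (d ^ 2)) -(expnM d 2 2) leq_mul2r; apply/orP; right.
rewrite (expnMn _ (rad n)) (expnMn (rad (n - d))).
apply: leq_trans (_ : (n - d) * (n + d) * n <= _); first by apply: leq_mul => //; exact: leq_mul.
rewrite (_ : 3 = 2 + 1) // expnD expn1 leq_mul2r; apply/orP; right.
by rewrite -xy leq_addr.
Qed.

(** * Counting squarefull numbers through the form a^2 b^3 *)

Lemma squarefull_decomp n : squarefull n -> exists a b, [/\ n = a ^ 2 * b ^ 3, 0 < a & 0 < b].
Proof.
elim: n {-2}n (leqnn n) => [|N IH] n nN sn; first by move: sn nN; rewrite /squarefull; case: n.
case: (ltnP 1 n) => n1; last first.
  by exists 1, 1; split => //; move: sn n1; case/andP; case: n {nN} => [|[|]].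
have [n0 H] := squarefullP sn.
pose p := pdiv n; have pp : prime p by exact: pdiv_prime.
have pn : p \in primes n by rewrite mem_primes pp n0 pdiv_dvd.
have e2 : 1 < logn p n by rewrite -pfactor_dvdn // H.
have [m pm nE] := pfactor_coprime pp n0.
set e := logn p n in e2 nE.
have m0 : 0 < m by move: n0; rewrite nE muln_gt0 => /andP[].
have mn : m < n.
  rewrite nE ltn_Pmulr //; apply: leq_trans (prime_gt1 pp) _.
  apply: leq_trans (_ : p ^ 1 <= _); first by rewrite expn1.
  by rewrite leq_pexp2l ?(prime_gt0 pp) //; exact: ltnW e2.
have sm : squarefull m.
  apply: squarefullI => // r; rewrite mem_primes => /and3P[pr _ rm].
  have rp : r != p by apply: contraTneq rm => ->; rewrite -prime_coprime.
  have : r ^ 2 %| n by apply: H; rewrite mem_primes pr n0 nE dvdn_mulr.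
  rewrite nE Gauss_dvdl // coprimeXl // coprimeXr // prime_coprime // dvdn_prime2 //.
have [|a [b [mE a0 b0]]] := IH m _ sm; first by rewrite -ltnS; apply: leq_trans nN.
have p0 := prime_gt0 pp.
(* An odd exponent is at least 3 and splits as 3 + 2 ((e - 3) / 2), the 3 going to b^3; an even one
   goes entirely to a^2. *)
case: (boolP (odd e)) => oe.
  exists (a * p ^ ((e - 3) %/ 2)), (b * p); rewrite !muln_gt0 a0 b0 expn_gt0 p0; split => //.
  rewrite {1}nE {1}mE !expnMn -expnM.
  have {1}-> : e = (e - 3) %/ 2 * 2 + 3 by move: oe e2; clear; lia.
  by rewrite expnD mulnACA.
exists (a * p ^ (e %/ 2)), b; rewrite !muln_gt0 a0 b0 expn_gt0 p0; split => //.
rewrite {1}nE {1}mE !expnMn -expnM.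
have {1}-> : e = e %/ 2 * 2 by move: oe; clear; lia.
by rewrite mulnAC.
Qed.

(** From the least argument with value above X on, values increase by at least w per step, so N/w +
    1 consecutive arguments exhaust the window. *)
Lemma window_cover (h : nat -> nat) X N w : 0 < w -> (exists a, X < h a) ->
  (forall a a', a <= a' -> X < h a -> (a' - a) * w <= h a' - h a) ->
  exists2 s, size s = (N %/ w).+1 & forall a, X < h a -> h a <= X + N -> h a \in s.
Proof.
move=> w0 ex gap; exists [seq h a | a <- iota (ex_minn ex) (N %/ w).+1]; first by rewrite size_map size_iota.
move=> a Xa aN; apply: map_f.
case: ex_minnP => a0 Xa0 min; have le := min a Xa.
rewrite mem_iota le /= addnS ltnS -leq_subLR leq_divRL //.
by apply: leq_trans (gap _ _ le Xa0) _; lia.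
Qed.

Lemma union_cover (Q : nat -> nat -> Prop) K r :
  (forall b, b < r -> exists2 s : seq nat, size s <= K & forall n, Q b n -> n \in s) ->
  exists2 s : seq nat, size s <= r * K & forall b n, b < r -> Q b n -> n \in s.
Proof.
elim: r => [|r IH] H; first by exists [::].
have [b br|s sK Hs] := IH; first by apply: H; exact: ltnW.
have [s' sK' Hs'] := H r (ltnSn r).
exists (s' ++ s); first by rewrite size_cat mulSn leq_add.
move=> b n; rewrite ltnS leq_eqVlt mem_cat => /orP[/eqP -> /Hs' -> //|br Qb].
by rewrite (Hs b n br Qb) orbT.
Qed.

(* If a^2 b^3 < r^5 then a < r or b < r; fixing the smaller one, the values of the other give points at
   mutual distance at least w. *)
Lemma squarefull_count X N w r : 0 < w -> w ^ 2 <= X -> X + N < r ^ 5 ->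
  count squarefull (iota X.+1 N) <= 2 * r * (N %/ w).+1.
Proof.
move=> w0 wX rX; set K := (N %/ w).+1.
pose Q b n := exists a, [/\ n = a ^ 2 * b ^ 3, X < n & n <= X + N].
pose Q' a n := exists b, [/\ n = a ^ 2 * b ^ 3, X < n & n <= X + N].
have [b br|sA sAK HA] := @union_cover Q K r.
  case: (posnP b) => [->|b0].
    by exists [::] => // n [a [-> ]]; rewrite muln0.
  have [||s sK Hs] := @window_cover (fun a => a ^ 2 * b ^ 3) X N w w0; last 1 first.
  - by exists s; rewrite ?sK // => n [a [-> h1 h2]]; exact: Hs.
  - exists X.+1; apply: leq_trans (_ : X.+1 ^ 2 <= _); first by rewrite -mulnn leq_pmulr.
    by rewrite leq_pmulr // expn_gt0 b0.
  - move=> a a' aa' Xa; rewrite -mulnBl.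
    (* (a b^3)^2 >= a^2 b^3 > X >= w^2, while a'^2 - a^2 >= (a' - a) a. *)
    have wb : w <= a * b ^ 3.
      rewrite -(@leq_exp2r _ _ 2) //; apply: leq_trans wX _; apply: leq_trans (ltnW Xa) _.
      by rewrite expnMn leq_mul2l -expnM leq_pexp2l ?orbT.
    apply: leq_trans (_ : (a' - a) * (a * b ^ 3) <= _); first by rewrite leq_mul2l wb orbT.
    by rewrite mulnA leq_mul2r subn_sqr leq_mul2l leq_addl !orbT.
have [a ar|sB sBK HB] := @union_cover Q' K r.
  case: (posnP a) => [->|a0].
    by exists [::] => // n [b [-> ]]; rewrite mul0n.
  have [||s sK Hs] := @window_cover (fun b => a ^ 2 * b ^ 3) X N w w0; last 1 first.
  - by exists s; rewrite ?sK // => n [b [-> h1 h2]]; exact: Hs.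
  - exists X.+1; apply: leq_trans (_ : X.+1 ^ 3 <= _); first by rewrite -{1}(expn1 X.+1) leq_pexp2l.
    by rewrite leq_pmull // expn_gt0 a0.
  - move=> b b' bb' Xb; rewrite -mulnBr.
    have b0 : 0 < b by case: b Xb {bb'} => //; rewrite muln0.
    have wb : w <= a ^ 2 * b ^ 2.
      rewrite -(@leq_exp2r _ _ 2) //; apply: leq_trans wX _; apply: leq_trans (ltnW Xb) _.
      by rewrite expnMn -!expnM leq_mul // leq_pexp2l.
    apply: leq_trans (_ : (b' - b) * (a ^ 2 * b ^ 2) <= _); first by rewrite leq_mul2l wb orbT.
    rewrite mulnCA leq_mul2l; apply/orP; right.
    rewrite leq_subRL ?leq_exp2r // [b ^ 3]expnS -mulnDl subnKC // [b' ^ 3]expnS.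
    by rewrite leq_mul2l leq_exp2r ?bb' ?orbT.
rewrite -size_filter; apply: leq_trans (_ : size (sA ++ sB) <= _).
  apply: uniq_leq_size; first by rewrite filter_uniq // iota_uniq.
  move=> n; rewrite mem_filter mem_iota => /andP[/squarefull_decomp[a [b [nE a0 b0]]] /andP[Xn nN]].
  have nN' : n <= X + N by rewrite -ltnS -addSn.
  rewrite mem_cat; case: (ltnP b r) => br; first by rewrite (HA b n br) //; exists a.
  case: (ltnP a r) => ar; first by rewrite (HB a n ar) ?orbT //; exists b.
  exfalso; move: rX; rewrite ltnNge => /negP; apply; apply: leq_trans nN'.
  by rewrite nE (_ : 5 = 2 + 3) // expnD leq_mul // leq_exp2r.
by rewrite size_cat -mulnA mul2n -addnn leq_add.
Qed.

End Integers.

(** * Squarefull numbers in short intervals *)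

Import Integers.
Delimit Scope nat_scope with N.

Lemma INR_muln m n : INR (m * n)%N = (INR m * INR n)%R.
Proof. by rewrite -multE mult_INR. Qed.

Lemma INR_addn m n : INR (m + n)%N = (INR m + INR n)%R.
Proof. by rewrite -plusE plus_INR. Qed.

Lemma INR_expn m n : INR (expn m n) = (INR m ^ n)%R.
Proof. by elim: n => [|n IH] //; rewrite expnS INR_muln IH. Qed.

Lemma INR_leq m n : (m <= n)%N -> (INR m <= INR n)%R.
Proof. by move/leP/le_INR. Qed.

Lemma INR_pos n : (0 < n)%N -> (0 < INR n)%R.
Proof. by move/ltP/lt_0_INR. Qed.

Lemma ltn_INR m n : (INR m < INR n)%R -> (m < n)%N.
Proof. by move/INR_lt/ltP. Qed.

Lemma ln_mono x y : (0 < x)%R -> (x <= y)%R -> (ln x <= ln y)%R.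
Proof.
move=> x0 [xy|<-]; last exact: Rle_refl.
exact: Rlt_le (ln_increasing _ _ x0 xy).
Qed.

Lemma exp_mono x y : (x <= y)%R -> (exp x <= exp y)%R.
Proof. by move=> [xy|<-]; [exact: Rlt_le (exp_increasing _ _ xy)|exact: Rle_refl]. Qed.

Lemma ln_ge0 x : (1 <= x)%R -> (0 <= ln x)%R.
Proof. by move=> x1; rewrite -ln_1; apply: ln_mono => //; lra. Qed.

Lemma coprime_Zgcd a b : coprime a b -> Z.gcd (Z.of_nat a) (Z.of_nat b) = 1%Z.
Proof.
move=> cab; have [g gE] := IZN _ (Z.gcd_nonneg (Z.of_nat a) (Z.of_nat b)).
have dv m : (Z.of_nat g | Z.of_nat m)%Z -> (g %| m)%N.
  move=> [z zE]; case: (posnP g) => [g0|g0].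
    by move: zE; rewrite g0 Z.mul_0_r => /(Nat2Z.inj _ 0) ->.
  have z0 : (0 <= z)%Z.
    by apply: (Z.mul_nonneg_cancel_r z (Z.of_nat g) _).1; [move/ltP: g0; lia|lia].
  have [k kE] := IZN _ z0.
  have -> : m = (k * g)%N by rewrite -multE; lia.
  exact: dvdn_mull.
have : (g %| gcdn a b)%N.
  by rewrite dvdn_gcd !dv // -gE; [exact: Z.gcd_divide_r|exact: Z.gcd_divide_l].
by rewrite gE (eqP cab) dvdn1 => /eqP ->.
Qed.

(** For d <= n^(9/40) the radical K satisfies K g <= n^(39/20), while c g = n^2. With eps = 1/100,
    the difference 2 - (101/100) (39/20) = 61/2000 exceeds 1/40, so log n <= 40 max(0, log C); the
    factor g >= 1 only helps. *)
Lemma abc_no_squarefull_AP3 : abc_conjecture -> exists X0 : R,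
  forall n d : nat, (0 < d)%N -> (d < n)%N -> (40 * ln (INR d) <= 9 * ln (INR n))%R ->
  squarefull (n - d) -> squarefull n -> squarefull (n + d) -> (INR n <= X0)%R.
Proof.
move=> abc; have e0 : (0 < 1/100)%R by lra.
have [C [C0 HC]] := abc _ e0; exists (exp (40 * Rmax 0 (ln C))) => n d d0 dn dn9 s1 s2 s3.
have [a [b [c [g [abc' cab /and4P[a0 b0 c0 g0] cg Kg]]]]] := AP3_abc_triple d0 dn s1 s2 s3.
have n0 : (0 < n)%N by exact: leq_ltn_trans dn.
have {HC} := HC (Z.of_nat a) (Z.of_nat b) (Z.of_nat c).
move/ltP in a0; move/ltP in b0; move/ltP in c0.
have nz (m : nat) : (0 < m)%coq_nat -> Z.of_nat m <> 0%Z by lia.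
move/(_ (nz _ a0) (nz _ b0) (nz _ c0)).
have E1 : (Z.of_nat a + Z.of_nat b = Z.of_nat c)%Z by rewrite -abc' -plusE Nat2Z.inj_add.
move/(_ E1 (coprime_Zgcd cab)).
have -> : kappa (Z.of_nat a * Z.of_nat b * Z.of_nat c) = INR (rad (a * b * c)).
  by rewrite /kappa -!Nat2Z.inj_mul Zabs2Nat.id.
set K := rad _ in Kg *.
move=> HC.
have K0 : (0 < INR K)%R by apply: INR_pos; exact: rad_gt0.
have cC : (INR c <= C * Rpower (INR K) (1 + 1/100))%R.
  apply: Rle_trans HC; rewrite INR_IZR_INZ; apply: IZR_le.
  rewrite !Z.abs_eq; lia.
have cR : (0 < INR c)%R by apply: lt_0_INR.
have gR : (0 < INR g)%R by apply: INR_pos.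
have nR : (0 < INR n)%R by apply: INR_pos.
have dR : (0 < INR d)%R by apply: INR_pos.
have P0 : (0 < Rpower (INR K) (1 + 1/100))%R by exact: exp_pos.
have l1 : (ln (INR c) <= ln C + (1 + 1/100) * ln (INR K))%R.
  by rewrite -ln_Rpower -ln_mult //; exact: ln_mono.
have l2 : (ln (INR c) + ln (INR g) = 2 * ln (INR n))%R.
  by rewrite -ln_mult // -INR_muln cg INR_expn ln_pow.
have l3 : (2 * (ln (INR K) + ln (INR g)) <= 3 * ln (INR n) + 4 * ln (INR d))%R.
  have := ln_mono _ (INR_leq Kg); rewrite INR_muln !INR_expn INR_muln.
  have KgR : (0 < INR K * INR g)%R by apply: Rmult_lt_0_compat.
  move/(_ (pow_lt _ 2 KgR)); rewrite ln_mult; try exact: pow_lt.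
  rewrite !ln_pow // ln_mult //=; lra.
have g1 : (0 <= ln (INR g))%R by apply: ln_ge0; apply: (INR_leq (m := 1)).
have m0 := Rmax_l 0 (ln C); have m1 := Rmax_r 0 (ln C).
rewrite -[INR n]exp_ln //; apply: exp_mono; lra.
Qed.

Lemma floor_natP x : (0 <= x)%R -> (INR (floor_nat x) <= x < INR (floor_nat x) + 1)%R.
Proof.
move=> x0; have [h1 h2] := base_Int_part x.
have z0 : (0 <= Int_part x)%Z.
  have : (-1 < Int_part x)%Z by apply: lt_IZR; lra.
  lia.
by rewrite /floor_nat INR_IZR_INZ Z2Nat.id //; lra.
Qed.

Section Final.
Variables x y : R.
Hypothesis x1 : (1 <= x)%R.
Hypothesis y1 : (1 <= y)%R.
Hypothesis yx : (y <= x)%R.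
Let X := floor_nat x.
Let N := (floor_nat (x + y) - X)%N.
Let cnt := count squarefull (iota X.+1 N).
Let Ly := ln (y + 1).

Let Xb : (INR X <= x < INR X + 1)%R. Proof. by apply: floor_natP; lra. Qed.
Let XNb : (INR (floor_nat (x + y)) <= x + y < INR (floor_nat (x + y)) + 1)%R. Proof. by apply: floor_natP; lra. Qed.

Let XleXN : (X <= floor_nat (x + y))%N.
Proof.
rewrite -ltnS; apply: ltn_INR; rewrite S_INR; move: Xb XNb; lra.
Qed.

Let XNE : (X + N = floor_nat (x + y))%N. Proof. exact: subnKC. Qed.

Let NE : INR N = (INR (floor_nat (x + y)) - INR X)%R.
Proof. by rewrite -XNE INR_addn; lra. Qed.

Lemma Q2_diff : (INR (Q2 (x + y)) - INR (Q2 x) = INR cnt)%R.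
Proof.
rewrite /Q2 -/X -XNE iotaD count_cat INR_addn add1n; rewrite -/cnt; lra.
Qed.

Let cntN : (cnt <= N)%N.
Proof. by have := count_size squarefull (iota X.+1 N); rewrite size_iota. Qed.

Let N2y : (INR N <= 2 * y)%R.
Proof. move: Xb XNb; rewrite NE; lra. Qed.

Let Ly0 : (0 < Ly)%R.
Proof. by rewrite -ln_1; apply: ln_increasing; lra. Qed.

(** Long intervals leave a saving of y^(1/9), as x^(1/5) <= y^(8/9) there. For t = (log y)/18 one
    has log(y + 1) <= 1 + 18 t <= 19 e^t, and 361 = 19^2. *)
Let Ly_sqr : (Ly * Ly <= 361 * exp (ln y / 9))%R.
Proof.
set t := (ln y / 18)%R.
have ly : (0 <= ln y)%R by exact: ln_ge0.
have e1 := exp_ineq1_le t.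
have h : (Ly <= 19 * exp t)%R.
  have -> : (19 * exp t = exp t + 18 * exp t)%R by lra.
  apply: (Rle_trans _ (1 + ln y)); last by rewrite /t in e1 *; lra.
  rewrite -[X in (X + _)%R]ln_exp -ln_mult; [|exact: exp_pos|lra].
  apply: ln_mono; first by lra.
  by have := exp_ineq1_le 1; nra.
have -> : (exp (ln y / 9) = exp t * exp t)%R by rewrite -exp_plus; congr exp; rewrite /t; lra.
by have := Ly0; nra.
Qed.

Lemma count_long_interval : (9 * ln x <= 40 * ln y)%R -> (INR cnt * (Ly * Ly) <= 10830 * y)%R.
Proof.
move=> big; have lx : (0 <= ln x)%R by exact: ln_ge0.
have ly : (0 <= ln y)%R by exact: ln_ge0.
have lyx : (ln y <= ln x)%R by apply: ln_mono; lra.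
set u := exp (ln x / 5); set v := exp (ln x / 2).
have u1 : (1 <= u)%R by have := exp_ineq1_le (ln x / 5); rewrite -/u; lra.
have v1 : (1 <= v)%R by have := exp_ineq1_le (ln x / 2); rewrite -/v; lra.
have u5 : (u ^ 5 = x)%R.
  have -> : (u ^ 5 = exp (ln x))%R by rewrite /u /= Rmult_1_r -!exp_plus; congr exp; lra.
  by apply: exp_ln; lra.
have v2 : (v * v = x)%R.
  have -> : (v * v = exp (ln x))%R by rewrite /v -!exp_plus; congr exp; lra.
  by apply: exp_ln; lra.
set r := (floor_nat (2 * u)).+1; set w := floor_nat v.
have rb : (2 * u < INR r <= 3 * u)%R.
  have := floor_natP (_ : 0 <= 2 * u)%R; rewrite /r S_INR => H; have := H _; lra.
have wb : (INR w <= v < INR w + 1)%R by apply: floor_natP; lra.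
have w0 : (0 < w)%N by apply: ltn_INR; rewrite /=; lra.
have w1 : (1 <= INR w)%R by exact: (INR_leq (m := 1)).
have wX : (expn w 2 <= X)%N.
  rewrite -ltnS; apply: ltn_INR; rewrite INR_expn S_INR /= Rmult_1_r.
  by have := Xb; nra.
have rX : (X + N < expn r 5)%N.
  apply: ltn_INR; rewrite XNE INR_expn.
  apply: (Rle_lt_trans _ (x + y)); first by case: XNb.
  apply: (Rlt_le_trans _ ((2 * u) ^ 5)); last by apply: pow_incr; lra.
  by rewrite Rpow_mult_distr u5 /=; lra.
have := INR_leq (squarefull_count w0 wX rX); rewrite -/cnt INR_muln INR_muln (S_INR (N %/ w)) => H.
have NwN : (INR (N %/ w) * INR w <= 2 * y)%R.
  by apply: Rle_trans N2y; rewrite -INR_muln; apply: INR_leq; exact: leq_trunc_div.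
have vw : (v <= 2 * INR w)%R by lra.
set D := INR (N %/ w) in H NwN.
have D0 : (0 <= D)%R by exact: pos_INR.
have Dv : (D * v <= 4 * y)%R by nra.
have e9 := exp_pos (ln y / 9); set z := exp (ln y / 9) in e9.
have uz : (u * z <= y)%R.
  rewrite /u /z -exp_plus -[X in (_ <= X)%R]exp_ln; last by lra.
  by apply: exp_mono; lra.
have uzv : (u * z <= v)%R.
  by rewrite /u /z /v -exp_plus; apply: exp_mono; lra.
have H2 : (INR cnt <= 6 * u * (D + 1))%R.
  apply: Rle_trans H _; rewrite (_ : INR 2 = 2)%R //; nra.
have Lq := Ly_sqr; rewrite -/z in Lq.
have c0 : (0 <= INR cnt)%R by exact: pos_INR.
apply: (Rle_trans _ (6 * u * (D + 1) * (361 * z))).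
  apply: Rmult_le_compat => //; have := Ly0; nra.
(* 2166 = 6 * 361; the bounds u z D <= v D <= 4 y and u z <= y then give 2166 * 5 = 10830. *)
have -> : (6 * u * (D + 1) * (361 * z) = 2166 * (u * z * D + u * z))%R by ring.
have : (u * z * D <= v * D)%R by apply: Rmult_le_compat_r.
lra.
Qed.

Lemma count_bounded_interval x0 : (x <= x0)%R -> (INR cnt * (Ly * Ly) <= 2 * (ln (x0 + 1) * ln (x0 + 1)) * y)%R.
Proof.
move=> xx0; have L1 : (Ly <= ln (x0 + 1))%R by apply: ln_mono; lra.
have c1 : (INR cnt <= 2 * y)%R by apply: Rle_trans N2y; exact: INR_leq.
have c0 : (0 <= INR cnt)%R by exact: pos_INR.
apply: (Rle_trans _ (2 * y * (ln (x0 + 1) * ln (x0 + 1)))); last by lra.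
have L0 := Ly0; apply: Rmult_le_compat => //; first by nra.
by apply: Rmult_le_compat; lra.
Qed.

(** Passage from the binary logarithm t of N to log(y + 1) <= t + 3, which is at most 4 t if t >= 1.
    If t = 0 the interval holds at most one integer and the summand 18 suffices. *)
Lemma count_AP3_free C : (cnt * expn (trunc_log 2 N) 2 <= C * N)%N ->
  (INR cnt * (Ly * Ly) <= (32 * INR C + 18) * y)%R.
Proof.
move=> HC; have C0 := pos_INR C; have c0 := pos_INR cnt; have L0 := Ly0.
have yN : (y < INR N + 1)%R by move: Xb XNb; rewrite NE; lra.
have cN := INR_leq cntN.
set t := trunc_log 2 N in HC.
case: (posnP N) => [N0|N0].
  have -> : cnt = 0%N by apply/eqP; rewrite -leqn0; move: cntN; rewrite N0.
  rewrite /= Rmult_0_l; nra.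
have /andP[_ tu] := trunc_log_bounds (isT : (1 < 2)%N) N0; rewrite -/t in tu.
have LN : (Ly <= INR t + 3)%R.
  have e1 := exp_ineq1_le 1.
  have p2 : (2 ^ (t + 3) <= exp (INR t + 3))%R.
    have -> : (INR t + 3 = INR (t + 3) * 1)%R by rewrite INR_addn /=; lra.
    elim: (t + 3)%N => [|k IH]; first by rewrite /= Rmult_0_l exp_0; lra.
    rewrite S_INR Rmult_plus_distr_r exp_plus Rmult_1_l /=.
    by have := exp_pos (INR k * 1); nra.
  rewrite -[X in (_ <= X)%R]ln_exp; apply: ln_mono; first by lra.
  apply: Rle_trans p2.
  have := INR_leq tu; rewrite S_INR INR_expn (_ : INR 2 = 2)%R // => tu'.
  have N1 : (1 <= INR N)%R by exact: (INR_leq (m := 1)).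
  have -> : (2 ^ (t + 3) = 2 ^ t * 8)%R by rewrite -plusE pow_add /=; lra.
  rewrite /= in tu'; lra.
case: (posnP t) => [t0|t0].
  have N1 : (INR N <= 1)%R by move: tu; rewrite t0 expn1 ltnS => /INR_leq.
  have : (Ly * Ly <= 9)%R by move: LN; rewrite t0 /=; nra.
  nra.
have t1 : (1 <= INR t)%R by exact: (INR_leq (m := 1)).
have := INR_leq HC; rewrite (INR_muln cnt) INR_expn INR_muln /= Rmult_1_r => HC'.
have LL : (Ly * Ly <= 16 * (INR t * INR t))%R by nra.
apply: (Rle_trans _ (INR cnt * (16 * (INR t * INR t)))); first by apply: Rmult_le_compat_l.
apply: (Rle_trans _ (16 * (INR C * INR N))); first by lra.
by have := N2y; nra.
Qed.

(** A progression inside the window has 2 d < N, hence d <= y, and its middle term exceeds x; so d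
    is at most the power 9/40 of the middle term. *)
Lemma AP3_free_short_interval X0 : (9 * ln x > 40 * ln y)%R -> (X0 < x)%R ->
  (forall n d : nat, (0 < d)%N -> (d < n)%N -> (40 * ln (INR d) <= 9 * ln (INR n))%R ->
    squarefull (n - d) -> squarefull n -> squarefull (n + d) -> (INR n <= X0)%R) ->
  AP3_free X N squarefull.
Proof.
move=> big xX0 noAP n d d0 Xn nN s1 s2 s3.
have nR : (x < INR (n + d))%R.
  have := INR_leq Xn; rewrite S_INR INR_addn; have := pos_INR d; have := Xb; lra.
have dR : (1 <= INR d)%R by exact: (INR_leq (m := 1)).
have dy : (INR d <= y)%R.
  have := INR_leq nN; rewrite XNE INR_addn INR_muln; have := INR_leq Xn; rewrite S_INR.
  have := Xb; have := XNb; rewrite (_ : INR 2 = 2)%R //; lra.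
have := noAP (n + d)%N d d0; rewrite addnK -addnA addnn -mul2n.
have n0 : (0 < n)%N by exact: leq_ltn_trans Xn.
rewrite -{1}[d]add0n ltn_add2r => /(_ n0) H.
suff : (INR (n + d) <= X0)%R by lra.
apply: H => //.
have l1 : (ln (INR d) <= ln y)%R by apply: ln_mono; lra.
have l2 : (ln x <= ln (INR (n + d)))%R by apply: ln_mono; lra.
lra.
Qed.

End Final.

Theorem theorem5 :
  abc_conjecture ->
  exists c C : R, (0 < c)%R /\ (0 < C)%R /\
  forall x y : R, (1 <= x)%R -> (1 <= y)%R -> (y <= x)%R ->
    (INR (Q2 (x + y)) - INR (Q2 x)
       <= C * (y / Rpower (ln (y + 1)) (1 + c)))%R.
Proof.
move=> abc; have [X0 noAP] := abc_no_squarefull_AP3 abc.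
have [C1 roth] := roth_log2.
set K := (10830 + 2 * (ln (X0 + 1) * ln (X0 + 1)) + (32 * INR C1 + 18))%R.
(* X0 + 1 may be nonpositive, where [ln] has a default value; being a square, the term is
   nonnegative anyway. *)
have q1 : (0 <= ln (X0 + 1) * ln (X0 + 1))%R by nra.
have C10 := pos_INR C1.
have K0 : (0 < K)%R by rewrite /K; lra.
exists 1%R, K; split; [lra|split=> // x y x1 y1 yx].
have L0 : (0 < ln (y + 1))%R by rewrite -ln_1; apply: ln_increasing; lra.
have -> : Rpower (ln (y + 1)) (1 + 1) = (ln (y + 1) * ln (y + 1))%R by rewrite Rpower_plus Rpower_1.
rewrite (Q2_diff x1 y1).
set cnt := count _ _; set L := ln (y + 1) in L0 *.
have LL : (0 < L * L)%R by nra.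
suff H : (INR cnt * (L * L) <= K * y)%R.
  apply: (Rmult_le_reg_r (L * L)) => //; rewrite (_ : K * (y / (L * L)) * (L * L) = K * y)%R //.
  by field; lra.
have p1 : (0 <= 2 * (ln (X0 + 1) * ln (X0 + 1)) * y)%R by nra.
have p2 : (0 <= (32 * INR C1 + 18) * y)%R by nra.
have p0 : (0 <= 10830 * y)%R by lra.
have split3 (a b c t : R) : (0 <= a * y)%R -> (0 <= b * y)%R -> (0 <= c * y)%R ->
    (t <= a * y \/ t <= b * y \/ t <= c * y)%R -> (t <= (a + b + c) * y)%R.
  by move=> ? ? ? h; rewrite !Rmult_plus_distr_r; lra.
apply: split3 => //.
have [big|big] := Rle_lt_dec (9 * ln x) (40 * ln y).
  by left; exact: count_long_interval.
right; have [xX0|xX0] := Rle_lt_dec x X0.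
  by left; exact: count_bounded_interval.
right; have free := AP3_free_short_interval x1 y1 big xX0 noAP.
exact: count_AP3_free (roth _ _ _ free).
Qed.
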